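(* Let $G$ and $H$ be finite metric spaces, and let $X$ and $Y$ be metric spaces, glued from $G$ and $H$, that differ by a sycamore twist. Then: (1) $\widetilde\chi(\mathcal{M}^\ell(X))=\widetilde\chi(\mathcal{M}^\ell(Y))$ for every $\ell\ge 0$. (2) The magnitudes of $X$ and $Y$ coincide: $\mathrm{Mag}(X)=\mathrm{Mag}(Y)$.
   Context: Gluing. Given isometric embeddings $i_G:K\hookrightarrow G$, $i_H:K\hookrightarrow H$ with $K$ nonempty compact (here $K$ is finite), the gluing $G\cup_{i_G,i_H}H$ is $G\sqcup H$ with $i_G(k)\sim i_H(k)$ for $k\in K$, with metric equal to $d_G$ on $G$, $d_H$ on $H$, and $d(x,y)=\min_{k\in K}(d_G(x,i_G(k))+d_H(i_H(k),y))$ for $x\in G$, $y\in H$. Sycamore twist. A point $y\in H$ projects to $i_H(K)$ if there is $\pi(y)\in i_H(K)$ with $d_H(k,y)=d_H(k,\pi(y))+d_H(\pi(y),y)$ for all $k\in i_H(K)$. Let $H_*$ be the set of $y\in H\setminus i_H(K)$ that project to $i_H(K)$, and $H_0=H\setminus(i_H(K)\cup H_* )$. Let $\alpha:K\to K$ be an isometry (a distance-preserving bijection) such that $d_H(h,i_H(k))=d_H(h,i_H(\alpha(k)))$ for all $h\in H_0$, $k\in K$. Let $X$ be the gluing obtained by identifying $i_G(k)$ with $i_H(k)$, and $Y$ the gluing obtained by identifying $i_G(k)$ with $i_H(\alpha(k))$ ($k\in K$). Then $X$ and $Y$ are said to differ by a sycamore twist. Magnitude homotopy type. For points write $d(x_0,\dots,x_n)=\sum_{i=1}^n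 d(x_{i-1},x_i)$. The causal order on $X\times\mathbb{R}$ is $(x,t)\le(x',t')$ iff $d(x,x')\le t'-t$. $\mathrm{Cau}^\ell(X;a,b)=\{(x,t)\in X\times[0,\ell]\mid d(a,x)\le t,\ d(x,b)\le\ell-t\}$. $\Delta P$ is the order complex of a poset $P$. $\Delta'\mathrm{Cau}^\ell(X;a,b)$ is the subcomplex of chains $(x_0,t_0)<\dots<(x_n,t_n)$ with $d(x_0,\dots,x_n)<\ell$. $\mathcal{M}^\ell(X;a,b)=|\Delta\mathrm{Cau}^\ell(X;a,b)|/|\Delta'\mathrm{Cau}^\ell(X;a,b)|$ (with $Y/\emptyset=Y\sqcup\{*\}$, $\emptyset/\emptyset=\{*\}$) and $\mathcal{M}^\ell(X)=\bigvee_{a,b\in X}\mathcal{M}^\ell(X;a,b)$. $\widetilde\chi(W)=\sum_{k\ge 0}(-1)^k\operatorname{rank}\widetilde H_k(W)$. Magnitude. Let $\mathscr{H}$ be the ring of Hahn series $\sum_{r\ge 0}c_rq^r$ ($r\in\mathbb{R}_{\ge 0}$, $c_r\in\mathbb{C}$) with well-ordered support. For a finite metric space $X$, $Z_X=(q^{d(x,y)})_{x,y\in X}$ is invertible over $\mathscr{H}$, with $Z_X^{-1}=\sum_{k\ge 0}(I-Z_X)^k$ converging $q$-adically, and $\mathrm{Mag}(X)=\sum_{x,y\in X}Z_X^{-1}(x,y)\in\mathscr{H}$. *)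

(* Defs.v *)
From HB Require Import structures.
From mathcomp Require Import all_boot all_order all_algebra.
From mathcomp Require Import generic_quotient finmap.
From mathcomp Require Import all_classical all_reals interval_inference.
From mathcomp Require Import topology normedtype wedge_sigT complex.
From mathcomp.multinomials Require Import freeg.
Set Implicit Arguments.
Unset Strict Implicit.
Unset Printing Implicit Defensive.
Import Order.TTheory GRing.Theory Num.Theory.
Import numFieldNormedType.Exports.
Local Open Scope classical_set_scope.
Local Open Scope quotient_scope.
Local Open Scope ring_scope.

#[short(type="finMetricType")]
HB.structure Definition FinMetric (R : numDomainType) :=
  { M of Finite M & Metric R M }.

Record isometric_embedding (R : realType) (A B : metricType R) := Embedding {
  embedding_fun :> A -> B;
  embeddingP : forall x y, mdist (embedding_fun x) (embedding_fun y) = mdist x y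
}.

Lemma embedding_inj (R : realType) (A B : metricType R)
    (f : isometric_embedding A B) : injective f.
Proof.
move=> x y fxy; apply: mdist_positivity; rewrite -(embeddingP f) fxy.
exact: mdistxx.
Qed.

Definition embedding_comp (R : realType) (A B C : metricType R)
    (g : isometric_embedding B C) (f : isometric_embedding A B) :
    isometric_embedding A C :=
  Embedding (fun x y => etrans (embeddingP g (f x) (f y)) (embeddingP f x y)).

Section Gluing.
Context (R : realType) (G H K : finMetricType R) (k0 : K).
Context (iG : isometric_embedding K G) (iH : isometric_embedding K H).

Definition gluing_rel (u v : G + H) : bool :=
  match u, v with
  | inl x, inl x' => x == x'
  | inr y, inr y' => y == y'
  | inl x, inr y | inr y, inl x => [exists k, (iG k == x) && (iH k == y)]
  end.

Let gluing_rel_refl : reflexive gluing_rel.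
Proof. by case=> x /=. Qed.

Let gluing_rel_sym : symmetric gluing_rel.
Proof. by case=> x [] y //=; rewrite eq_sym. Qed.

Let gluing_rel_trans : transitive gluing_rel.
Proof.
case=> y [] x [] z //=.
- by move=> /eqP-> /eqP->.
- by move=> /eqP->.
- by move=> + /eqP <-.
- move=> /existsP[k /andP[/eqP<- /eqP<-]] /existsP[k' /andP[/eqP e /eqP<-]].
  by rewrite (embedding_inj e).
- move=> /existsP[k /andP[/eqP<- /eqP<-]] /existsP[k' /andP[/eqP<- /eqP e]].
  by rewrite (embedding_inj e).
- by move=> + /eqP <-.
- by move=> /eqP->.
- by move=> /eqP-> /eqP->.
Qed.

Canonical gluing_equiv :=
  EquivRel gluing_rel gluing_rel_refl gluing_rel_sym gluing_rel_trans.

(* [k0] only witnesses that [K] is nonempty; the underlying set does not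
   depend on it, but the metric below is a metric only in that case. *)
Definition gluing : Type := let _ := k0 in {eq_quot gluing_equiv}.
HB.instance Definition _ := Choice.on gluing.
HB.instance Definition _ := EqQuotient.on gluing.
HB.instance Definition _ : isCountable gluing :=
  CanIsCountable (@reprK _ gluing).
HB.instance Definition _ : isFinite gluing := CanIsFinite (@reprK _ gluing).

Definition gluing_cross (x : G) (y : H) : R :=
  let F k := mdist x (iG k) + mdist (iH k) y in
  \big[Order.min/F k0]_(k : K) F k.

Definition gluing_dist (u v : G + H) : R :=
  match u, v with
  | inl x, inl x' => mdist x x'
  | inr y, inr y' => mdist y y'
  | inl x, inr y | inr y, inl x => gluing_cross x y
  end.

Lemma gluing_cross_le x y k :
  gluing_cross x y <= mdist x (iG k) + mdist (iH k) y.
Proof. exact: bigmin_le. Qed.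

Lemma gluing_crossE x y :
  exists k, gluing_cross x y = mdist x (iG k) + mdist (iH k) y.
Proof.
rewrite /gluing_cross.
elim/big_ind: _ => [|a b [k ->] [k' ->]|k _]; first by exists k0.
  by rewrite /Order.min; case: ifP => _; [exists k|exists k'].
by exists k.
Qed.

Lemma gluing_crossl k y : gluing_cross (iG k) y = mdist (iH k) y.
Proof.
apply/eqP; rewrite eq_le; apply/andP; split.
  by rewrite (le_trans (gluing_cross_le _ _ k))// mdistxx add0r.
have [k' ->] := gluing_crossE (iG k) y.
by rewrite embeddingP -(embeddingP iH) metric_triangle.
Qed.

Lemma gluing_crossr x k : gluing_cross x (iH k) = mdist x (iG k).
Proof.
apply/eqP; rewrite eq_le; apply/andP; split.
  by rewrite (le_trans (gluing_cross_le _ _ k))// mdistxx addr0.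
have [k' ->] := gluing_crossE x (iH k).
by rewrite embeddingP -(embeddingP iG) metric_triangle.
Qed.

Lemma gluing_dist_sym u v : gluing_dist u v = gluing_dist v u.
Proof. by case: u v => [x|y] [x'|y'] //=; exact: metric_sym. Qed.

Lemma gluing_dist_rel u u' v :
  gluing_rel u u' -> gluing_dist u v = gluing_dist u' v.
Proof.
case: u u' => [x|y] [x'|y'] /=; try by move=> /eqP->.
  move=> /existsP[k /andP[/eqP<- /eqP<-]]; case: v => [z|z] /=.
    by rewrite gluing_crossr metric_sym.
  by rewrite gluing_crossl.
move=> /existsP[k /andP[/eqP<- /eqP<-]]; case: v => [z|z] /=.
  by rewrite gluing_crossr metric_sym.
by rewrite gluing_crossl.
Qed.

Lemma gluing_dist_triangle v u w :
  gluing_dist u w <= gluing_dist u v + gluing_dist v w.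
Proof.
case: u v w => [x|x] [y|y] [z|z] /=; try exact: metric_triangle.
- have [k ->] := gluing_crossE y z; apply: le_trans (gluing_cross_le _ _ k) _.
  by rewrite addrA lerD2r metric_triangle.
- have [k ->] := gluing_crossE x y; have [k' ->] := gluing_crossE z y.
  apply: le_trans (metric_triangle _ (iG k) _) _; rewrite -addrA lerD2l.
  apply: le_trans (metric_triangle _ (iG k') _) _.
  rewrite [mdist z _ + _]addrC addrA (metric_sym _ z) lerD2r embeddingP.
  by rewrite -(embeddingP iH) [mdist (iH k') y]metric_sym metric_triangle.
- have [k ->] := gluing_crossE x y; apply: le_trans (gluing_cross_le _ _ k) _.
  by rewrite -addrA lerD2l metric_triangle.
- have [k ->] := gluing_crossE y x; apply: le_trans (gluing_cross_le _ _ k) _.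
  by rewrite addrAC lerD2r [leRHS]addrC [mdist y z]metric_sym metric_triangle.
- have [k ->] := gluing_crossE y x; have [k' ->] := gluing_crossE y z.
  apply: le_trans (metric_triangle _ (iH k) _) _.
  rewrite [mdist y _ + _]addrC -addrA (metric_sym x) lerD2l.
  apply: le_trans (metric_triangle _ (iH k') _) _.
  rewrite addrA lerD2r embeddingP -(embeddingP iG) (metric_sym y).
  by rewrite metric_triangle.
- have [k ->] := gluing_crossE z y; apply: le_trans (gluing_cross_le _ _ k) _.
  rewrite [leRHS]addrC -addrA lerD2l (metric_sym x).
  by rewrite metric_triangle.
Qed.

Lemma gluing_dist_positivity u v : gluing_dist u v = 0 -> gluing_rel u v.
Proof.
have cross x y : gluing_cross x y = 0 ->
    [exists k, (iG k == x) && (iH k == y)].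
  have [k ->] := gluing_crossE x y => /eqP.
  rewrite paddr_eq0 ?mdist_ge0// => /andP[/eqP xk /eqP ky].
  apply/existsP; exists k; apply/andP; split; apply/eqP.
    exact/esym/mdist_positivity.
  exact/mdist_positivity.
by case: u v => [x|y] [x'|y'] /=; [|exact: cross|exact: cross|];
  move=> /mdist_positivity ->.
Qed.

Definition gluing_mdist (p q : gluing) : R := gluing_dist (repr p) (repr q).

Lemma gluing_mdistE (u v : G + H) :
  gluing_mdist (\pi_gluing u)%qT (\pi_gluing v)%qT = gluing_dist u v.
Proof.
have pi_rel w : gluing_rel (repr (\pi_gluing w)%qT) w.
  by apply/(@eqmodP _ gluing_equiv); rewrite reprK.
rewrite /gluing_mdist (gluing_dist_rel _ (pi_rel u)) gluing_dist_sym.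
by rewrite (gluing_dist_rel _ (pi_rel v)) gluing_dist_sym.
Qed.

Let gluing_mdistxx p : gluing_mdist p p = 0.
Proof. by rewrite /gluing_mdist; case: (repr p) => x /=; exact: mdistxx. Qed.

Let gluing_mdist_positivity p q : gluing_mdist p q = 0 -> p = q.
Proof.
move=> /gluing_dist_positivity pq; rewrite -[p]reprK -[q]reprK.
exact/(@eqmodP _ gluing_equiv).
Qed.

Let gluing_mdist_sym p q : gluing_mdist p q = gluing_mdist q p.
Proof. exact: gluing_dist_sym. Qed.

Let gluing_mdist_triangle q p r :
  gluing_mdist p r <= gluing_mdist p q + gluing_mdist q r.
Proof. exact: gluing_dist_triangle. Qed.

HB.instance Definition _ := isMetric.Build R gluing
  gluing_mdistxx gluing_mdist_positivity gluing_mdist_sym gluing_mdist_triangle.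

End Gluing.

Definition glued_space (R : realType) (G H K : finMetricType R) (k0 : K)
    (iG : isometric_embedding K G) (iH : isometric_embedding K H) :
    finMetricType R := FinMetric.clone R (gluing k0 iG iH) _.

Section Sycamore.
Context (R : realType) (H K : metricType R) (iH : isometric_embedding K H).

Definition projects (A : set H) (y : H) : Prop :=
  exists2 p, A p & forall k, A k -> mdist k y = mdist k p + mdist p y.

Definition sycamore_star : set H :=
  [set y | ~ range iH y /\ projects (range iH) y].

Definition sycamore_zero : set H := ~` (range iH `|` sycamore_star).

Definition sycamore_twisting (alpha : isometric_embedding K K) : Prop :=
  bijective alpha /\
  forall h k, sycamore_zero h -> mdist h (iH k) = mdist h (iH (alpha k)).

End Sycamore.

Definition chains d (T : porderType d) (P : set T) : set (seq T) :=
  [set c | [/\ c != [::], sorted <%O c & {in c, forall x, P x}]].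

Definition complex_of_chains (T : choiceType) (C : set (seq T)) :
    set {fset T} := [set [fset x in c]%fset | c in C].

Definition order_complex d (T : porderType d) (P : set T) : set {fset T} :=
  complex_of_chains (chains P).

Section Realization.
Context (R : realType) (V : choiceType) (K : set {fset V}).

(* Points of $|K|$ are given by their barycentric coordinates. *)
Definition barycentric : set {fsfun V -> R with 0} :=
  [set w | [/\ K (finsupp w), forall v, 0 <= w v &
               \sum_(v <- finsupp w) w v = 1]].

Definition realization : Type := set_type barycentric.
HB.instance Definition _ := Choice.on realization.

Definition carrier (w : realization) : {fset V} := finsupp (val w).

(* The coherent (weak) topology: [A] is open iff its trace on every closed
   simplex $|\sigma|$ is open for the Euclidean topology of $|\sigma|$. *)
Definition realization_open (A : set realization) : Prop :=
  forall s, K s -> forall w, A w -> (carrier w `<=` s)%fset ->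
  exists2 e : R, 0 < e & forall w' : realization, (carrier w' `<=` s)%fset ->
    (forall v, `|val w v - val w' v| < e) -> A w'.

Let realization_openT : realization_open setT.
Proof. by move=> s Ks w _ ws; exists 1. Qed.

Let realization_openI : setI_closed realization_open.
Proof.
move=> A B oA oB s Ks w [Aw Bw] ws.
have [e e0 eA] := oA s Ks w Aw ws; have [e' e0' eB] := oB s Ks w Bw ws.
exists (Num.min e e'); first by rewrite lt_min e0.
move=> w' w's ww'; split; [apply: eA|apply: eB] => // v; move: (ww' v);
  by rewrite lt_min => /andP[].
Qed.

Let realization_open_bigU (I : Type) (f : I -> set realization) :
  (forall i, realization_open (f i)) -> realization_open (\bigcup_i f i).
Proof.
move=> of_ s Ks w [i _ fw] ws; have [e e0 ef] := of_ i s Ks w fw ws.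
by exists e => // w' w's ww'; exists i => //; exact: ef.
Qed.

HB.instance Definition _ := isOpenTopological.Build realization
  realization_openT realization_openI realization_open_bigU.

End Realization.

Section Collapse.
Context (Y : topologicalType) (A : set Y).

(* The quotient space $Y/A$: [None] is the base point, [Some y] a point outside
   [A], and [insub] is the projection. With [A = set0] this is the disjoint
   union of [Y] and an isolated base point. *)
Definition collapse : Type := option (set_type (~` A)).
HB.instance Definition _ := Choice.on collapse.

Definition collapse_pi (y : Y) : collapse := insub y.

Definition collapse_open (U : set collapse) : Prop :=
  open (collapse_pi @^-1` U).

Let collapse_openT : collapse_open setT.
Proof. exact: openT. Qed.

Let collapse_openI : setI_closed collapse_open.
Proof. by move=> U V; exact: openI. Qed.

Let collapse_open_bigU (I : Type) (f : I -> set collapse) :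
  (forall i, collapse_open (f i)) -> collapse_open (\bigcup_i f i).
Proof. by move=> of_; apply: bigcup_open => i _; exact: of_. Qed.

HB.instance Definition _ := isOpenTopological.Build collapse
  collapse_openT collapse_openI collapse_open_bigU.

End Collapse.

Definition spacetime (R : realType) (X : metricType R) : Type := (X * R)%type.

Section Causal.
Context (R : realType) (X : metricType R).

HB.instance Definition _ := Choice.on (spacetime X).

Definition causal_le (p q : spacetime X) : bool := mdist p.1 q.1 <= q.2 - p.2.

Let causal_refl : reflexive causal_le.
Proof. by move=> p; rewrite /causal_le mdistxx subrr. Qed.

Let causal_anti : antisymmetric causal_le.
Proof.
move=> [x t] [y u] /andP[]; rewrite /causal_le /= => xy yx.
have tu : t = u.
  apply/eqP; rewrite eq_le -subr_ge0 -[_ <= t]subr_ge0.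
  by rewrite (le_trans (mdist_ge0 _ _) xy) (le_trans (mdist_ge0 _ _) yx).
subst u; congr pair; apply/mdist_positivity/eqP.
by rewrite eq_le mdist_ge0 andbT; rewrite subrr in xy.
Qed.

Let causal_trans : transitive causal_le.
Proof.
move=> q p r; rewrite /causal_le => pq qr.
apply: le_trans (metric_triangle _ q.1 _) _.
by apply: le_trans (lerD pq qr) _; rewrite addrC addrA subrK.
Qed.

Fact causal_display : Order.disp_t. Proof. exact: Order.default_display. Qed.

HB.instance Definition _ := Order.Le_isPOrder.Build causal_display
  (spacetime X) causal_refl causal_anti causal_trans.

Fixpoint path_length (c : seq X) : R :=
  if c is x :: c' then
    (if c' is y :: _ then mdist x y else 0) + path_length c'
  else 0.

Definition Cau (l : R) (a b : X) : set (spacetime X) :=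
  [set p | [/\ 0 <= p.2 <= l, mdist a p.1 <= p.2 & mdist p.1 b <= l - p.2]].

Definition Cau_complex l a b : set {fset spacetime X} :=
  order_complex (Cau l a b).

(* The subcomplex $\Delta'\mathrm{Cau}^\ell(X;a,b)$. *)
Definition Cau_subcomplex l a b : set {fset spacetime X} :=
  complex_of_chains
    (chains (Cau l a b) `&` [set c | path_length [seq p.1 | p <- c] < l]).

Definition magnitude_pair l a b : topologicalType :=
  @collapse (realization R (Cau_complex l a b))
    [set w | Cau_subcomplex l a b (carrier w)].

(* For empty [X] the wedge is empty instead of being a point. *)
Definition magnitude_homotopy_type l : topologicalType :=
  wedge (fun ab : X * X => None : magnitude_pair l ab.1 ab.2).

End Causal.

Section SingularHomology.
Context (R : realType).

Definition simplex_set n : set 'rV[R]_n.+1 :=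
  [set x | (forall i, 0 <= x ord0 i) /\ \sum_i x ord0 i = 1].
Definition simplex n : Type := set_type (@simplex_set n).
HB.instance Definition _ n := Topological.on (simplex n).

(* [face_coords i x] inserts a zero coordinate at position [i]. *)
Definition face_coords n (i : 'I_n.+2) (x : 'rV[R]_n.+1) : 'rV[R]_n.+2 :=
  \row_j (if unlift i j is Some k then x ord0 k else 0).

Lemma face_coordsP n (i : 'I_n.+2) (x : simplex n) :
  face_coords i (val x) \in @simplex_set n.+1.
Proof.
have /set_mem[x0 x1] := valP x; apply/mem_set; split.
  by move=> j; rewrite mxE; case: unliftP.
rewrite (bigD1_ord i)//= mxE unlift_none add0r -[RHS]x1.
by apply: eq_bigr => k _; rewrite mxE liftK.
Qed.

Definition face n (i : 'I_n.+2) (x : simplex n) : simplex n.+1 :=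
  exist (fun v => v \in @simplex_set n.+1) _ (face_coordsP i x).

Lemma face_continuous n (i : 'I_n.+2) : continuous (face i).
Proof.
suff cf : continuous (fun y : simplex n => face_coords i (val y)).
  exact: (@continuous_comp_initial _ _ _ set_val (face i) cf).
move=> x A [B nB BA].
have : \forall y \near x, forall j, B ord0 j (face_coords i (val y) ord0 j).
  apply: (@filter_forall _ _ _ _ (nbhs_filter x)) => j.
  have cj : continuous (fun y : simplex n => face_coords i (val y) ord0 j).
    under eq_fun do rewrite mxE.
    case: (unlift i j) => [k|]; last exact: cst_continuous.
    have cv : continuous (set_val : simplex n -> 'rV[R]_n.+1).
      exact: initial_continuous.
    have ck := @coord_continuous R 1 n.+1 ord0 k.
    by move=> y; exact: (continuous_comp (cv y) (ck (set_val y))).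
  exact: (cj x _ (nB ord0 j)).
apply: (@filterS _ _ (nbhs_filter x)) => y By.
by apply: BA => i' j; rewrite ord1; exact: By.
Qed.

HB.instance Definition _ n (i : 'I_n.+2) :=
  isContinuous.Build _ _ (face i) (@face_continuous n i).

Context (W : topologicalType).

Definition singular_chain n := {freeg (continuousType (simplex n) W)}.

Definition boundary n (c : singular_chain n.+1) : singular_chain n :=
  fglift (fun s : continuousType (simplex n.+1) W =>
    \sum_(i < n.+2) (-1) ^+ i *: << (s \o face i : continuousType _ _) >>) c.

(* Cycles of the augmented complex, whose last differential is [deg]. *)
Definition reduced_cycles n : set (singular_chain n) :=
  match n with
  | 0 => [set c | deg c = 0]
  | m.+1 => [set c | boundary c = 0]
  end.

Definition boundaries n : set (singular_chain n) := range (@boundary n).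

End SingularHomology.

(* [r] is the rank of the abelian group [Z / B], for [B `<=` Z] subgroups of
   [M]: the maximal size of a $\mathbb{Z}$-independent family in [Z / B]. *)
Definition independent_mod (M : zmodType) (B : set M) n
    (z : 'I_n -> M) : Prop :=
  forall a : 'I_n -> int, B (\sum_i z i *~ a i) -> forall i, a i = 0.

Definition quotient_rank (M : zmodType) (Z B : set M) (r : nat) : Prop :=
  (exists2 z : 'I_r -> M, (forall i, Z (z i)) & independent_mod B z) /\
  (forall z : 'I_r.+1 -> M, (forall i, Z (z i)) -> ~ independent_mod B z).

(* [reduced_betti R W k r] : $\operatorname{rank} \widetilde H_k(W) = r$. *)
Definition reduced_betti (R : realType) (W : topologicalType)
    (k r : nat) : Prop :=
  quotient_rank (@reduced_cycles R W k) (@boundaries R W k) r.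

(* [reduced_euler_char R W chi] : all the ranks of the reduced homology of [W]
   are finite, almost all of them vanish, and their alternating sum is [chi]. *)
Definition reduced_euler_char (R : realType) (W : topologicalType)
    (chi : int) : Prop :=
  exists (b : nat -> nat) (N : nat),
    [/\ forall k, reduced_betti R W k (b k),
        forall k, (N <= k)%N -> b k = 0%N &
        chi = \sum_(k < N) (-1) ^+ k * (b k)%:Z].

Section WellOrdered.
Context {R : realType}.
Implicit Types A B S : set R.

Definition well_ordered A := forall S, S `<=` A -> S !=set0 ->
  exists2 m, S m & forall x, S x -> m <= x.

Lemma well_orderedS A B : A `<=` B -> well_ordered B -> well_ordered A.
Proof. by move=> AB wB S SA; apply: wB; exact: subset_trans AB. Qed.

Lemma well_ordered1 (r : R) : well_ordered [set r].
Proof.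
move=> S Sr [x Sx]; exists x => // y Sy.
by rewrite (Sr _ Sx) (Sr _ Sy).
Qed.

Lemma well_orderedU A B : well_ordered A -> well_ordered B ->
  well_ordered (A `|` B).
Proof.
move=> wA wB S SAB S0.
have [[a [Sa Aa]]|nA] := pselect (S `&` A !=set0); last first.
  apply: wB => // x Sx; case: (SAB x Sx) => // Ax.
  by exfalso; apply: nA; exists x.
have [[b [Sb Bb]]|nB] := pselect (S `&` B !=set0); last first.
  apply: wA => // x Sx; case: (SAB x Sx) => // Bx.
  by exfalso; apply: nB; exists x.
have [m [Sm Am] mP] :=
  wA (S `&` A) (@subIsetr _ _ _) (ex_intro _ a (conj Sa Aa)).
have [n [Sn Bn] nP] :=
  wB (S `&` B) (@subIsetr _ _ _) (ex_intro _ b (conj Sb Bb)).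
exists (Num.min m n); first by rewrite /Num.min; case: ifP.
by move=> x Sx; rewrite ge_min; case: (SAB x Sx) => ?;
  apply/orP; [left; exact: mP|right; exact: nP].
Qed.

Definition sumset A B : set R :=
  [set x | exists a b, [/\ A a, B b & x = a + b]].

Lemma well_ordered_sumset A B : well_ordered A -> well_ordered B ->
  well_ordered (sumset A B).
Proof.
move=> wA wB S SAB [s0 Ss0]; apply: contrapT => nomin.
have low s : S s -> exists a b, [/\ A a, B b, S (a + b), a + b <= s &
    forall a' b', A a' -> B b' -> S (a' + b') -> a' + b' <= s -> a <= a'].
  move=> Ss.
  have [a0 [b0 [Aa0 Bb0 sE]]] := SAB _ Ss.
  have [||a [Aa [b [Bb Sab ab]]] aP] := wA [set a | A a /\
    exists b, [/\ B b, S (a + b) & a + b <= s]].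
  - by move=> ? [].
  - by exists a0; split => //; exists b0; rewrite -sE.
  exists a, b; split => // a' b' Aa' Bb' Sab' le; apply: aP; split => //.
  by exists b'.
pose V := [set b | B b /\ exists a, [/\ A a, S (a + b) &
    forall a' b', A a' -> B b' -> S (a' + b') -> a' + b' <= a + b -> a <= a']].
have VP s : S s -> exists a b, [/\ A a, S (a + b), a + b <= s, V b &
    forall a' b', A a' -> B b' -> S (a' + b') -> a' + b' <= s -> a <= a'].
  move=> /low[a [b [Aa Bb Sab le H]]]; exists a, b; split => //; split => //.
  exists a; split => // a' b' ? ? ? le'; apply: (H _ b') => //.
  exact: le_trans le.
have [||b0 [Bb0 [a0 [Aa0 Sab0 H0]]] b0P] := wB V.
- by move=> ? [].
- by have [a [b [? ? ? Vb _]]] := VP _ Ss0; exists b.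
apply: nomin; exists (a0 + b0) => // s Ss; rewrite leNgt; apply/negP => lts.
have [a [b [Aa Sab le Vb H]]] := VP _ Ss.
have leb := b0P _ Vb; have Bb := Vb.1.
have lea : a0 <= a by apply: (H0 _ b) => //; exact: le_trans (ltW lts).
have := le_lt_trans le lts.
by rewrite ltNge lerD.
Qed.

Lemma well_ordered_finite A r : well_ordered A ->
  well_ordered [set r - a | a in A] -> finite_set A.
Proof.
move=> wA wA'.
have max S : S `<=` A -> S !=set0 -> exists2 m, S m & forall x, S x -> x <= m.
  move=> SA [x Sx].
  have [||_ [m Sm <-] mP] := wA' [set r - a | a in S].
  - by move=> _ [y Sy <-]; exists y => //; exact: SA.
  - by exists (r - x); exists x.
  exists m => // y Sy; rewrite -(lerN2 m) -(lerD2l r); apply: mP.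
  by exists y.
apply: contrapT => infA.
have [|m0 Am0 m0P] := max A (fun x => id); first exact: infinite_setN0.
pose G := [set a | A a /\ infinite_set (A `&` [set x | x <= a])].
have [||m [Am infm] mP] := wA G.
- by move=> ? [].
- exists m0; split => //; rewrite (_ : A `&` _ = A)//.
  by apply/seteqP; split=> [x []//|x Ax]; split => //; exact: m0P.
have infm' : infinite_set (A `&` [set x | x < m]).
  move=> fin; apply: infm.
  apply: (@sub_finite_set _ _ ((A `&` [set x | x < m]) `|` [set m])).
    move=> x [Ax /=]; rewrite le_eqVlt => /predU1P[->|]; first by right.
    by left.
  by rewrite finite_setU; split => //; exact: finite_set1.
have [||h [Ah hm] hP] := max (A `&` [set x | x < m]).
- exact: subIsetl.
- exact: infinite_setN0.
have /mP : G h.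
  split => //; apply: sub_infinite_set infm' => x [Ax xm]; split => //=.
  exact: hP.
by rewrite leNgt hm.
Qed.

Lemma finite_conv A B r : well_ordered A -> well_ordered B ->
  finite_set (A `&` [set a | B (r - a)]).
Proof.
move=> wA wB; apply: (@well_ordered_finite _ r).
  by apply: well_orderedS wA; exact: subIsetl.
by apply: well_orderedS wB => _ [a [Aa Ba] <-].
Qed.

End WellOrdered.

Section Hahn.
Context (R : realType) (C : fieldType).

Definition hahn_support (f : R -> C) : set R := [set r | f r != 0].

(* A series $\sum_{r \ge 0} c_r q^r$ is encoded by its coefficient function
   [r |-> c_r], extended by zero to negative exponents. *)
Definition is_hahn (f : R -> C) : Prop :=
  (forall r, r < 0 -> f r = 0) /\ well_ordered (hahn_support f).

Record hahn := Hahn { hcoef :> R -> C; hcoefP : is_hahn hcoef }.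

Lemma hahnP (f g : hahn) : (forall r, f r = g r) -> f = g.
Proof.
move=> /funext; case: f g => [f Pf] [g Pg] /= fg; subst g.
by congr Hahn; exact: Prop_irrelevance.
Qed.

HB.instance Definition _ := gen_eqMixin hahn.
HB.instance Definition _ := gen_choiceMixin hahn.

Implicit Types f g h : hahn.

Let supp f := hahn_support f.
Let wsupp f : well_ordered (supp f). Proof. exact: (hcoefP f).2. Qed.
Let neg0 f r : r < 0 -> f r = 0. Proof. exact: (hcoefP f).1. Qed.

Lemma is_hahn0 : is_hahn (fun=> 0).
Proof.
split => // S SA [x /SA]; by rewrite /hahn_support /= eqxx.
Qed.

Lemma is_hahnN f : is_hahn (fun r => - f r).
Proof.
split => [r /neg0 ->|]; first by rewrite oppr0.
apply: (@well_orderedS _ _ (supp f)) => [r|]; last exact: wsupp.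
by rewrite /supp /hahn_support /= oppr_eq0.
Qed.

Lemma is_hahnD f g : is_hahn (fun r => f r + g r).
Proof.
split => [r r0|]; first by rewrite !neg0// addr0.
apply: (@well_orderedS _ _ (supp f `|` supp g)) => [r /= fg0|]; last first.
  by apply: well_orderedU; exact: wsupp.
have [f0|f0] := eqVneq (f r) 0; last by left.
by right; move: fg0; rewrite /hahn_support /= f0 add0r.
Qed.

Lemma is_hahn_monomial (s : {nonneg R}) :
  is_hahn (fun r => (r == s%:num)%:R).
Proof.
split => [r r0|].
  by case: eqP r0 => // -> ; rewrite ltNge ge0.
apply: (@well_orderedS _ _ [set s%:num]) => [r|]; last exact: well_ordered1.
rewrite /hahn_support /=; have [-> //|_] := eqVneq r s%:num.
by rewrite ?mulr0n eqxx.
Qed.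

(* [\sum_(s \in A) F s] is [0] by convention when [F] has infinite support
   in [A]; lemma [finite_conv] shows that this does not happen for the product
   of two Hahn series. *)
Definition hconv (f g : R -> C) (r : R) : C :=
  \sum_(s \in [set: R]) f s * g (r - s).

Lemma hconvE f g r (P : set R) : finite_set P ->
  (supp f `&` [set s | supp g (r - s)] `<=` P) ->
  hconv f g r = \sum_(s \in P) f s * g (r - s).
Proof.
move=> finP sub; apply/esym/fsbig_widen => // s [_ nPs] /=.
apply/eqP; rewrite mulf_eq0; apply/negPn; rewrite negb_or.
by apply/negP => /andP[fs gs]; apply: nPs; apply: sub; split.
Qed.

Let fin f g r : finite_set (supp f `&` [set s | supp g (r - s)]).
Proof. exact: finite_conv. Qed.

Let hconv_supp f g : hahn_support (hconv f g) `<=` sumset (supp f) (supp g).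
Proof.
move=> r; rewrite /hahn_support /= (hconvE (fin f g r) (@subset_refl _ _)).
move=> /(@fsbigN1 _ _ _ R R _ (fun=> fun s => f s * g (r - s)) 0)[s [fs gs] _].
exists s, (r - s); split => //.
by rewrite addrC subrK.
Qed.

Lemma is_hahnM f g : is_hahn (hconv f g).
Proof.
split => [r r0|].
  apply/fsbig1 => s _; have [s0|s0] := ltP s 0; first by rewrite neg0// mul0r.
  by rewrite [g _]neg0 ?mulr0// ltrBlDr; apply: lt_le_trans r0 _; rewrite add0r.
apply: (@well_orderedS _ _ (sumset (supp f) (supp g))); first exact: hconv_supp.
exact: well_ordered_sumset.
Qed.

Definition hahn0 := Hahn is_hahn0.
Definition hahnN f := Hahn (is_hahnN f).
Definition hahnD f g := Hahn (is_hahnD f g).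
Definition hahnM f g := Hahn (is_hahnM f g).
(* The monomial $q^s$. *)
Definition qpow (s : {nonneg R}) := Hahn (is_hahn_monomial s).

Let hahnDA : associative hahnD.
Proof. by move=> f g h; apply/hahnP => r /=; rewrite addrA. Qed.
Let hahnDC : commutative hahnD.
Proof. by move=> f g; apply/hahnP => r /=; rewrite addrC. Qed.
Let hahnD0 : left_id hahn0 hahnD.
Proof. by move=> f; apply/hahnP => r /=; rewrite add0r. Qed.
Let hahnDN : left_inverse hahn0 hahnN hahnD.
Proof. by move=> f; apply/hahnP => r /=; rewrite addNr. Qed.

HB.instance Definition _ := GRing.isZmodule.Build hahn
  hahnDA hahnDC hahnD0 hahnDN.

Let hahnMC : commutative hahnM.
Proof.
move=> f g; apply/hahnP => r /=; rewrite /hconv.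
rewrite (@reindex_fsbigT _ _ _ R R (fun s => r - s)) /=; last first.
  by exists (fun s => r - s) => s; rewrite opprB addrC subrK.
apply: eq_fsbigr => s _; rewrite mulrC; congr (_ * f _).
by rewrite opprB addrC subrK.
Qed.

Let hahn1M : left_id (qpow 0%:nng) hahnM.
Proof.
move=> f; apply/hahnP => r /=.
rewrite /hconv -(@fsbig_widen _ _ _ _ [set 0])//.
  by rewrite fsbig_set1 eqxx mul1r subr0.
by move=> s [_ /= /eqP/negbTE ->]; rewrite mul0r.
Qed.

Let hahnMDl : left_distributive hahnM hahnD.
Proof.
move=> f g h; apply/hahnP => r.
pose P := (supp f `&` [set s | supp h (r - s)]) `|`
          (supp g `&` [set s | supp h (r - s)]).
have finP : finite_set P by rewrite finite_setU.
rewrite /= (@hconvE f h r P)//; last exact: subsetUl.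
rewrite (@hconvE g h r P)//; last exact: subsetUr.
rewrite -fsbig_split//= (@hconvE (hahnD f g) h r P)//.
  by apply: eq_fsbigr => s _; rewrite mulrDl.
move=> s [/= fgs hs]; have [f0|f0] := eqVneq (f s) 0.
  right; split => //; move: fgs; rewrite /supp /hahn_support /= f0.
  by rewrite add0r.
by left.
Qed.

Let hahnMA : associative hahnM.
Proof.
move=> f g h; apply/hahnP => r.
pose P := supp f `&` [set a | sumset (supp g) (supp h) (r - a)].
pose Q := sumset (supp f) (supp g) `&` [set b | supp h (r - b)].
have finP : finite_set P.
  by apply: finite_conv => //; exact: well_ordered_sumset.
have finQ : finite_set Q.
  by apply: finite_conv => //; exact: well_ordered_sumset.
rewrite [LHS](@hconvE f (hahnM g h) r P)//; last first.
  by move=> a [fa gha]; split => //; exact: hconv_supp.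
rewrite [RHS](@hconvE (hahnM f g) h r Q)//; last first.
  by move=> b [fgb hb]; split => //; exact: hconv_supp.
pose F a b := f a * g (b - a) * h (r - b).
transitivity (\sum_(a \in P) \sum_(b \in Q) F a b); last first.
  rewrite exchange_fsbig//; apply: eq_fsbigr => b /set_mem[fgb hb] /=.
  rewrite -mulr_fsuml (@hconvE f g b P)// => a [fa ga]; split => //.
  exists (b - a), (r - b); split => //.
  by rewrite [RHS]addrC addrA subrK.
apply: eq_fsbigr => a /set_mem[fa gha] /=.
under [RHS]eq_fsbigr do rewrite /F -mulrA.
rewrite -mulr_fsumr; congr (_ * _).
rewrite /hconv (@reindex_fsbigT _ _ _ R R (fun b => b - a)); last first.
  by exists (fun b => b + a) => b; rewrite ?addrK ?subrK.
rewrite -(@fsbig_widen _ _ _ _ Q)//.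
  by apply: eq_fsbigr => b _; congr (_ * h _); rewrite opprB addrA subrK.
move=> b [_ nQb] /=; apply/eqP; rewrite mulf_eq0; apply/negPn; rewrite negb_or.
apply/negP => /andP[gb hb]; apply: nQb; split => /=.
  by exists a, (b - a); split => //; rewrite addrC subrK.
by move: hb; rewrite opprB addrA subrK.
Qed.

Let hahn1_neq0 : qpow 0%:nng != hahn0.
Proof.
apply/eqP => /(congr1 (fun f : hahn => f 0)) /=.
by rewrite eqxx => /eqP; rewrite oner_eq0.
Qed.

HB.instance Definition _ := GRing.Zmodule_isComNzRing.Build hahn
  hahnMA hahnMC hahn1M hahnMDl hahn1_neq0.

(* Classical choice of inverses; only the units of the ring are meaningful,
   the value of the inverse elsewhere being the identity as in any
   [unitRingType]. *)
Definition hahn_unit : {pred hahn} := fun f => `[< exists g, g * f = 1 >].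
Definition hahn_inv f : hahn :=
  if pselect (exists g, g * f = 1) is left e then projT1 (cid e) else f.

Let hahn_mulVr : {in hahn_unit, left_inverse 1 hahn_inv *%R}.
Proof.
move=> f /asboolP e; rewrite /hahn_inv; case: pselect => // e'.
exact: projT2 (cid e').
Qed.
Let hahn_unitP f g : g * f = 1 -> hahn_unit f.
Proof. by move=> gf; apply/asboolP; exists g. Qed.
Let hahn_inv_out : {in [predC hahn_unit], hahn_inv =1 id}.
Proof.
move=> f /negP nf; rewrite /hahn_inv; case: pselect => // e.
by exfalso; apply: nf; apply/asboolP.
Qed.

HB.instance Definition _ := GRing.ComNzRing_hasMulInverse.Build hahn
  hahn_mulVr hahn_unitP hahn_inv_out.

End Hahn.

Section Magnitude.
Context (R : realType) (X : finMetricType R).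

Definition similarity_matrix : 'M[hahn R R[i]]_#|X| :=
  \matrix_(i, j) qpow R[i] (NngNum (mdist_ge0 (enum_val i) (enum_val j))).

Definition magnitude : hahn R R[i] :=
  \sum_i \sum_j invmx similarity_matrix i j.

End Magnitude.

(* Main.v *)
(** The space [magnitude_homotopy_type X l] is a finite cell complex whose cells,
    apart from the base point, correspond to the paths x_0, ..., x_n in X with
    x_(i-1) <> x_i and total length l: such a path has a unique unit-speed lift
    to a chain of Cau^l, and these lifts are exactly the chains outside the
    subcomplex. Hence its reduced Euler characteristic is the sum of (-1)^n over
    these paths. The Euler characteristic is computed directly from
    singular homology: homotopy invariance, barycentric subdivision and
    Mayer-Vietoris show that attaching an open n-simplex changes the Euler
    characteristic by (-1)^n.

    The same alternating count of paths from x to y, as a function of the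
    length, is the (x, y) entry of the inverse of Z_X, because the terms of
    Z_X * Z_X^-1 telescope over the first step of a path. So the Euler
    characteristic at l is the coefficient of q^l in Mag(X), and the first claim
    follows from the second.

    For Mag(X) = Mag(Y), take a weighting w of X. A point y of H_* acts on G only
    through its projection, so moving the mass q^d(y, pi(y)) w(y) from the
    place of pi(y) in Y to its place in X turns w into a weighting of Y with the
    same total. *)
From HB Require Import structures.
Require Import Defs.
From mathcomp Require Import all_boot all_order all_algebra all_classical all_reals.
From mathcomp Require Import finmap interval_inference.
From mathcomp Require Import topology normedtype sequences wedge_sigT complex.
From mathcomp Require Import zify ring lra.
From mathcomp.multinomials Require Import freeg.
Set Implicit Arguments.
Unset Strict Implicit.
Unset Printing Implicit Defensive.
Import Order.TTheory GRing.Theory Num.Theory.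
Import numFieldNormedType.Exports.
Local Open Scope classical_set_scope.
Local Open Scope ring_scope.

(** * Ranks of subquotients and Euler characteristics *)

(** Ranks of homology are only given as sizes of independent families, so the Mayer-Vietoris
    sequence is read as a count of ranks of subquotients. Chains are augmented and shifted by one
    degree: a point or a contractible set then has Euler characteristic 0, the empty set has 1, and
    an open cell with [n] vertices adds [(-1)^n]; undoing the shift at the end changes the sign. The
    obstacle is the topology of the space, a wedge of quotients of realizations. Collapsing a
    subcomplex destroys the continuity of barycentric coordinates, but not that of the minimum of
    the weights over a cell, nor that of its product with a weight. Continuity is therefore tested
    through these functions and along maps from simplices. A cell is attached by covering with the
    part where its minimum is below [1/n], which deforms to the older cells, and the open cell; the
    two meet in a cell without its barycentre, whose Euler characteristic comes from a cover by
    convex sets. *)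

Lemma int_left_kernel m n (A : 'M[int]_(m, n)) : (n < m)%N ->
  exists2 u : 'rV[int]_m, u != 0 & u *m A = 0.
Proof.
case: m A => // m A nm.
have [L uL [R uR [d _ defA]]] := int_Smith_normal_form A.
(* With more rows than columns, the last row of the diagonal form is zero; [invmx L] carries that
   row back to [A]. *)
exists (delta_mx 0 ord_max *m invmx L).
  apply/eqP => /(congr1 (mulmx^~ L)); rewrite mulmxKV // mul0mx.
  by move/matrixP/(_ 0 ord_max); rewrite !mxE !eqxx.
rewrite defA !mulmxA mulmxKV // -rowE (_ : row _ _ = 0) ?mul0mx //.
apply/rowP => j; rewrite !mxE /=.
by rewrite gtn_eqF ?mulr0n // (leq_trans (ltn_ord j)).
Qed.

Section Rank.
Variable M : zmodType.
Implicit Types A B Z : set M.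

Definition subgrp A := A 0 /\ forall x y, A x -> A y -> A (x - y).

Lemma subgrpN A x : subgrp A -> A x -> A (- x).
Proof. by move=> [A0 AB] Ax; rewrite -sub0r; exact: AB. Qed.

Lemma subgrpD A x y : subgrp A -> A x -> A y -> A (x + y).
Proof.
by move=> sA Ax Ay; rewrite -[y]opprK; apply: sA.2 => //; exact: subgrpN.
Qed.

Lemma subgrp_mulz A x (a : int) : subgrp A -> A x -> A (x *~ a).
Proof.
move=> sA Ax.
have An n : A (x *+ n).
  by elim: n => [|n IH]; [exact: sA.1|rewrite mulrS; exact: subgrpD].
by case: a => n; [exact: An|rewrite NegzE mulrNz; apply: subgrpN => //; exact: An].
Qed.

Lemma subgrp_sum A (I : Type) (r : seq I) (P : pred I) (F : I -> M) :
  subgrp A -> (forall i, P i -> A (F i)) -> A (\sum_(i <- r | P i) F i).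
Proof.
by move=> sA AF; elim/big_ind: _ => //; [exact: sA.1|move=> x y; exact: subgrpD].
Qed.

Lemma subgrpI A B : subgrp A -> subgrp B -> subgrp (A `&` B).
Proof.
move=> sA sB; split=> [|x y [Ax Bx] [Ay By]]; first by split; [case: sA|case: sB].
by split; [exact: sA.2|exact: sB.2].
Qed.

Definition addset A B : set M := [set x | exists a b, [/\ A a, B b & x = a + b]].

Lemma subgrp_addset A B : subgrp A -> subgrp B -> subgrp (addset A B).
Proof.
move=> sA sB; split=> [|_ _ [a [b [Aa Bb ->]]] [a' [b' [Aa' Bb' ->]]]].
  by exists 0, 0; rewrite addr0; split => //; [case: sA|case: sB].
exists (a - a'), (b - b'); split; [exact: sA.2|exact: sB.2|].
by rewrite opprD addrACA.
Qed.

Lemma addsetl A B : subgrp B -> A `<=` addset A B.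
Proof. by move=> sB x Ax; exists x, 0; rewrite addr0; split => //; case: sB. Qed.

Lemma addsetr A B : subgrp A -> B `<=` addset A B.
Proof. by move=> sA x Bx; exists 0, x; rewrite add0r; split => //; case: sA. Qed.

Lemma addset_sub A B C : subgrp C -> A `<=` C -> B `<=` C -> addset A B `<=` C.
Proof.
by move=> sC AC BC _ [a [b [/AC ? /BC ? ->]]]; exact: subgrpD.
Qed.

(** Spanning after tensoring with the rationals: the multiplier [N] absorbs torsion and
    denominators. *)
Definition spanned_mod B Z n (e : 'I_n -> M) :=
  forall z, Z z -> exists2 N : int, N != 0 &
    exists a : 'I_n -> int, B (z *~ N - \sum_i e i *~ a i).

Lemma rank_basis Z B r : subgrp B -> quotient_rank Z B r ->
  exists e : 'I_r -> M,
    [/\ forall i, Z (e i), independent_mod B e & spanned_mod B Z e].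
Proof.
move=> sB [[e Ze ie] max]; exists e; split => // z Zz.
pose z' (i : 'I_r.+1) := if unlift ord0 i is Some j then e j else z.
have /existsNP[a] : ~ independent_mod B z'.
  by apply: max => i; rewrite /z'; case: unliftP.
move=> /not_implyP[Ba /existsNP[i0 ai0]].
have sumE : \sum_i z' i *~ a i = z *~ a ord0 + \sum_i e i *~ a (fintype.lift ord0 i).
  rewrite big_ord_recl /z' unlift_none; congr (_ + _).
  by apply: eq_bigr => i _; rewrite liftK.
(* Were [a ord0] zero, the relation would be one among the [e i], against their independence. *)
rewrite sumE in Ba; exists (a ord0).
  apply/eqP => a0; apply: ai0; case: (unliftP ord0 i0) => [j ->|-> //].
  by apply: (ie (fun j => a (fintype.lift ord0 j))); move: Ba; rewrite a0 mulr0z add0r.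
exists (fun i => - a (fintype.lift ord0 i)).
under eq_bigr do rewrite mulrNz.
by rewrite sumrN opprK.
Qed.

(** Multiples [N i] of the [z i] are integer combinations of the [e j]; a left kernel vector [u] of
    the coefficient matrix gives the relation with coefficients [N i * u i], not all zero. *)
Lemma spanned_dependent Z B r n (e : 'I_r -> M) (z : 'I_n -> M) : subgrp B ->
  spanned_mod B Z e -> (r < n)%N -> (forall i, Z (z i)) ->
  ~ independent_mod B z.
Proof.
move=> sB se rn Zz iz.
have /choice[N HN] : forall i, exists N : int, N != 0 /\
    exists a : 'I_r -> int, B (z i *~ N - \sum_i e i *~ a i).
  by move=> i; have [N N0 H] := se _ (Zz i); exists N.
have /choice[a Ha] : forall i, exists a : 'I_r -> int,
    B (z i *~ N i - \sum_i e i *~ a i).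
  by move=> i; have [_] := HN i.
have [u u0 uA] := int_left_kernel (\matrix_(i < n, j < r) a i j) rn.
have /existsP[i ui] : [exists i, u 0 i != 0].
  apply: contraT => /existsPn H; move: u0; rewrite (_ : u = 0) ?eqxx //.
  by apply/rowP => i; rewrite mxE; apply/eqP/negPn/H.
have : forall i, N i * u 0 i = 0.
  apply: iz.
  rewrite (_ : \sum_i _ = \sum_i (z i *~ N i - \sum_j e j *~ a i j) *~ u 0 i).
    by apply: subgrp_sum => // j _; exact: subgrp_mulz.
  under [RHS]eq_bigr do rewrite mulrzBl -mulrzA.
  rewrite sumrB [X in _ - X](_ : _ = 0) ?subr0 //.
  under eq_bigr do rewrite mulrz_suml.
  rewrite exchange_big /= big1 // => j _.
  under eq_bigr do rewrite -mulrzA.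
  rewrite -mulrz_sumr (_ : \sum_i _ = (u *m \matrix_(i, j) a i j) 0 j).
    by rewrite uA mxE mulr0z.
  by rewrite mxE; apply: eq_bigr => k _; rewrite mxE mulrC.
move=> /(_ i)/eqP; rewrite mulf_eq0 (negbTE ui) orbF.
by have [/negbTE -> _] := HN i.
Qed.

Lemma basis_rank Z B r (e : 'I_r -> M) : subgrp B -> (forall i, Z (e i)) ->
  independent_mod B e -> spanned_mod B Z e -> quotient_rank Z B r.
Proof.
move=> sB Ze ie se; split; first by exists e.
by move=> z Zz; exact: (spanned_dependent sB se (ltnSn r) Zz).
Qed.

Lemma rank_bound Z B r n (z : 'I_n -> M) : subgrp B -> quotient_rank Z B r ->
  (forall i, Z (z i)) -> independent_mod B z -> (n <= r)%N.
Proof.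
move=> sB rZ Zz iz; have [e [_ _ se]] := rank_basis sB rZ.
by rewrite leqNgt; apply/negP => rn; exact: (spanned_dependent sB se rn Zz iz).
Qed.

Lemma rank_unique Z B r r' : subgrp B -> quotient_rank Z B r ->
  quotient_rank Z B r' -> r = r'.
Proof.
move=> sB rZ rZ'; have [[z Zz iz] _] := rZ; have [[z' Zz' iz'] _] := rZ'.
apply/eqP; rewrite eqn_leq.
by rewrite (rank_bound sB rZ' Zz iz) (rank_bound sB rZ Zz' iz').
Qed.

(** A family of [Z'] independent modulo [B'] is independent modulo the smaller [B], so [r] bounds
    its size and a maximal size exists. *)
Lemma rank_subquotient Z B Z' B' r : subgrp B -> B `<=` B' -> Z' `<=` Z ->
  quotient_rank Z B r -> exists r', quotient_rank Z' B' r'.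
Proof.
move=> sB BB' ZZ' rZ.
pose P n := `[< exists2 z : 'I_n -> M, (forall i, Z' (z i)) & independent_mod B' z >].
have P0 : exists n, P n.
  by exists 0%N; apply/asboolP; exists (fun=> 0) => [[]//|? ? []].
have Pr n : P n -> (n <= r)%N.
  move=> /asboolP[z Zz iz]; apply: (rank_bound sB rZ (z := z)) => [i|a Ba].
    exact: ZZ'.
  by apply: iz; exact: BB'.
case: (ex_maxnP P0 Pr) => m /asboolP Pm maxm; exists m; split => // z Zz iz.
by have := maxm m.+1; rewrite ltnn => /(_ _)/negP; apply => //; apply/asboolP; exists z.
Qed.

Lemma rank_add Z Z' B a b : subgrp B -> subgrp Z' -> B `<=` Z' -> Z' `<=` Z ->
  quotient_rank Z Z' a -> quotient_rank Z' B b -> quotient_rank Z B (a + b).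
Proof.
move=> sB sZ' BZ' ZZ' rZ rZ'.
have [e [Ze ie se]] := rank_basis sZ' rZ.
have [f [Zf jf sf]] := rank_basis sB rZ'.
pose g (i : 'I_(a + b)) := match fintype.split i with inl j => e j | inr j => f j end.
have gE (c : 'I_(a + b) -> int) : \sum_i g i *~ c i =
    \sum_i e i *~ c (lshift b i) + \sum_i f i *~ c (rshift a i).
  rewrite big_split_ord; congr (_ + _); apply: eq_bigr => i _; rewrite /g.
    by rewrite (unsplitK (inl i)).
  by rewrite (unsplitK (inr i)).
apply: (basis_rank (e := g)) => //.
- by move=> i; rewrite /g; case: (fintype.split i) => j; [|apply: ZZ'].
- move=> c; rewrite gE => Bc.
  have c0 i : c (lshift b i) = 0.
    apply: (ie (fun i => c (lshift b i))).
    rewrite -[X in Z' X](addrK (\sum_i f i *~ c (rshift a i))).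
    apply: sZ'.2; first exact: BZ'.
    by apply: subgrp_sum => // j _; exact: subgrp_mulz.
  move: Bc; rewrite big1 ?add0r => [/jf c1 i|i _]; last by rewrite c0 mulr0z.
  by rewrite -(fintype.splitK i); case: (fintype.split i) => j; [exact: c0|exact: c1].
(* [N] clears denominators modulo [Z'], and [N'] does so modulo [B] for the remainder, which lies in
   [Z']. *)
- move=> z Zz; have [N N0 [c Zc]] := se z Zz; have [N' N0' [d Bd]] := sf _ Zc.
  exists (N * N'); first by rewrite mulf_neq0.
  exists (fun i => match fintype.split i with inl j => c j * N' | inr j => d j end).
  move: Bd; congr B; rewrite gE mulrzBl -mulrzA opprD addrA; congr (_ - _ - _).
    rewrite mulrz_suml; apply: eq_bigr => i _.
    by rewrite (unsplitK (inl i)) mulrzA.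
  by apply: eq_bigr => i _; rewrite (unsplitK (inr i)).
Qed.

End Rank.

(** The four conditions on [f] say that it induces an isomorphism from [Z / B] to [Z' / B'],
    expressed on representatives; bases modulo the subgroups are transported in either direction. *)
Lemma rank_iso (M M' : zmodType) (f : {additive M -> M'}) (Z B : set M)
    (Z' B' : set M') r : subgrp Z -> subgrp B -> subgrp B' ->
  (forall z, Z z -> Z' (f z)) -> (forall z, B z -> B' (f z)) ->
  (forall z, Z z -> B' (f z) -> B z) ->
  (forall z', Z' z' -> exists2 z, Z z & B' (z' - f z)) ->
  quotient_rank Z B r <-> quotient_rank Z' B' r.
Proof.
move=> sZ sB sB' fZ fB fI fS; split=> rZ.
  have [e [Ze ie se]] := rank_basis sB rZ.
  apply: (basis_rank (e := f \o e)) => //.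
  - by move=> i; exact: fZ.
  - move=> a Ba; apply: ie; apply: fI.
      by apply: subgrp_sum => // i _; exact: subgrp_mulz.
    by rewrite raddf_sum; under eq_bigr do rewrite raddfMz.
  - move=> z' /fS[z Zz Bz]; have [N N0 [a Ba]] := se z Zz.
    exists N => //; exists a.
    have := subgrpD sB' (subgrp_mulz N sB' Bz) (fB _ Ba).
    rewrite mulrzBl raddfB raddfMz raddf_sum.
    by under eq_bigr do rewrite raddfMz; rewrite addrA subrK.
have [e [Ze ie se]] := rank_basis sB' rZ.
have /choice[p Hp] : forall i, exists p, Z p /\ B' (e i - f p).
  by move=> i; have [p Zp Bp] := fS _ (Ze i); exists p.
have sumB (a : 'I_r -> int) :
    B' (\sum_i e i *~ a i - f (\sum_i p i *~ a i)).
  rewrite raddf_sum -sumrB; apply: subgrp_sum => // i _.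
  rewrite raddfMz -mulrzBl; apply: subgrp_mulz => //; by case: (Hp i).
apply: (basis_rank (e := p)) => //.
- by move=> i; case: (Hp i).
- move=> a /fB Ba; apply: ie.
  rewrite -[X in B' X](subrK (f (\sum_i p i *~ a i))); exact: subgrpD.
- move=> z Zz; have [N N0 [a Ba]] := se _ (fZ _ Zz).
  exists N => //; exists a; apply: fI.
    apply: sZ.2; first exact: subgrp_mulz.
    by apply: subgrp_sum => // i _; apply: subgrp_mulz => //; case: (Hp i).
  rewrite raddfB raddfMz -[X in B' X](subrKA (\sum_i e i *~ a i)).
  exact: subgrpD.
Qed.

Lemma rank_second_iso (M : zmodType) (P Q : set M) r : subgrp P -> subgrp Q ->
  quotient_rank P (P `&` Q) r <-> quotient_rank (addset P Q) Q r.
Proof.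
move=> sP sQ; apply: (rank_iso (f := idfun)) => //=.
- exact: subgrpI.
- by move=> z Pz; apply: addsetl.
- by move=> z [].
- by move=> _ [p [q [Pp Qq ->]]]; exists p => //; rewrite addrC addKr.
Qed.

(** * Chain complexes, Euler characteristics and the Mayer-Vietoris count *)

Section Complex.
Variables (D : nat -> lmodType int) (d : forall n, {additive D n.+1 -> D n}).
Hypothesis dd : forall n x, d n (d n.+1 x) = 0.
Implicit Types A B : forall n, set (D n).

Record subcomplex A : Prop := Subcomplex {
  sub_grp : forall n, subgrp (A n);
  sub_d : forall n x, A n.+1 x -> A n (d n x) }.

(** The complex ends in degree 0. For augmented chains that degree holds the integers, and the
    augmentation is the differential leaving degree 1. *)
Definition cyc A n : set (D n) :=
  match n with 0 => A 0%N | m.+1 => [set x | A m.+1 x /\ d m x = 0] end.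

Definition bnd A n : set (D n) := [set d n x | x in A n.+1].

Arguments cyc A n x : clear implicits.
Arguments bnd A n x : clear implicits.

Definition hrank A n r := quotient_rank (cyc A n) (bnd A n) r.

Definition euler A (e : int) := exists (b : nat -> nat) (N : nat),
  [/\ forall n, hrank A n (b n), forall n, (N <= n)%N -> b n = 0%N &
      e = \sum_(n < N) (-1) ^+ n * (b n)%:Z].

Lemma cyc_sub A n : cyc A n `<=` A n.
Proof. by case: n => // n x []. Qed.

Lemma subgrp_cyc A n : subcomplex A -> subgrp (cyc A n).
Proof.
move=> sA; case: n => [|n]; first exact: (sub_grp sA 0%N).
split=> [|x y [Ax dx] [Ay dy]]; first by split; [case: (sub_grp sA n.+1)|rewrite raddf0].
by split; [apply: (sub_grp sA n.+1).2|rewrite raddfB dx dy subrr].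
Qed.

Lemma subgrp_bnd A n : subcomplex A -> subgrp (bnd A n).
Proof.
move=> sA; split=> [|_ _ [x Ax <-] [y Ay <-]].
  by exists 0; [case: (sub_grp sA n.+1)|rewrite raddf0].
by exists (x - y); [apply: (sub_grp sA n.+1).2|rewrite raddfB].
Qed.

Lemma bnd_cyc A n : subcomplex A -> bnd A n `<=` cyc A n.
Proof.
move=> sA _ [x Ax <-]; case: n x Ax => [|n] x Ax; first exact: (sub_d sA).
by split; [exact: (sub_d sA)|exact: dd].
Qed.

Lemma bndS A B n : (forall n, A n `<=` B n) -> bnd A n `<=` bnd B n.
Proof. by move=> AB _ [x /AB Bx <-]; exists x. Qed.

Lemma subcomplexI A B : subcomplex A -> subcomplex B ->
  subcomplex (fun n => A n `&` B n).
Proof.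
move=> sA sB; split=> n; first by apply: subgrpI; [exact: (sub_grp sA)|exact: (sub_grp sB)].
by move=> x [Ax Bx]; split; [exact: (sub_d sA)|exact: (sub_d sB)].
Qed.

Lemma subcomplexD A B : subcomplex A -> subcomplex B ->
  subcomplex (fun n => addset (A n) (B n)).
Proof.
move=> sA sB; split=> n; first by apply: subgrp_addset; [exact: (sub_grp sA)|exact: (sub_grp sB)].
move=> _ [a [b [Aa Bb ->]]]; exists (d n a), (d n b).
by split; [exact: (sub_d sA)|exact: (sub_d sB)|rewrite raddfD].
Qed.

Lemma euler_widen (b : nat -> nat) N N' : (N <= N')%N ->
  (forall n, (N <= n)%N -> b n = 0%N) ->
  \sum_(n < N') (-1) ^+ n * (b n)%:Z = \sum_(n < N) (-1) ^+ n * (b n)%:Z :> int.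
Proof.
move=> NN' b0.
rewrite [RHS](big_ord_widen N' (fun n => (-1) ^+ n * (b n)%:Z)) //.
rewrite [LHS](bigID (fun n : 'I_N' => (n < N)%N)) /= [X in _ + X]big1 ?addr0 //.
by move=> i; rewrite -leqNgt => /b0 ->; rewrite mulr0.
Qed.

Section MayerVietoris.
Variables A B : forall n, set (D n).
Arguments A n _ : clear implicits.
Arguments B n _ : clear implicits.
Hypotheses (sA : subcomplex A) (sB : subcomplex B).
Let I n := A n `&` B n.
Let S n := addset (A n) (B n).
Arguments I n _ : clear implicits.
Arguments S n _ : clear implicits.
Let sI : subcomplex I. Proof. exact: subcomplexI. Qed.
Let sS : subcomplex S. Proof. exact: subcomplexD. Qed.
Let gZA n := subgrp_cyc n sA.
Let gZB n := subgrp_cyc n sB.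
Let gZI n := subgrp_cyc n sI.
Let gZS n := subgrp_cyc n sS.
Let gBA n := subgrp_bnd n sA.
Let gBB n := subgrp_bnd n sB.
Let gBI n := subgrp_bnd n sI.
Let gBS n := subgrp_bnd n sS.
Let gA n := sub_grp sA n.
Let gB n := sub_grp sB n.

Let cycII n x : cyc A n x -> cyc B n x -> cyc I n x.
Proof. by case: n x => [|n] x //=; move=> [? ?] [? ?]. Qed.

Let cycIl n x : cyc I n x -> cyc A n x.
Proof. by case: n x => [|n] x /=; [case|move=> [[]]]. Qed.

Let cycIr n x : cyc I n x -> cyc B n x.
Proof. by case: n x => [|n] x /=; [case|move=> [[]]]. Qed.

Let bcA n x : bnd A n x -> cyc A n x. Proof. exact: (@bnd_cyc A n sA). Qed.
Let bcB n x : bnd B n x -> cyc B n x. Proof. exact: (@bnd_cyc B n sB). Qed.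

(** For the map from the homology of [I] to the sum of those of [A] and [B], [k] is the rank of the
    kernel, [p] that of the image and [s] that of the cokernel, which is the image in the homology
    of [S]. *)
Lemma mayer_vietoris_middle n hA hB hI : hrank A n hA -> hrank B n hB ->
  hrank I n hI -> exists p k s,
  [/\ hI = p + k, s + p = hA + hB,
    quotient_rank (bnd A n `&` bnd B n) (bnd I n) k &
    quotient_rank (addset (cyc A n) (cyc B n)) (bnd S n) s]%N.
Proof.
move=> rA rB rI.
have BII : bnd I n `<=` bnd A n `&` bnd B n.
  by move=> _ [x [Ax Bx] <-]; split; exists x.
have BZ : bnd A n `&` bnd B n `<=` cyc I n.
  by move=> x [/bcA ? /bcB ?]; exact: cycII.
have gAB : subgrp (bnd A n `&` bnd B n) by exact: subgrpI.
have [k rk] := rank_subquotient (gBI n) (@subset_refl _ _) BZ rI.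
have BZ' : bnd A n `&` bnd B n `<=` cyc I n `&` bnd B n.
  by move=> x AB; split; [exact: BZ|case: AB].
have gIB : subgrp (cyc I n `&` bnd B n) by exact: subgrpI.
(* [q2] is the rank of the image of the homology of [I] in that of [B], [q1] the rank of the image
   in that of [A] of the classes dying in [B]; together they make up [p]. *)
have [q1 rq1] := rank_subquotient (gBI n) BII (@subIsetl _ _ (bnd B n)) rI.
have [q2 rq2] := rank_subquotient (gBI n) (subset_trans BII BZ') (@subset_refl _ _) rI.
have rp := rank_add gAB gIB BZ' (@subIsetl _ _ _) rq2 rq1.
have rI' := rank_add (gBI n) gAB BII BZ rp rk.
have gIBs : subgrp (addset (cyc I n) (bnd B n)) by exact: subgrp_addset.
have ZIBs : addset (cyc I n) (bnd B n) `<=` cyc B n.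
  by apply: addset_sub => // x; [exact: cycIr|exact: bcB].
(* [u] and, further on, [v] complete [q2] and [q1] to the ranks for [B] and [A]. They reappear as
   the two layers of the sum of the cycles over the sum of the boundaries, so [s = u + v]. *)
have [u ru] := rank_subquotient (gBB n) (addsetr (B := bnd B n) (gZI n))
  (@subset_refl _ _) rB.
have rq2' := (rank_second_iso q2 (gZI n) (gBB n)).1 rq2.
have rB' := rank_add (gBB n) gIBs (addsetr (gZI n)) ZIBs ru rq2'.
pose T := cyc A n `&` bnd B n.
have gT : subgrp T by exact: subgrpI.
have gTA : subgrp (addset T (bnd A n)) by exact: subgrp_addset.
have TAsub : addset T (bnd A n) `<=` cyc A n.
  by apply: addset_sub => // x; [case|exact: bcA].
have [v rv] := rank_subquotient (gBA n) (addsetr (B := bnd A n) gT)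
  (@subset_refl _ _) rA.
have rq1' : quotient_rank (addset T (bnd A n)) (bnd A n) q1.
  apply/rank_second_iso => //; move: rq1; congr (quotient_rank _ _ _).
    apply/seteqP; split=> x [Zx Bx]; split => //; first exact: cycIl.
    by apply: cycII => //; by auto.
  by apply/seteqP; split=> [x [? ?]|x [[? ?] ?]]; split => //; split => //; by auto.
have rA' := rank_add (gBA n) gTA (addsetr gT) TAsub rv rq1'.
have gAB' : subgrp (addset (cyc A n) (bnd B n)) by exact: subgrp_addset.
have ru' : quotient_rank (addset (cyc A n) (cyc B n)) (addset (cyc A n) (bnd B n)) u.
  have := (rank_second_iso u (gZB n) gAB').1;
    rewrite (_ : addset (cyc B n) _ = addset (cyc A n) (cyc B n)).
    apply; move: ru; congr (quotient_rank _ _ _); apply/seteqP; split=> x.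
      move=> [i [b [Zi Bb ->]]]; split.
        by apply: subgrpD => //; [exact: cycIr|by auto].
      by exists i, b; split => //; exact: cycIl.
    move=> [ZBx [a [b [Za Bb xE]]]]; exists a, b; split => //; apply: cycII => //.
    by rewrite -(addrK b a) -xE; apply: (gZB n).2 => //; by auto.
  apply/seteqP; split=> x.
    move=> [b [_ [Zb [a [b' [Za Bb' ->]]] ->]]]; exists a, (b + b'); split => //.
      by apply: subgrpD => //; by auto.
    by rewrite addrCA.
  move=> [a [b [Za Zb ->]]]; exists b, a; split => //; last by rewrite addrC.
  exact: addsetl.
have gS' : subgrp (addset (bnd A n) (bnd B n)) by exact: subgrp_addset.
have rv' : quotient_rank (addset (cyc A n) (bnd B n)) (addset (bnd A n) (bnd B n)) v.
  have := (rank_second_iso v (gZA n) gS').1;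
    rewrite (_ : addset (cyc A n) _ = addset (cyc A n) (bnd B n)).
    apply; move: rv; congr (quotient_rank _ _ _); apply/seteqP; split=> x.
      move=> [t [a [[Zt Bt] Ba ->]]]; split.
        by apply: subgrpD => //; by auto.
      by exists a, t; split => //; rewrite addrC.
    move=> [ZAx [a [b [Ba Bb xE]]]]; exists b, a; split => //; last by rewrite addrC.
    split => //; rewrite -(addKr a b) -xE addrC; apply: (gZA n).2 => //; by auto.
  apply/seteqP; split=> x.
    move=> [a [_ [Za [a' [b [Ba Bb ->]]] ->]]]; exists (a + a'), b; split => //.
      by apply: subgrpD => //; by auto.
    by rewrite addrA.
  move=> [a [b [Za Zb ->]]]; exists a, b; split => //.
  exact: addsetr.
have bndSE : bnd S n = addset (bnd A n) (bnd B n).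
  apply/seteqP; split=> x.
    by move=> [_ [a [b [Aa Bb ->]]] <-]; exists (d n a), (d n b);
      split; [exists a|exists b|rewrite raddfD].
  move=> [_ [_ [[a Aa <-] [b Bb <-] ->]]]; exists (a + b); last by rewrite raddfD.
  by exists a, b.
have rs : quotient_rank (addset (cyc A n) (cyc B n)) (bnd S n) (u + v).
  rewrite bndSE; apply: rank_add ru' rv' => //.
    by apply: addset_sub => //; [move=> x /(bnd_cyc sA); exact: addsetl|exact: addsetr].
  apply: addset_sub; [exact: subgrp_addset|exact: addsetl|].
  by move=> x /(bnd_cyc sB); exact: addsetr.
exists (q2 + q1)%N, k, (u + v)%N; split => //.
  exact: rank_unique rI rI'.
rewrite (rank_unique (gBA n) rA rA') (rank_unique (gBB n) rB rB').
by rewrite addnACA addnC.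
Qed.

(* The connecting homomorphism sends the class of [a + b] to that of [d a]. *)
Lemma mayer_vietoris_connecting n k :
  quotient_rank (bnd A n `&` bnd B n) (bnd I n) k ->
  quotient_rank (cyc S n.+1) (addset (cyc A n.+1) (cyc B n.+1)) k.
Proof.
move=> rk.
(* [T] collects the [A]-parts of cycles of the sum: if [d a = d b] with [b] in [B], then [a - b] is
   a cycle. On [T] the connecting map is [d] itself. *)
pose T : set (D n.+1) := [set a | A n.+1 a /\ bnd B n (d n a)].
have gT : subgrp T.
  split=> [|x y [Ax Bx] [Ay By]].
    by split; [case: (gA n.+1)|rewrite raddf0; case: (gBB n)].
  by split; [exact: (gA n.+1).2|rewrite raddfB; exact: (gBB n).2].
have gZAI : subgrp (addset (cyc A n.+1) (I n.+1)).
  by apply: subgrp_addset => //; exact: (sub_grp sI).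
have rT : quotient_rank T (addset (cyc A n.+1) (I n.+1)) k.
  apply/(rank_iso (f := d n)); last exact: rk.
  all: rewrite //=.
  - by move=> z [Az Bz]; split => //; exists z.
  - move=> _ [z [i [[Az dz] Ii ->]]]; rewrite raddfD dz add0r; by exists i.
  - move=> z [Az _] [i Ii di]; exists (z - i), i; split => //; last by rewrite subrK.
    by split; [apply: (gA n.+1).2 => //; case: Ii|rewrite raddfB di subrr].
  - move=> _ [[a Aa <-] Ba]; exists a => //; rewrite subrr; by case: (gBI n).
pose Q := addset (cyc A n.+1) (B n.+1).
have gQ : subgrp Q by exact: subgrp_addset.
have : quotient_rank (addset T Q) Q k.
  apply/rank_second_iso => //; move: rT; congr (quotient_rank _ _ _).
  apply/seteqP; split=> x.
    move=> [z [i [[Az dz] [Ai Bi] ->]]]; split; last by exists z, i.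
    split; first exact: subgrpD.
    by rewrite raddfD dz add0r; exists i.
  move=> [[Ax _] [z [b [[Az dz] Bb xE]]]]; exists z, b; split => //; split => //.
  by rewrite -(addKr z b) -xE addrC; apply: (gA n.+1).2.
(* Modulo [Q], which contains [B], a cycle [a - b] and its [A]-part [a] agree. *)
rewrite (_ : addset T Q = addset (cyc S n.+1) Q).
  move=> /(rank_second_iso k (gZS n.+1) gQ).2; congr (quotient_rank _ _ _).
  apply/seteqP; split=> x.
    move=> [[_ dx] [z [b [[Az dz] Bb xE]]]]; exists z, b; split => //; split => //.
    by move: dx; rewrite xE raddfD dz add0r.
  move=> [a [b [[Aa da] [Bb db] ->]]]; split; last by exists a, b.
  by split; [exists a, b|rewrite raddfD da db addr0].
apply/seteqP; split=> x.
  move=> [t [_ [[At [b Bb dt]] [z [b' [Zz Bb' ->]]] ->]]].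
  exists (t - b), (z + (b + b')); split.
  - split; last by rewrite raddfB dt subrr.
    by exists t, (- b); split => //; exact: subgrpN.
  - by exists z, (b + b'); split => //; exact: subgrpD.
  - by rewrite [RHS]addrCA subrKA addrCA.
move=> [_ [_ [[[a [b [Aa Bb ->]]] dab] [z [b' [Zz Bb' ->]]] ->]]].
exists a, (z + (b + b')); split.
- split => //; exists (- b); first exact: subgrpN.
  by apply/eqP; rewrite raddfN eq_sym -addr_eq0 -raddfD dab.
- by exists z, (b + b'); split => //; exact: subgrpD.
- by rewrite -addrA [b + (z + _)]addrCA.
Qed.

Lemma mayer_vietoris eA eB eI : euler A eA -> euler B eB -> euler I eI ->
  euler S (eA + eB - eI).
Proof.
move=> [hA [NA [rA zA ->]]] [hB [NB [rB zB ->]]] [hI [NI [rI zI ->]]].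
have /choice[f Hf] : forall n, exists f : nat * nat * nat,
  [/\ hI n = f.1.1 + f.1.2, f.2 + f.1.1 = hA n + hB n,
    quotient_rank (bnd A n `&` bnd B n) (bnd I n) f.1.2 &
    quotient_rank (addset (cyc A n) (cyc B n)) (bnd S n) f.2]%N.
  move=> n; have [p [k [s H]]] := mayer_vietoris_middle (rA n) (rB n) (rI n).
  by exists (p, k, s).
pose p n := (f n).1.1; pose k n := (f n).1.2; pose s n := (f n).2.
have hIE n : hI n = (p n + k n)%N by case: (Hf n).
have sE n : (s n + p n = hA n + hB n)%N by case: (Hf n).
(* The kernel in degree [m] is hit from degree [m + 1] of the sum, so [k] enters shifted by one;
   hence the opposite sign in the alternating sum and the bound [N.+1]. *)
pose k' n := if n is m.+1 then k m else 0%N.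
pose N := maxn NA (maxn NB NI).
have leA : (NA <= N)%N by exact: leq_maxl.
have leB : (NB <= N)%N by rewrite leq_max leq_maxl orbT.
have leI : (NI <= N)%N by rewrite leq_max leq_maxr orbT.
have kz n : (N <= n)%N -> k n = 0%N.
  move=> Nn; have := zI n (leq_trans leI Nn).
  by rewrite hIE => /eqP; rewrite addn_eq0 => /andP[_ /eqP].
have sz n : (N <= n)%N -> s n = 0%N.
  move=> Nn; have := sE n; rewrite zA ?(leq_trans leA) // zB ?(leq_trans leB) //.
  by move=> /eqP; rewrite addn_eq0 => /andP[/eqP].
exists (fun n => k' n + s n)%N, N.+1; split.
- case=> [|n]; first by case: (Hf 0%N) => _ _ _ /=; rewrite add0n.
  case: (Hf n) => _ _ rk _; case: (Hf n.+1) => _ _ _ rs.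
  apply: rank_add rs => //=; first exact: subgrp_addset.
  + move=> _ [_ [a [b [Aa Bb ->]]] <-]; exists (d n.+1 a), (d n.+1 b).
    rewrite raddfD; split => //; [apply: (@bcA n.+1); by exists a|apply: (@bcB n.+1); by exists b].
  + move=> _ [a [b [[Aa da] [Bb db] ->]]]; split; first by exists a, b.
    by rewrite raddfD da db addr0.
  + exact: mayer_vietoris_connecting.
- by case=> // n Nn; rewrite /= kz // sz // ltnW.
rewrite -(euler_widen (leqW leA) zA) -(euler_widen (leqW leB) zB).
rewrite -(euler_widen leI zI).
have -> : \sum_(n < N.+1) (-1) ^+ n * (k' n + s n)%N%:Z =
    \sum_(n < N.+1) (-1) ^+ n * (s n)%:Z - \sum_(n < N) (-1) ^+ n * (k n)%:Z :> int.
  under eq_bigr do rewrite PoszD mulrDr.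
  rewrite big_split /= addrC; congr (_ + _).
  rewrite big_ord_recl /= mulr0 add0r -sumrN; apply: eq_bigr => i _.
  by rewrite /bump /= exprS mulN1r mulNr.
have -> : \sum_(n < N) (-1) ^+ n * (hI n)%:Z =
    \sum_(n < N) (-1) ^+ n * (p n)%:Z + \sum_(n < N) (-1) ^+ n * (k n)%:Z :> int.
  by rewrite -big_split; apply: eq_bigr => n _; rewrite hIE PoszD mulrDr.
rewrite opprD addrA; congr (_ - _).
have -> : \sum_(n < N) (-1) ^+ n * (p n)%:Z = \sum_(n < N.+1) (-1) ^+ n * (p n)%:Z :> int.
  apply/esym/euler_widen => // n Nn.
  have := zI n (leq_trans leI Nn).
  by rewrite hIE => /eqP; rewrite addn_eq0 => /andP[/eqP].
apply/eqP; rewrite subr_eq -!big_split /=; apply/eqP/eq_bigr => n _.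
by rewrite -!mulrDr -!PoszD -sE.
Qed.

End MayerVietoris.

Lemma hrank_equiv A' A n r : subcomplex A' -> subcomplex A ->
  (forall n, A' n `<=` A n) ->
  (forall n z, cyc A n z -> exists2 z', cyc A' n z' & bnd A n (z - z')) ->
  (forall n z, cyc A' n z -> bnd A n z -> bnd A' n z) ->
  hrank A' n r <-> hrank A n r.
Proof.
move=> sA' sA AA surj inj; apply: (rank_iso (f := idfun)) => //=.
- exact: subgrp_cyc.
- exact: subgrp_bnd.
- exact: subgrp_bnd.
- case: n => [|n] z; first exact: AA.
  by case=> Az dz; split => //; exact: AA.
- exact: bndS.
- exact: inj.
- exact: surj.
Qed.

Lemma euler_equiv A' A e : (forall n r, hrank A' n r <-> hrank A n r) ->
  euler A' e -> euler A e.
Proof.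
by move=> H [b [N [rb zb eb]]]; exists b, N; split => // n; apply/H.
Qed.

Lemma euler_acyclic A : subcomplex A -> (forall n, cyc A n `<=` bnd A n) ->
  euler A 0.
Proof.
move=> sA ac; exists (fun=> 0%N), 0%N; split => [n||] //; last by rewrite big_ord0.
split; first by exists (fun=> 0) => [[]//|? ? []].
move=> z Zz iz; have Bz : bnd A n (\sum_i z i *~ (fun=> 1 : int) i).
  by rewrite big_ord1 mulr1z; exact: ac.
by have := iz _ Bz ord0.
Qed.

End Complex.

Arguments cyc {D} d A n x.
Arguments bnd {D} d A n x.
Arguments hrank {D} d A n r.
Arguments euler {D} d A e.
Arguments subcomplex {D} d A.

Lemma subrACA (M : zmodType) (a b c d : M) : a - b - (c - d) = a - c - (b - d).
Proof. by rewrite !opprD !opprK addrACA. Qed.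

(** * Chains of lists of points *)

Section FreeChains.
Variable K : choiceType.
Implicit Types (c : {freeg K}) (P : K -> Prop).

Definition zlift (M : lmodType int) (f : K -> M) : {freeg K} -> M := fglift f.

Lemma zlift_is_additive (M : lmodType int) (f : K -> M) : zmod_morphism (zlift f).
Proof. exact: lift_is_additive. Qed.

HB.instance Definition _ (M : lmodType int) (f : K -> M) :=
  GRing.isZmodMorphism.Build {freeg K} M (zlift f) (zlift_is_additive f).

Lemma zliftU (M : lmodType int) (f : K -> M) x : zlift f << x >> = f x.
Proof. by rewrite /zlift liftU scale1r. Qed.

Lemma freeg_sum c : c = \sum_(x <- dom c) << x >> *~ coeff x c.
Proof.
rewrite -{1}[c]freeg_sumE; apply: eq_bigr => x _.
by rewrite freegU_mulz intz.
Qed.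

Definition on P : set {freeg K} := [set c | forall x, x \in dom c -> P x].

Lemma subgrp_on P : subgrp (on P).
Proof.
split=> [x|c c' Pc Pc' x]; first by rewrite dom0.
by move=> /domB; rewrite mem_cat => /orP[/Pc|/Pc'].
Qed.

Lemma onB P c c' : on P c -> on P c' -> on P (c - c').
Proof. exact: (subgrp_on P).2. Qed.

Lemma on0 P : on P 0. Proof. by case: (subgrp_on P). Qed.

Lemma onU P x : P x -> on P << x >>.
Proof. by move=> Px y; rewrite domU1 inE => /eqP->. Qed.

Lemma onS P Q c : on P c -> (forall x, P x -> Q x) -> on Q c.
Proof. by move=> Pc PQ x /Pc/PQ. Qed.

Lemma onT c : on (fun=> True) c. Proof. by []. Qed.

Lemma on_ind P (S : set {freeg K}) : subgrp S -> (forall x, P x -> S << x >>) ->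
  on P `<=` S.
Proof.
move=> sS PS c Pc; rewrite [c]freeg_sum big_seq.
by apply: subgrp_sum => // x /Pc/PS; exact: subgrp_mulz.
Qed.

Lemma subgrp_preim (M N : zmodType) (f : {additive M -> N}) (S : set N) :
  subgrp S -> subgrp (f @^-1` S).
Proof.
move=> sS; split=> [|x y Sx Sy]; first by rewrite /preimage /= raddf0; case: sS.
by rewrite /preimage /= raddfB; exact: sS.2.
Qed.

Lemma subgrp_eq (M N : zmodType) (f g : {additive M -> N}) :
  subgrp [set x | f x = g x].
Proof. by split=> [|x y /= fx fy]; rewrite /= ?raddf0 // !raddfB fx fy. Qed.

Lemma zlift_on P (M : lmodType int) (f : K -> M) (S : set M) c : subgrp S ->
  (forall x, P x -> S (f x)) -> on P c -> S (zlift f c).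
Proof.
move=> sS PS; move: c; apply: (on_ind (S := zlift f @^-1` S)).
  exact: subgrp_preim.
by move=> x /PS; rewrite /preimage /= zliftU.
Qed.

Lemma additive_ext P (M : zmodType) (f g : {additive {freeg K} -> M}) c :
  (forall x, P x -> f << x >> = g << x >>) -> on P c -> f c = g c.
Proof.
by move=> fg; move: c; apply: (on_ind (S := [set c | f c = g c])) => //; exact: subgrp_eq.
Qed.

Lemma additive_extT (M : zmodType) (f g : {additive {freeg K} -> M}) c :
  (forall x, f << x >> = g << x >>) -> f c = g c.
Proof. by move=> fg; apply: (additive_ext (fun x _ => fg x)) (@onT c). Qed.

Lemma zlift_ext P (M : lmodType int) (f g : K -> M) c :
  (forall x, P x -> f x = g x) -> on P c -> zlift f c = zlift g c.
Proof.
move=> fg; apply: (@additive_ext P M (zlift f) (zlift g)) => x Px /=.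
by rewrite !zliftU fg.
Qed.

End FreeChains.

Section ListChains.
Implicit Types E F : choiceType.

Definition cone E (x : E) : {freeg seq E} -> {freeg seq E} :=
  zlift (fun l => << x :: l >>).
HB.instance Definition _ E (x : E) := GRing.Additive.on (cone x).

(* The empty list generates degree [-1], so the complex is augmented. *)
Fixpoint bdl E (l : seq E) : {freeg seq E} :=
  if l is x :: l' then << l' >> - cone x (bdl l') else 0.

Definition bd E : {freeg seq E} -> {freeg seq E} := zlift (@bdl E).
HB.instance Definition _ E := GRing.Additive.on (@bd E).

Definition lmap E F (g : E -> F) : {freeg seq E} -> {freeg seq F} :=
  zlift (fun l => << map g l >>).
HB.instance Definition _ E F (g : E -> F) := GRing.Additive.on (lmap g).

Lemma coneU E (x : E) l : cone x << l >> = << x :: l >>.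
Proof. exact: zliftU. Qed.

Lemma bdU E (l : seq E) : bd << l >> = bdl l.
Proof. exact: zliftU. Qed.

Lemma lmapU E F (g : E -> F) l : lmap g << l >> = << map g l >>.
Proof. exact: zliftU. Qed.

(** The cone is a contracting homotopy. Since the empty list is a generator, the formula has no
    exceptional case in the lowest degree. *)
Lemma bd_cone E (x : E) c : bd (cone x c) = c - cone x (bd c).
Proof.
refine (@additive_extT _ _ (@bd E \o cone x) (idfun \- (cone x \o @bd E)) c _) => l /=.
by rewrite coneU !bdU.
Qed.

Lemma bd_bdl E (l : seq E) : bd (bdl l) = 0.
Proof.
elim: l => [|x l IH]; first by rewrite raddf0.
by rewrite /= raddfB /= bdU bd_cone IH raddf0 subr0 subrr.
Qed.

Lemma lmap_cone E F (g : E -> F) x c : lmap g (cone x c) = cone (g x) (lmap g c).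
Proof.
apply: (@additive_extT _ _ (lmap g \o cone x) (cone (g x) \o lmap g)) => l /=.
by rewrite coneU !lmapU coneU.
Qed.

Lemma lmap_bdl E F (g : E -> F) l : bdl (map g l) = lmap g (bdl l).
Proof.
elim: l => [|x l IH] /=; first by rewrite raddf0.
by rewrite raddfB /= lmapU lmap_cone IH.
Qed.

Lemma on_cone E (P Q : seq E -> Prop) x c : (forall l, P l -> Q (x :: l)) ->
  on P c -> on Q (cone x c).
Proof.
move=> PQ; apply: zlift_on => [|l Pl]; first exact: subgrp_on.
by apply: onU; exact: PQ.
Qed.

Lemma bdl_on E (l : seq E) :
  on (fun l' => size l = (size l').+1 /\ {subset l' <= l}) (bdl l).
Proof.
elim: l => [|x l IH] /=; first exact: on0.
apply: onB.
  by apply: onU; split => // y yl; rewrite inE yl orbT.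
apply: on_cone IH => l' [sl sub]; split; first by rewrite /= sl.
by move=> y; rewrite !inE => /orP[->//|/sub->]; rewrite orbT.
Qed.

End ListChains.

(** * Barycentric subdivision and prisms on lists of points *)

Section Prism.
Variable R : numFieldType.
Implicit Types E F : lmodType R.

Definition bary E (l : seq E) : E := (size l)%:R^-1 *: \sum_(x <- l) x.

Lemma bary_map E F (g : {linear E -> F}) l : bary (map g l) = g (bary l).
Proof. by rewrite /bary size_map big_map [RHS]linearZ /=; congr (_ *: _); rewrite raddf_sum. Qed.

(* The recursion depth [n] is meant to be [size l]; likewise for [prism]. *)
Fixpoint sd E n (l : seq E) : {freeg seq E} :=
  if n is m.+1 then cone (bary l) (zlift (@sd E m) (bdl l)) else << [::] >>.

Definition top E (l : seq E) : seq (E * R^o) := [seq (x, 1) | x <- l].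
Definition bot E (l : seq E) : seq (E * R^o) := [seq (x, 0) | x <- l].

(* For [e = 1] this is a prism operator; for [e = 0] it is a chain homotopy from
   the inclusion of the top face to the subdivision of the bottom face. *)
Fixpoint prism E (e : int) n (l : seq E) : {freeg seq (E * R^o)} :=
  if n is m.+1 then
    cone (bary l, 0) (<< top l >> - << bot l >> *~ e - zlift (prism e m) (bdl l))
  else 0.

(** By [bd_cone] the prism over the boundary cancels, leaving the cone over the boundary of what was
    coned. The induction hypothesis, extended linearly to [bdl l] and combined with
    [bd (bdl l) = 0], identifies that boundary with a multiple [1 - e] of the subdivided boundary,
    whose cone is the subdivision of [l]. *)
Lemma prism_bd E e n (l : seq E) : size l = n ->
  bd (prism e n l) + zlift (prism e n.-1) (bdl l) =
  << top l >> - << bot l >> *~ e - lmap (fun x : E => (x, 0) : E * R^o) (sd n l) *~ (1 - e).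
Proof.
elim: n l => [|n IH] l.
  move=> /size0nil -> /=; rewrite !raddf0 addr0 lmapU /= mulrzBr mulr1z opprB.
  by rewrite addrC subrKA subrr.
move=> sl; set X := << top l >> - << bot l >> *~ e.
set c := bdl l; set i0 := fun x : E => (x, 0) : E * R^o.
have IHc : bd (zlift (prism e n) c) + zlift (prism e n.-1) (bd c) =
    lmap (fun x : E => (x, 1) : E * R^o) c - lmap i0 c *~ e
    - lmap i0 (zlift (sd n) c) *~ (1 - e).
  have : on (fun l' => size l' = n) c.
    by move=> l' /(@bdl_on _ l)[]; rewrite sl => -[].
  move: (c); apply: on_ind.
    move: (1 - e) => e1; split=> [|x y /= ex ey]; first by rewrite /= !raddf0 !mul0rz !subr0 addr0.
    rewrite /= !raddfB /= !mulrzBl addrACA -opprD ex ey.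
    by rewrite [LHS]subrACA [X in X - _]subrACA.
  by move=> l' sl'; rewrite /= !zliftU bdU !lmapU IH.
rewrite /= bd_cone -/c -/X addrAC subrK; congr (_ - _).
rewrite lmap_cone -raddfMz; congr cone.
move: IHc; rewrite bd_bdl raddf0 addr0 => IHc.
rewrite [LHS]raddfB /= IHc /X raddfB raddfMz /= !bdU /top /bot !lmap_bdl.
by rewrite opprB addrC subrK.
Qed.

(** Barycentres commute with linear maps. This naturality allows the operator on singular chains to
    be defined on the standard simplex alone. *)
Lemma prism_map E F (g : {linear E -> F}) e n l :
  prism e n (map g l) = lmap (fun p : E * R^o => (g p.1, p.2) : F * R^o) (prism e n l).
Proof.
elim: n l => [|n IH] l /=; first by rewrite raddf0.
set gp := fun p : E * R^o => (g p.1, p.2) : F * R^o.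
rewrite bary_map lmap_cone /=; congr cone; rewrite !raddfB raddfMz /= !lmapU.
congr (_ - _ *~ _ - _); rewrite /top /bot -?map_comp //.
rewrite lmap_bdl.
refine (@additive_extT _ _ (zlift (prism e n) \o lmap g) (lmap gp \o zlift (prism e n)) _ _).
by move=> l' /=; rewrite lmapU !zliftU IH.
Qed.

Definition bary_closed E (D : set E) :=
  forall l : seq E, l != [::] -> (forall x, x \in l -> D x) -> D (bary l).

Lemma sd_on E (D : set E) n l : bary_closed D -> size l = n ->
  (forall x, x \in l -> D x) ->
  on (fun l' : seq E => size l' = n /\ forall x, x \in l' -> D x) (sd n l).
Proof.
move=> cD; elim: n l => [|n IH] l sl Dl; first exact: onU.
apply: (@on_cone _ (fun l' : seq E => size l' = n /\ forall x, x \in l' -> D x)).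
  move=> l' [sl' Dl']; split; first by rewrite /= sl'.
  move=> x; rewrite inE => /orP[/eqP->|/Dl'//]; apply: cD => //.
  by rewrite -size_eq0 sl.
apply: zlift_on (@bdl_on _ l); first exact: subgrp_on.
move=> l' [sl' sub]; apply: IH; first by case: (sl'); rewrite sl => -[].
by move=> x /sub/Dl.
Qed.

Lemma prism_on E (D : set E) e n l : bary_closed D -> size l = n ->
  (forall x, x \in l -> D x) ->
  on (fun l' : seq (E * R^o) => size l' = n.+1 /\
    forall p, p \in l' -> D p.1 /\ 0 <= p.2 <= 1) (prism e n l).
Proof.
move=> cD; elim: n l => [|n IH] l sl Dl; first exact: on0.
pose P (l' : seq (E * R^o)) := size l' = n.+1 /\
  forall p, p \in l' -> D p.1 /\ 0 <= p.2 <= 1.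
have gP : subgrp (on P) := subgrp_on P.
apply: (@on_cone _ P).
  move=> l' [sl' Dl']; split; first by rewrite /= sl'.
  move=> x; rewrite inE => /orP[/eqP->|/Dl'//]; split; last by rewrite lexx ler01.
  by apply: cD => //; rewrite -size_eq0 sl.
apply: gP.2; last first.
  apply: zlift_on (@bdl_on _ l); first exact: gP.
  move=> l' [sl' sub]; apply: IH; first by case: (sl'); rewrite sl => -[].
  by move=> x /sub/Dl.
apply: gP.2.
  apply: onU; split; first by rewrite size_map.
  by move=> _ /mapP[x /Dl Dx ->]; rewrite /= lexx ler01.
apply: (@subgrp_mulz _ (on P) << bot l >> e gP).
apply: onU; split; first by rewrite size_map.
by move=> _ /mapP[x /Dl Dx ->]; rewrite /= lexx ler01.
Qed.

End Prism.

(** * Shrinking of the mesh under subdivision *)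

Section Mesh.
Variables (R : realFieldType) (E : normedModType R).
Implicit Types (l : seq E) (x y : E).

Definition mesh_le l (r : R) := forall x y, x \in l -> y \in l -> `|x - y| <= r.

Lemma bary_dist l y r : l != [::] -> (forall x, x \in l -> `|x - y| <= r) ->
  `|bary l - y| <= r.
Proof.
move=> l0 lr; have s0 : 0 < (size l)%:R :> R by rewrite ltr0n lt0n size_eq0.
have -> : bary l - y = (size l)%:R^-1 *: \sum_(x <- l) (x - y).
  rewrite sumrB scalerBr; congr (_ - _).
  rewrite big_const_seq count_predT iter_addr_0 -[y *+ _]scaler_nat scalerA.
  by rewrite mulVf ?scale1r // gt_eqF.
rewrite normrZ normrV ?unitfE ?gt_eqF // (ger0_norm (ltW s0)) ler_pdivrMl //.
apply: le_trans (ler_norm_sum _ _ _) _.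
rewrite big_seq (le_trans (ler_sum _ lr)) // -big_seq big_const_seq count_predT.
by rewrite iter_addr_0 mulr_natl.
Qed.

(** In the average of the differences [y - x] the term [y = x] vanishes, which leaves one summand
    fewer than the denominator. *)
Lemma bary_mesh l x r : mesh_le l r -> x \in l ->
  `|bary l - x| <= (size l).-1%:R / (size l)%:R * r.
Proof.
move=> lr xl; have s0 : 0 < (size l)%:R :> R by rewrite ltr0n lt0n size_eq0; case: l xl {lr}.
have -> : bary l - x = (size l)%:R^-1 *: \sum_(y <- rem x l) (y - x).
  have -> : \sum_(y <- rem x l) (y - x) = \sum_(y <- l) (y - x).
    by rewrite [RHS](perm_big _ (perm_to_rem xl)) big_cons /= subrr add0r.
  rewrite sumrB scalerBr; congr (_ - _).
  rewrite big_const_seq count_predT iter_addr_0 -[x *+ _]scaler_nat scalerA.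
  by rewrite mulVf ?scale1r // gt_eqF.
rewrite normrZ normrV ?unitfE ?gt_eqF // (ger0_norm (ltW s0)) mulrAC.
rewrite mulrC ler_pM2r ?invr_gt0 //.
apply: le_trans (ler_norm_sum _ _ _) _.
rewrite big_seq (le_trans (ler_sum _ (G := fun=> r) _)) //.
  by move=> y /mem_rem yl; exact: lr.
by rewrite -big_seq big_const_seq count_predT iter_addr_0 size_rem // mulr_natl.
Qed.

(** The factor is that of the top dimension [N], which dominates those of the faces and so stays
    fixed along the induction. *)
Lemma sd_mesh N n l r : size l = n -> (n <= N.+1)%N -> mesh_le l r -> 0 <= r ->
  on (fun l' => mesh_le l' (N%:R / N.+1%:R * r)) (sd n l).
Proof.
move=> + + + r0; elim: n l => [|n IH] l sl nN lr; first exact: onU.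
(* Closeness to [bary l] is recorded as well, since that point is joined to [l'] next. It passes to
   the subdivided faces because a ball is closed under barycentres. *)
pose H l' := mesh_le l' (N%:R / N.+1%:R * r) /\
  forall x, x \in l' -> `|bary l - x| <= N%:R / N.+1%:R * r.
have r0' : 0 <= N%:R / N.+1%:R * r by rewrite mulr_ge0 // divr_ge0.
apply: (@on_cone _ H).
  move=> l' [lr' bl'] x y; rewrite !inE => /orP[/eqP->|xl] /orP[/eqP->|yl].
  - by rewrite subrr normr0.
  - exact: bl'.
  - by rewrite distrC; exact: bl'.
  - exact: lr'.
apply: zlift_on (@bdl_on _ l); first exact: subgrp_on.
move=> l' [sl' sub]; have sl'n : size l' = n by case: (sl'); rewrite sl => -[].
have lr' : mesh_le l' r by move=> x y /sub xl /sub yl; exact: lr.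
move=> l'' l''in; split; first exact: (IH l' sl'n (ltnW nN) lr').
pose D := [set x | `|bary l - x| <= N%:R / N.+1%:R * r].
have cD : bary_closed D.
  move=> k k0 Dk; rewrite /D /= distrC; apply: bary_dist => // x /Dk.
  by rewrite /D /= distrC.
have [|_] := sd_on cD sl'n _ l''in; last by [].
move=> x /sub xl; rewrite /D /=; apply: le_trans (bary_mesh lr xl) _.
rewrite sl /= ler_wpM2r // ler_pdivrMr ?ltr0n // mulrAC ler_pdivlMr ?ltr0n //.
by rewrite -!natrM ler_nat mulnC [leqRHS]mulnC !mulSn; lia.
Qed.
End Mesh.

(** Brings the recursive boundary into the alternating form in which [boundary] is defined on
    singular simplices. *)
Lemma bdl_sum (E : choiceType) (l : seq E) :
  bdl l = \sum_(i < size l) << take i l ++ drop i.+1 l >> *~ (-1) ^+ i.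
Proof.
elim: l => [|x l IH]; first by rewrite big_ord0.
rewrite [LHS]/= IH /= big_ord_recl /= drop0 expr0 mulr1z raddf_sum; congr (_ + _).
rewrite -sumrN; apply: eq_bigr => i _.
by rewrite raddfMz /= coneU /bump /= exprS mulN1r mulrNz.
Qed.

(** * Affine simplices and convex sets *)

Section Affine.
Variable R : realType.
Implicit Type E : normedModType R.

Lemma simplex_setP k (x : simplex R k) : simplex_set (val x).
Proof. exact/set_mem/valP. Qed.

Lemma val_simplex_continuous k : continuous (fun x : simplex R k => val x).
Proof. exact: initial_continuous. Qed.

Lemma coord_simplex_continuous k (i : 'I_k.+1) :
  continuous (fun x : simplex R k => (val x) ord0 i).
Proof.
move=> x; have ck := @coord_continuous R 1 k.+1 ord0 i.
exact: (continuous_comp (@val_simplex_continuous k x) (ck (set_val x))).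
Qed.

Definition aff E k (l : seq E) (x : 'rV[R]_k.+1) : E :=
  \sum_(i < k.+1) x ord0 i *: l`_i.

Lemma aff_is_linear E k (l : seq E) : linear (@aff E k l).
Proof.
move=> a x y; rewrite /aff scaler_sumr -big_split; apply: eq_bigr => i _ /=.
by rewrite !mxE scalerDl scalerA.
Qed.

HB.instance Definition _ E k (l : seq E) :=
  GRing.isLinear.Build R 'rV[R]_k.+1 E *:%R (@aff E k l) (aff_is_linear l).

Lemma aff_map E (F : normedModType R) (g : {linear E -> F}) k (l : seq E) x :
  @aff F k (map g l) x = g (aff l x).
Proof.
rewrite /aff (raddf_sum g); apply: eq_bigr => i _; rewrite [RHS]linearZ /=; congr (_ *: _).
have [il|li] := ltnP i (size l); first exact: nth_map.
by rewrite !nth_default ?size_map // raddf0.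
Qed.

Lemma aff_continuous E k (l : seq E) :
  continuous (fun x : simplex R k => aff l (val x)).
Proof.
apply: continuous_big => [|i _]; first exact: add_continuous.
move=> x; have ci := @coord_simplex_continuous k i x.
have H := @cvgZr_tmp R E _ _ _ (fun y : simplex R k => (val y) ord0 i) _ l`_i ci. exact: H.
Qed.

Definition verts k : seq 'rV[R]_k.+1 := [seq delta_mx 0 i | i <- enum 'I_k.+1].

Lemma size_verts k : size (verts k) = k.+1.
Proof. by rewrite size_map size_enum_ord. Qed.

Lemma nth_verts k (i : 'I_k.+1) : (verts k)`_i = delta_mx 0 i.
Proof. by rewrite (nth_map i) ?size_enum_ord // nth_ord_enum. Qed.

Lemma aff_verts k (x : 'rV[R]_k.+1) : aff (verts k) x = x.
Proof.
by rewrite [RHS]row_sum_delta; apply: eq_bigr => i _; rewrite nth_verts.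
Qed.

Lemma map_aff_verts E k (l : seq E) : size l = k.+1 -> map (aff l) (verts k) = l.
Proof.
move=> sl; apply: (@eq_from_nth _ 0); first by rewrite size_map size_verts.
move=> i; rewrite size_map size_verts => ik.
rewrite (nth_map 0) ?size_verts // (nth_verts (Ordinal ik)).
rewrite /aff (bigD1 (Ordinal ik)) //= big1 ?addr0.
  by rewrite mxE !eqxx scale1r.
by move=> j jk; rewrite mxE (negbTE jk) andbF scale0r.
Qed.

Lemma verts_simplex k x : x \in verts k -> simplex_set x.
Proof.
move=> /mapP[i _ ->]; split; first by move=> j; rewrite mxE ler0n.
rewrite (bigD1 i) //= big1 ?addr0 ?mxE ?eqxx // => j ji.
by rewrite mxE (negbTE ji) andbF.
Qed.

Definition cvx E (D : set E) := forall k (l : seq E) (x : simplex R k),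
  size l = k.+1 -> (forall y, y \in l -> D y) -> D (aff l (val x)).

Lemma cvx_bary_closed E (D : set E) : cvx D -> bary_closed D.
Proof.
move=> cD l l0 Dl; have sl : size l = (size l).-1.+1 by case: l l0 {Dl}.
pose b : 'rV[R]_(size l).-1.+1 := \row_i (size l)%:R^-1.
have bS : b \in @simplex_set R (size l).-1.
  apply/mem_set; split; first by move=> i; rewrite mxE invr_ge0.
  under eq_bigr do rewrite mxE; rewrite big_const_ord iter_addr_0 -sl.
  by rewrite -[LHS]mulr_natr mulVf // pnatr_eq0 sl.
have := cD _ l (exist _ b bS) sl Dl; congr D.
rewrite /aff /=; under eq_bigr do rewrite mxE.
by rewrite -scaler_sumr /bary [in RHS](big_nth 0) -(big_mkord xpredT (fun i => l`_i)) -sl.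
Qed.

Lemma aff_ge0 k (l : seq R^o) (x : simplex R k) : size l = k.+1 ->
  (forall y, y \in l -> 0 <= y) -> 0 <= aff l (val x).
Proof.
move=> sl l0; apply: sumr_ge0 => i _; apply: mulr_ge0.
  by case: (simplex_setP x).
by apply/l0/mem_nth; rewrite sl.
Qed.

Lemma cvx_simplex k : cvx (@simplex_set R k).
Proof.
move=> j l x sl Dl; have [x0 x1] := simplex_setP x; split.
  move=> i; rewrite /aff summxE; apply: sumr_ge0 => m _; rewrite mxE mulr_ge0 //.
  have ml : (m < size l)%N by rewrite sl.
  by have [] := Dl _ (mem_nth 0 ml).
rewrite /aff; under eq_bigr do rewrite summxE.
rewrite exchange_big /= -[RHS]x1; apply: eq_bigr => m _.
under eq_bigr do rewrite mxE.
rewrite -mulr_sumr; have [_ ->] : simplex_set l`_m by apply/Dl/mem_nth; rewrite sl.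
by rewrite mulr1.
Qed.

Lemma aff_fst E (F : normedModType R) k (l : seq (E * F)) x :
  (@aff _ k l x).1 = aff (map fst l) x.
Proof.
rewrite /aff; pose p1 := fun p : E * F => p.1.
have -> : forall I (r : seq I) (G : I -> E * F), (\sum_(i <- r) G i).1 = \sum_(i <- r) (G i).1.
  by move=> I r G; elim/big_rec2: _ => // i ? ? _ <-.
apply: eq_bigr => i _ /=; congr (_ *: _).
have [il|li] := ltnP i (size l); first by rewrite (nth_map 0).
by rewrite !nth_default ?size_map.
Qed.

Lemma aff_snd E (F : normedModType R) k (l : seq (E * F)) x :
  (@aff _ k l x).2 = aff (map snd l) x.
Proof.
rewrite /aff; pose p1 := fun p : E * F => p.2.
have -> : forall I (r : seq I) (G : I -> E * F), (\sum_(i <- r) G i).2 = \sum_(i <- r) (G i).2.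
  by move=> I r G; elim/big_rec2: _ => // i ? ? _ <-.
apply: eq_bigr => i _ /=; congr (_ *: _).
have [il|li] := ltnP i (size l); first by rewrite (nth_map 0).
by rewrite !nth_default ?size_map.
Qed.

Definition cyl E (D : set E) : set (E * R^o) := [set p | D p.1 /\ 0 <= p.2 <= 1].

Lemma cvx_cyl E (D : set E) : cvx D -> cvx (cyl D).
Proof.
move=> cD k l x sl Dl; split; last first.
  have -> : (aff l (val x)).2 = aff (map snd l) (val x) :> R^o by rewrite aff_snd.
  rewrite aff_ge0 ?size_map //=; last by move=> _ /mapP[p /Dl[_ /andP[]] ? ? ->].
  have [x0 x1] := simplex_setP x.
  rewrite -[leRHS]x1; apply: ler_sum => i _; rewrite -[leRHS]mulr1 ler_wpM2l //.
  rewrite (nth_map 0) ?sl //.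
  have il : (i < size l)%N by rewrite sl.
  by have [_ /andP[]] := Dl _ (mem_nth 0 il).
rewrite aff_fst; apply: cD; first by rewrite size_map.
by move=> _ /mapP[p /Dl[Dp _] ->].
Qed.

Lemma aff_face E k (l : seq E) (i : 'I_k.+2) (x : 'rV[R]_k.+1) : size l = k.+2 ->
  aff l (face_coords i x) = aff (take i l ++ drop i.+1 l) x.
Proof.
move=> sl; rewrite /aff (bigD1_ord i) //= mxE unlift_none scale0r add0r.
apply: eq_bigr => j _; rewrite mxE liftK; congr (_ *: _).
rewrite nth_cat size_take sl ltn_ord /= /bump leqNgt.
have [ji|ij] := ltnP j i; first by rewrite nth_take ?add0n.
by rewrite nth_drop addSn subnKC // add1n.
Qed.

End Affine.

(** * Singular chains and homotopies *)

Section Singular.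
Variables (R : realType) (W : topologicalType).
Implicit Type E : normedModType R.

Lemma boundary_is_additive n : zmod_morphism (@boundary R W n).
Proof. exact: lift_is_additive. Qed.

HB.instance Definition _ n := GRing.isZmodMorphism.Build _ _ (@boundary R W n)
  (@boundary_is_additive n).

(* Augmented singular chains, shifted by one. *)
Definition chn n : lmodType int :=
  if n is k.+1 then singular_chain R W k else int^o.

Definition chd n : {additive chn n.+1 -> chn n} :=
  match n with 0%N => @deg _ | k.+1 => @boundary R W k end.

(* Junk value [0] when [g] is not continuous. *)
Definition simp n (g : simplex R n -> W) : singular_chain R W n :=
  if pselect (continuous g) is left cg
  then << (mkcts cg : continuousType (simplex R n) W) >> else 0.

Lemma simpE n (s : continuousType (simplex R n) W) : simp s = << s >>.
Proof.
rewrite /simp; case: pselect => [cg|[]]; last exact: cts_fun.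
by congr << _ >>; apply/continuousEP.
Qed.

Lemma simp_cont n (g : simplex R n -> W) : continuous g ->
  exists2 s : continuousType (simplex R n) W, g = s & simp g = << s >>.
Proof. by move=> cg; exists (mkcts cg) => //; rewrite -simpE. Qed.

(** The bridge from lists to singular chains: [f] along the affine simplex with vertices [l]. The
    empty list becomes the generator of the augmentation, so degrees on both sides are list
    sizes. *)
Definition rho E (f : E -> W) n (l : seq E) : chn n :=
  if n is k.+1 then simp (fun x : simplex R k => f (aff l (val x))) else (1 : int).

Definition rhoc E (f : E -> W) n : {freeg seq E} -> chn n := zlift (rho f n).
HB.instance Definition _ E (f : E -> W) n := GRing.Additive.on (rhoc f n).

Lemma rhocU E (f : E -> W) n l : rhoc f n << l >> = rho f n l.
Proof. exact: zliftU. Qed.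

(** Continuity on [D] as seen by maps from simplices. Off [D] the values of [f] are arbitrary, as
    for [ext]. *)
Definition admissible E (f : E -> W) (D : set E) :=
  forall k (g : simplex R k -> E), continuous g -> (forall x, D (g x)) ->
    continuous (f \o g).

Lemma rho_cont E (f : E -> W) D k (l : seq E) : admissible f D -> cvx D ->
  size l = k.+1 -> (forall y, y \in l -> D y) ->
  continuous (fun x : simplex R k => f (aff l (val x))).
Proof.
move=> af cD sl Dl.
apply: (af k (fun x : simplex R k => aff l (val x))); first exact: aff_continuous.
by move=> x; exact: cD.
Qed.

Lemma rho_bd E (f : E -> W) D n (l : seq E) : admissible f D -> cvx D ->
  size l = n.+1 -> (forall y, y \in l -> D y) ->
  chd n (rho f n.+1 l) = rhoc f n (bdl l).
Proof.
move=> af cD sl Dl; have cf := rho_cont af cD sl Dl.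
have [s sE simE] := simp_cont cf; rewrite /rho -/(rho f n) simE.
case: n l sl Dl cf s sE simE => [|n] l sl Dl cf s sE simE.
  case: l sl {Dl cf sE simE} => [|x []] // _.
  by rewrite /= degU raddf0 subr0 rhocU.
rewrite /= /boundary -/(zlift _ _) zliftU bdl_sum raddf_sum sl /=.
apply: eq_bigr => i _; rewrite raddfMz /= rhocU -scaler_int.
congr (_ *: _); last first.
  rewrite /rho -simpE; congr simp; apply/funext => x /=.
  by rewrite -sE /= aff_face.
by rewrite rmorphXn /= mulrN1z.
Qed.

Lemma rhoc_bd E (f : E -> W) D n c : admissible f D -> cvx D ->
  on (fun l => size l = n.+1 /\ forall y, y \in l -> D y) c ->
  chd n (rhoc f n.+1 c) = rhoc f n (bd c).
Proof.
move=> af cD.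
apply: (@additive_ext _ _ _ (chd n \o rhoc f n.+1) (rhoc f n \o @bd E)) => l [sl Dl] /=.
by rewrite bdU rhocU; exact: (rho_bd af cD).
Qed.

Lemma rho_ext E (f g : E -> W) D n (l : seq E) : cvx D -> (forall y, D y -> f y = g y) ->
  size l = n -> (forall y, y \in l -> D y) -> rho f n l = rho g n l.
Proof.
move=> cD fg; case: n => // n sl Dl; congr simp; apply/funext => x.
by apply/fg/cD.
Qed.

Lemma rhoc_ext E (f g : E -> W) D n c : cvx D -> (forall y, D y -> f y = g y) ->
  on (fun l => size l = n /\ forall y, y \in l -> D y) c ->
  rhoc f n c = rhoc g n c.
Proof.
by move=> cD fg; apply: zlift_ext => l [sl Dl]; exact: (rho_ext cD).
Qed.

Lemma rho_map E (F : normedModType R) (f : F -> W) (g : {linear E -> F}) n l :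
  rho f n (map g l) = rho (f \o g) n l.
Proof.
by case: n => // n; congr simp; apply/funext => x; rewrite aff_map.
Qed.

Lemma rhoc_map E (F : normedModType R) (f : F -> W) (g : {linear E -> F}) n c :
  rhoc f n (lmap g c) = rhoc (f \o g) n c.
Proof.
apply: (@additive_extT _ _ (rhoc f n \o lmap g) (rhoc (f \o g) n)) => l /=.
by rewrite lmapU !rhocU rho_map.
Qed.

Definition vert0 k : simplex R k :=
  exist _ (delta_mx 0 ord0) (mem_set (verts_simplex (map_f _ (mem_enum 'I_k.+1 ord0)))).

(* Extended by a constant outside the simplex. *)
Definition ext k (s : simplex R k -> W) (v : 'rV[R]_k.+1) : W :=
  if pselect (simplex_set v) is left Sv then s (exist _ v (mem_set Sv))
  else s (vert0 k).

Lemma extE k (s : simplex R k -> W) x : ext s (val x) = s x.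
Proof.
rewrite /ext; case: pselect => [Sv|[]]; last exact: simplex_setP.
by congr s; apply: val_inj.
Qed.

Lemma ext_admissible k (s : continuousType (simplex R k) W) :
  admissible (ext s) (@simplex_set R k).
Proof.
move=> j g cg Sg; pose h x : simplex R k := exist _ (g x) (mem_set (Sg x)).
have -> : ext s \o g = s \o h.
  by apply/funext => x /=; rewrite -[g x]/(val (h x)) extE.
have ch : continuous h.
  by apply: (@continuous_comp_initial _ _ _ set_val h).
by move=> x; apply: continuous_comp; [exact: ch|exact: cts_fun].
Qed.

Lemma rho_verts k (s : continuousType (simplex R k) W) :
  rho (ext s) k.+1 (verts R k) = << s >>.
Proof.
by rewrite /rho -simpE; congr simp; apply/funext => x; rewrite aff_verts extE.
Qed.

Definition chs (U : set W) n : set (chn n) :=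
  match n with 0%N => setT
  | k.+1 => on (fun s : continuousType (simplex R k) W => forall x, U (s x)) end.

Arguments chs U n _ : clear implicits.

Lemma subgrp_chs U n : subgrp (chs U n).
Proof. by case: n => [|n]; [split|exact: subgrp_on]. Qed.

Lemma rho_chs E (f : E -> W) D U n (l : seq E) : admissible f D -> cvx D ->
  (forall y, D y -> U (f y)) -> size l = n -> (forall y, y \in l -> D y) ->
  chs U n (rho f n l).
Proof.
move=> af cD fU; case: n => // n sl Dl.
have [s sE simE] := simp_cont (rho_cont af cD sl Dl); rewrite /rho simE.
by apply: onU => x; rewrite -sE; apply/fU/cD.
Qed.

Lemma rhoc_chs E (f : E -> W) D U n c : admissible f D -> cvx D ->
  (forall y, D y -> U (f y)) ->
  on (fun l => size l = n /\ forall y, y \in l -> D y) c ->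
  chs U n (rhoc f n c).
Proof.
move=> af cD fU; apply: zlift_on; first exact: subgrp_chs.
by move=> l [sl Dl]; exact: (rho_chs af cD).
Qed.

Lemma chs_ind U n (S : set (chn n)) : subgrp S ->
  match n return set (chn n) -> Prop with
  | 0%N => fun S => S (1 : int)
  | k.+1 => fun S => forall s : continuousType (simplex R k) W,
      (forall x, U (s x)) -> S << s >> end S ->
  chs U n `<=` S.
Proof.
case: n S => [|n] S gS HS; last exact: on_ind.
move=> z _; have := subgrp_mulz (z : int) gS HS.
by congr S; rewrite -[RHS]intz -[RHS]mulrzr mul1r.
Qed.

Lemma chsS U V n : U `<=` V -> chs U n `<=` chs V n.
Proof. by move=> UV; case: n => // n; move=> c cU; apply: (onS cU) => s Us x; exact: UV. Qed.

Lemma chd_chs U n x : chs U n.+1 x -> chs U n (chd n x).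
Proof.
move: x; apply: chs_ind; first exact: (subgrp_preim (chd n)) (@subgrp_chs U n).
move=> s Us; rewrite /preimage /= -rho_verts.
have cS := @cvx_simplex R n; have aS := @ext_admissible n s.
rewrite (rho_bd aS cS) ?size_verts //; last exact: verts_simplex.
have US y : simplex_set y -> U (ext s y).
  by move=> Sy; rewrite -[y]/(val (exist _ y (mem_set Sy) : simplex R n)) extE.
apply: (rhoc_chs aS cS US) => l /bdl_on[]; rewrite size_verts => -[<-] sub.
by split => // y /sub; exact: verts_simplex.
Qed.

Lemma chd_chd n (x : chn n.+2) : chd n (chd n.+1 x) = 0.
Proof.
have : chs setT n.+2 x by [].
move: x; apply: (@chs_ind _ _ [set x | chd n (chd n.+1 x) = 0]).
  by split=> [|x y /= ex ey]; rewrite /= ?raddf0 // !raddfB /= ex ey subr0.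
move=> s _ /=; rewrite -rho_verts.
have cS := @cvx_simplex R n.+1; have aS := @ext_admissible n.+1 s.
rewrite (rho_bd aS cS) ?size_verts //; last exact: verts_simplex.
rewrite (rhoc_bd aS cS) ?bd_bdl ?raddf0 // => l /bdl_on[].
rewrite size_verts => -[<-] sub; split => // y /sub; exact: verts_simplex.
Qed.

Lemma subcomplex_chs U : subcomplex chd (chs U).
Proof. by split=> n; [exact: subgrp_chs|exact: chd_chs]. Qed.

Section Homotopy.
Variables (e : int) (H : W -> R -> W).

(** One operator for two purposes: [e = 1] gives homotopy invariance along [H], while [e = 0] with a
    constant homotopy compares a chain with its subdivision. *)
Definition hop n : {additive chn n -> chn n.+1} :=
  match n with
  | 0%N => \0
  | k.+1 => zlift (fun s : continuousType (simplex R k) W =>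
      rhoc (fun p : 'rV[R]_k.+1 * R^o => H (ext s p.1) p.2) k.+2
        (prism e k.+1 (verts R k)))
  end.

Lemma hopU k (s : continuousType (simplex R k) W) :
  hop k.+1 << s >> = rhoc (fun p : 'rV[R]_k.+1 * R^o => H (ext s p.1) p.2) k.+2
        (prism e k.+1 (verts R k)).
Proof. exact: zliftU. Qed.

Definition hopd n : {additive chn n -> chn n} :=
  match n with 0%N => \0 | k.+1 => (hop k \o chd k) end.

(** Joint continuity is tested along singular simplices in [A]: this is what singular chains see,
    and what the criterion for cell complexes can deliver. *)
Definition hadmissible (A : set W) :=
  forall k (g : simplex R k -> W) (t : simplex R k -> R),
    continuous g -> continuous t -> (forall x, A (g x)) ->
    (forall x, 0 <= t x <= 1) -> continuous (fun x => H (g x) (t x)).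

Variable A : set W.
Hypothesis hA : hadmissible A.

Lemma cyl_admissible E (f : E -> W) D : admissible f D -> (forall y, D y -> A (f y)) ->
  admissible (fun p : E * R^o => H (f p.1) p.2) (cyl D).
Proof.
move=> af fA k g cg gD.
have c1 : continuous (fun x => (g x).1).
  by move=> x; apply: (continuous_comp (cg x)); exact: cvg_fst.
have c2 : continuous (fun x => (g x).2).
  by move=> x; apply: (continuous_comp (cg x)); exact: cvg_snd.
apply: (hA (g := fun x => f (g x).1) (t := fun x => (g x).2)) => //.
- by apply: (af k (fun x => (g x).1)) => // x; case: (gD x).
- by move=> x; apply: fA; case: (gD x).
- by move=> x; case: (gD x).
Qed.

Definition cylmap E (F : normedModType R) (g : {linear E -> F}) (p : E * R^o) : F * R^o :=
  (g p.1, p.2).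

Lemma cylmap_is_linear E (F : normedModType R) (g : {linear E -> F}) : linear (cylmap g).
Proof. by move=> a x y; rewrite /cylmap /= linearP. Qed.

HB.instance Definition _ E (F : normedModType R) (g : {linear E -> F}) :=
  GRing.isLinear.Build R (E * R^o)%type (F * R^o)%type *:%R (cylmap g) (cylmap_is_linear g).

(** By naturality of the prism under [aff l], the operator can be computed on the list [l] itself,
    where [prism_bd] applies. *)
Lemma hop_rho E (f : E -> W) D n (l : seq E) : admissible f D -> cvx D ->
  (forall y, D y -> A (f y)) -> size l = n -> (forall y, y \in l -> D y) ->
  hop n (rho f n l) = rhoc (fun p => H (f p.1) p.2) n.+1 (prism e n l).
Proof.
move=> af cD fA; case: n => [|n] sl Dl; first by rewrite /= raddf0.
have [s sE simE] := simp_cont (rho_cont af cD sl Dl).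
rewrite /rho simE hopU.
have cS := @cvx_simplex R n.
transitivity (rhoc (fun p : 'rV[R]_n.+1 * R^o => H (f (aff l p.1)) p.2) n.+2
    (prism e n.+1 (verts R n))).
  apply: (rhoc_ext (cvx_cyl cS)) => [p [Sp _]|]; last first.
    apply: (onS (prism_on (cvx_bary_closed cS) (size_verts R n) (@verts_simplex R n))).
    by move=> l' [sl' Dl']; split => // p /Dl'.
  congr (H _ _); rewrite -[p.1]/(val (exist _ p.1 (mem_set Sp) : simplex R n)) extE.
  by rewrite -sE.
have := @rhoc_map _ _ (fun p => H (f p.1) p.2) (cylmap (aff l)) n.+2
  (prism e n.+1 (verts R n)).
by rewrite -(prism_map (aff l)) map_aff_verts // => ->.
Qed.

Lemma hop_rhoc E (f : E -> W) D n c : admissible f D -> cvx D ->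
  (forall y, D y -> A (f y)) ->
  on (fun l => size l = n /\ forall y, y \in l -> D y) c ->
  hop n (rhoc f n c) = rhoc (fun p => H (f p.1) p.2) n.+1 (zlift (prism e n) c).
Proof.
move=> af cD fA.
refine (@additive_ext _ _ _ (hop n \o rhoc f n)
  (rhoc (fun p => H (f p.1) p.2) n.+1 \o zlift (prism e n)) c _) => l [sl Dl] /=.
by rewrite zliftU rhocU; exact: (hop_rho af cD).
Qed.

Definition bot1 E (x : E) : E * R^o := (x, 0).

Lemma bot1_is_linear E : linear (@bot1 E).
Proof.
by move=> a x y; apply/pair_equal_spec; split=> //=; rewrite [_ *: _]mulr0 addr0.
Qed.

HB.instance Definition _ E :=
  GRing.isLinear.Build R E (E * R^o)%type *:%R (@bot1 E) (@bot1_is_linear E).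

Lemma rho_top E (f : E * R^o -> W) n l : size l = n ->
  rho f n (top l) = rho (fun v => f (v, 1)) n l.
Proof.
case: n => // n sl; congr simp; apply/funext => x; congr f.
have -> : aff (top l) (val x) = ((aff (top l) (val x)).1, (aff (top l) (val x)).2).
  by case: (aff _ _).
rewrite aff_fst aff_snd /top -!map_comp map_id; congr pair.
rewrite /aff; transitivity (\sum_i (val x) ord0 i); last by case: (simplex_setP x).
apply: eq_bigr => i _.
by rewrite (nth_map 0) ?sl //= [_ *: _]mulr1.
Qed.

Lemma rhoc_bot E (f : E * R^o -> W) n c :
  rhoc f n (lmap (fun x : E => (x, 0) : E * R^o) c) = rhoc (fun v => f (v, 0)) n c.
Proof.
exact: (rhoc_map f (@bot1 E)).
Qed.

Lemma hop_bd E (f : E -> W) D n (l : seq E) : admissible f D -> cvx D ->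
  (forall y, D y -> A (f y)) -> size l = n -> (forall y, y \in l -> D y) ->
  chd n (hop n (rho f n l)) + hopd n (rho f n l) =
  rho (fun v => H (f v) 1) n l - rho (fun v => H (f v) 0) n l *~ e
  - rhoc (fun v => H (f v) 0) n (sd n l) *~ (1 - e).
Proof.
move=> af cD fA sl Dl; set F := fun p : E * R^o => H (f p.1) p.2.
have aF := cyl_admissible af fA; have cF := cvx_cyl cD.
have -> : hopd n (rho f n l) = rhoc F n (zlift (prism e n.-1) (bdl l)).
  case: n sl => [|n] sl; first by rewrite (size0nil sl) /= !raddf0.
  rewrite /hopd [LHS]/= (rho_bd af cD sl Dl) (hop_rhoc af cD fA) // => l' /bdl_on[].
  by rewrite sl => -[<-] sub; split => // y /sub; exact: Dl.
rewrite (hop_rho af cD fA sl Dl) (rhoc_bd aF cF) -?/F; last first.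
  by apply: (onS (prism_on (cvx_bary_closed cD) sl Dl)) => l' [sl' Dl']; split.
rewrite -raddfD prism_bd // !raddfB !raddfMz /= !rhocU rho_top //.
have -> : rho F n (bot l) = rho (fun v => H (f v) 0) n l.
  by have := rhoc_bot F n << l >>; rewrite lmapU !rhocU.
by rewrite rhoc_bot.
Qed.

Lemma hop_chs U n x : U `<=` A -> (forall p t, U p -> 0 <= t <= 1 -> U (H p t)) ->
  chs U n x -> chs U n.+1 (hop n x).
Proof.
move=> UA HU; move: x.
apply: (@chs_ind _ _ (hop n @^-1` (chs U n.+1)));
  first exact: (subgrp_preim (hop n)) (@subgrp_chs U n.+1).
case: n => [|n].
  by rewrite /preimage /=; exact: on0.
move=> s Us; rewrite /preimage /mkset hopU.
have cS := @cvx_simplex R n.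
have US y : simplex_set y -> U (ext s y).
  by move=> Sy; rewrite -[y]/(val (exist _ y (mem_set Sy) : simplex R n)) extE.
apply: (rhoc_chs (cyl_admissible (@ext_admissible _ s) _) (cvx_cyl cS)).
- by move=> y /US/UA.
- by move=> p [Sp tp]; apply: HU => //; exact: US.
- apply: (onS (prism_on (cvx_bary_closed cS) (size_verts R n) (@verts_simplex R n))).
  by move=> l' [sl' Dl']; split => // p /Dl'.
Qed.

End Homotopy.
End Singular.
Arguments chs {R W} U n _.
Arguments subgrp_chs R {W} U n.

(** * Small chains *)

Section SmallChains.
Variables (R : realType) (W : topologicalType).
Implicit Type E : normedModType R.
Local Notation chn := (chn R W).
Local Notation chd := (@chd R W).
Local Notation chs := (@chs R W).

Section HopAlgebra.
Variables (e : int) (H : W -> R -> W).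

(** The combination [d h + h d] for [h = hop], a chain map that is null-homotopic. For [e = 1] it is
    the difference between the push-forwards along the two ends of [H]. *)
Definition hopk n (x : chn n) : chn n := chd n (hop e H n x) + hopd e H n x.

Lemma hopk_is_additive n : zmod_morphism (@hopk n).
Proof. by move=> x y; rewrite /hopk !raddfB /= opprD addrACA. Qed.

HB.instance Definition _ n := GRing.isZmodMorphism.Build _ _ (@hopk n) (@hopk_is_additive n).

Lemma hopd_chd n (x : chn n.+1) : hopd e H n (chd n x) = 0.
Proof. by case: n x => [|n] x //=; rewrite chd_chd raddf0. Qed.

Lemma hopk_chd n x : chd n (hopk x) = hopk (chd n x).
Proof. by rewrite /hopk raddfD /= chd_chd add0r hopd_chd addr0. Qed.

Lemma hopk_cyc (A : forall n, set (chn n)) n x : cyc chd A n x -> hopk x = chd n (hop e H n x).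
Proof.
by rewrite /hopk; case: n x => [|n] x /=; rewrite ?addr0 // => -[_ ->]; rewrite raddf0 addr0.
Qed.
End HopAlgebra.

Lemma admissible_cst E (A : set W) (f : E -> W) D H (t : R) : hadmissible H A ->
  admissible f D -> (forall y, D y -> A (f y)) -> 0 <= t <= 1 ->
  admissible (fun v => H (f v) t) D.
Proof.
move=> hA af fA t01 k g cg gD.
apply: (hA k (f \o g) (fun=> t)) => //.
- exact: (af k g).
- exact: cst_continuous.
- by move=> x; exact: fA.
Qed.

Lemma ext_in k (s : simplex R k -> W) (U : set W) y : (forall x, U (s x)) ->
  simplex_set y -> U (ext s y).
Proof.
by move=> Us Sy; rewrite -[y]/(val (exist _ y (mem_set Sy) : simplex R k)) extE.
Qed.

(** As [H] starts at the identity, [x + hopk 1 H x] is the push-forward of [x] along the end of [H].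
    It lies in [U'] and is homologous to a cycle [x] inside [U], and inside [U'] if [x] was
    there. *)
Lemma homotopy_hrank (U U' : set W) (H : W -> R -> W) : U' `<=` U ->
  hadmissible H U ->
  (forall p t, U p -> 0 <= t <= 1 -> U (H p t)) ->
  (forall p t, U' p -> 0 <= t <= 1 -> U' (H p t)) ->
  (forall p, U p -> H p 0 = p) -> (forall p, U p -> U' (H p 1)) ->
  forall n r, hrank chd (chs U') n r <-> hrank chd (chs U) n r.
Proof.
move=> UU hU HU HU' H0 H1.
have sh n x : chs U n x -> chs U' n (x + hopk 1 H x).
  move: x; apply: (@chs_ind _ _ _ _ [set x | chs U' n (x + hopk 1 H x)]).
    have [g0 gB] := subgrp_chs R U' n; split=> [|x y /= Ux Uy].
      by rewrite /= raddf0 addr0.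
    by rewrite /= raddfB addrACA -opprD; exact: gB.
  case: n => // k s Us /=.
  have cS := @cvx_simplex R k; have aS := @ext_admissible R W k s.
  have US y : simplex_set y -> U (ext s y) by exact: ext_in.
  have vS := @verts_simplex R k; have szv := size_verts R k.
  rewrite -rho_verts /hopk (hop_bd 1 hU aS cS US szv vS) subrr mulr0z subr0 mulr1z.
  rewrite (rho_ext (f := fun v => H (ext s v) 0) (g := ext s) cS) //;
    last by move=> y /US; exact: H0.
  rewrite addrC subrK; apply: rho_chs (admissible_cst hU aS US _) cS _ szv vS.
    by rewrite ler01 lexx.
  by move=> y /US; exact: H1.
have HhU n x : chs U n x -> chs U n.+1 (hop 1 H n x).
  exact: (hop_chs hU (@subset_refl _ U) HU).
have HhU' n x : chs U' n x -> chs U' n.+1 (hop 1 H n x).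
  exact: (hop_chs hU UU HU').
move=> n r; apply: hrank_equiv; [exact: subcomplex_chs|exact: subcomplex_chs| | |].
- by move=> m; exact: chsS.
- move=> m z Zz; exists (z + hopk 1 H z); last first.
    rewrite opprD addNKr (hopk_cyc 1 H Zz); exists (- hop 1 H m z); last by rewrite raddfN.
    exact: (subgrpN (subgrp_chs R U m.+1) (HhU _ _ (cyc_sub Zz))).
  case: m z Zz => [|m] z Zz; first exact: sh.
  split; first by apply: sh; case: Zz.
  by case: (Zz) => _ dz; rewrite raddfD /= hopk_chd dz raddf0 addr0.
(* The push-forward of [c] bounds that of [z]; subtracting [hop 1 H m z], a chain in [U'], restores
   [z] as the boundary. *)
- move=> m z Zz [c Uc dc]; exists (c + hopk 1 H c - hop 1 H m z); last first.
    rewrite raddfB raddfD /= hopk_chd dc.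
    by rewrite (hopk_cyc 1 H Zz) addrK.
  by apply: (subgrp_chs R U' m.+1).2; [exact: sh|apply: HhU'; exact: (cyc_sub Zz)].
Qed.

Definition sdh (p : W) (t : R) : W := p.

Lemma sdh_admissible A : hadmissible sdh A.
Proof. by []. Qed.

(** Barycentric subdivision of singular chains, as [sub_rho] shows. Written through the homotopy
    formula, it is visibly a chain map homotopic to the identity. *)
Definition bsub n (x : chn n) : chn n := x - hopk 0 sdh x.

Lemma sub_is_additive n : zmod_morphism (@bsub n).
Proof. by move=> x y; rewrite /bsub raddfB; exact: subrACA. Qed.

HB.instance Definition _ n := GRing.isZmodMorphism.Build _ _ (@bsub n) (@sub_is_additive n).

Lemma sub_rho E (f : E -> W) D n l : admissible f D -> cvx D -> size l = n ->
  (forall y, y \in l -> D y) -> bsub (rho f n l) = rhoc f n (sd n l).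
Proof.
move=> af cD sl Dl.
rewrite /bsub /hopk (hop_bd 0 (@sdh_admissible setT) af cD) //.
by rewrite mulr0z subr0 mulr1z opprB addrC subrK.
Qed.

Lemma sub_rhoc E (f : E -> W) D n c : admissible f D -> cvx D ->
  on (fun l => size l = n /\ forall y, y \in l -> D y) c ->
  bsub (rhoc f n c) = rhoc f n (zlift (sd n) c).
Proof.
move=> af cD.
refine (@additive_ext _ _ _ (@bsub n \o rhoc f n) (rhoc f n \o zlift (sd n)) c _).
by move=> l [sl Dl] /=; rewrite zliftU rhocU; exact: (sub_rho af cD).
Qed.

Lemma sub_iter_rho E (f : E -> W) D n l m : admissible f D -> cvx D -> size l = n ->
  (forall y, y \in l -> D y) ->
  iter m (@bsub n) (rho f n l) = rhoc f n (iter m (zlift (sd n)) << l >>) /\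
  on (fun l => size l = n /\ forall y, y \in l -> D y) (iter m (zlift (sd n)) << l >>).
Proof.
move=> af cD sl Dl; elim: m => [|m [IH IHon]] /=.
  by rewrite rhocU; split => //; exact: onU.
rewrite IH (sub_rhoc af cD IHon); split => //.
apply: zlift_on IHon; first exact: subgrp_on.
by move=> l' [sl' Dl']; apply: sd_on => //; exact: cvx_bary_closed.
Qed.

Lemma sd_iter_mesh E N (l : seq E) (r : R) m : size l = N.+1 -> mesh_le l r -> 0 <= r ->
  on (fun l' => size l' = N.+1 /\ mesh_le l' ((N%:R / N.+1%:R) ^+ m * r))
    (iter m (zlift (sd N.+1)) << l >>).
Proof.
move=> sl lr r0; elim: m => [|m IH] /=.
  by apply: onU; split => //; rewrite expr0 mul1r.
have bT : bary_closed (@setT E) by [].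
apply: zlift_on IH; first exact: subgrp_on.
move=> l' [sl' lr'] l'' l''in; split; first by have [] := sd_on bT sl' (fun _ _ => I) l''in.
rewrite exprS -mulrA; apply: (sd_mesh sl' (leqnn _) lr') l''in.
by rewrite mulr_ge0 // exprn_ge0 // divr_ge0.
Qed.

(* Relatively open, as far as singular simplices of [A] can tell. *)
Definition rel_open (A U : set W) := forall k (s : continuousType (simplex R k) W),
  (forall x, A (s x)) -> open (s @^-1` U).

Lemma simplex_compact k : compact (@simplex_set R k).
Proof.
apply: bounded_closed_compact.
  exists 1; split => // M M1 x [x0 x1]; apply: le_trans (ltW M1).
  rewrite /Num.norm /= mx_normrE; apply/bigmax_leP; split=> // -[i j] _ /=.
  rewrite (ord1 i) ger0_norm // -x1 (bigD1 j) //= lerDl.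
  by apply: sumr_ge0.
rewrite (_ : @simplex_set R k = (\bigcap_(i in setT) [set x : 'rV[R]_k.+1 | 0 <= x ord0 i])
   `&` [set x | \sum_i x ord0 i = 1]); last first.
  by apply/seteqP; split=> x [x0 x1]; split=> // i; [move=> _|]; exact: x0.
apply: closedI.
  apply: closed_bigI => i _.
  have ci : continuous (fun x : 'rV[R]_k.+1 => x ord0 i) by exact: coord_continuous.
  exact: ((continuous_closedP _).1 ci _ (@closed_ge R 0)).
have cs : continuous (fun x : 'rV[R]_k.+1 => \sum_i x ord0 i).
  by apply: continuous_big => [|i _]; [exact: add_continuous|exact: coord_continuous].
exact: ((continuous_closedP _).1 cs _ (@closed_eq R 1)).
Qed.

(** A Lebesgue number for the cover pulled back to the simplex: compactness makes the locally valid
    radii uniform. *)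
Lemma simplex_lebesgue k (s : continuousType (simplex R k) W) (U V : set W) :
  open (s @^-1` U) -> open (s @^-1` V) -> (forall x, U (s x) \/ V (s x)) ->
  exists2 d : R, 0 < d & forall v : 'rV[R]_k.+1, simplex_set v ->
    (forall x : simplex R k, `|v - val x| < d -> U (s x)) \/
    (forall x : simplex R k, `|v - val x| < d -> V (s x)).
Proof.
move=> oU oV cov.
have near U' (y : simplex R k) : open (s @^-1` U') -> U' (s y) ->
    \forall v \near val y & d \near 0^'+, forall x : simplex R k, `|v - val x| < d -> U' (s x).
  move=> [B oB BE] Uy.
  have By : B (val y) by rewrite -[B _]/((set_val @^-1` B) y) BE.
  have /nbhs_ballP[r /= r0 rB] : nbhs (val y) B by exact: open_nbhs_nbhs.
  (* Half of [r] is spent on moving the centre from [y] to [v], the other half on the radius around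
     [v]. *)
  exists (ball (val y) (r / 2), [set d | d < r / 2]) => /=.
    split; first by apply: nbhsx_ballx; rewrite divr_gt0.
    by apply: nbhs_right_lt; rewrite divr_gt0.
  move=> [v d] /= [vy dr] x vx; rewrite -[U' _]/((s @^-1` U') x) -BE; apply: rB.
  rewrite (splitr r); apply: ball_triangle vy _.
  by rewrite -ball_normE /ball_ /=; exact: lt_trans vx dr.
have := @simplex_compact k => /compact_near_coveringP.
move=> /(_ R 0^'+ (fun d v => (forall x : simplex R k, `|v - val x| < d -> U (s x)) \/
    (forall x : simplex R k, `|v - val x| < d -> V (s x)))) [].
  move=> v Sv; pose y : simplex R k := exist _ v (mem_set Sv).
  case: (cov y) => [/(near _ _ oU)|/(near _ _ oV)]; apply: filterS => -[? ?] /= ?; by [left|right].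
move=> d /= d0 Hd; exists (d / 2); first by rewrite divr_gt0.
move=> v Sv; apply: (Hd (d / 2)) => //=; last by rewrite divr_gt0.
by rewrite sub0r normrN gtr0_norm ?divr_gt0 // ltr_pdivrMr // ltr_pMr // ltr1n.
Qed.

Lemma sub_small k (s : continuousType (simplex R k) W) (U V : set W) :
  open (s @^-1` U) -> open (s @^-1` V) -> (forall x, U (s x) \/ V (s x)) ->
  exists m, addset (chs U k.+1) (chs V k.+1) (iter m (@bsub k.+1) << s >>).
Proof.
move=> oU oV cov; have [d d0 Hd] := simplex_lebesgue oU oV cov.
(* In the maximum norm a point of the simplex has norm at most 1, hence the bound 2 on distances. *)
have [r r0 vr] : exists2 r, 0 <= r & mesh_le (verts R k) r.
  exists 2 => // x y /verts_simplex Sx /verts_simplex Sy.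
  have n1 z : @simplex_set R k z -> `|z| <= 1.
    move=> [z0 z1]; rewrite /Num.norm /= mx_normrE; apply/bigmax_leP; split=> // -[i j] _ /=.
    by rewrite (ord1 i) ger0_norm // -z1 (bigD1 j) //= lerDl; apply: sumr_ge0.
  by apply: le_trans (ler_normB _ _) _; rewrite -[2]/(1 + 1) lerD // n1.
have [m mr] : exists m, (k%:R / k.+1%:R) ^+ m * r < d.
  have z1 : `|k%:R / k.+1%:R : R| < 1.
    by rewrite ger0_norm ?divr_ge0 // ltr_pdivrMr ?ltr0n // mul1r ltr_nat.
  have := @cvg_geometric R r _ z1 => /cvgrPdist_lt/(_ _ d0)[m _ /(_ m (leqnn m))].
  rewrite /= sub0r normrN => H; exists m; apply: le_lt_trans H.
  by rewrite mulrC ler_norm.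
exists m; rewrite -rho_verts.
have cS := @cvx_simplex R k; have aS := @ext_admissible R W k s.
have [-> onS] := sub_iter_rho m aS cS (size_verts R k) (@verts_simplex R k).
have onM := sd_iter_mesh (m := m) (size_verts R k) vr r0.
pose P (l' : seq 'rV[R]_k.+1) := [/\ size l' = k.+1, forall y, y \in l' -> simplex_set y & 
  mesh_le l' ((k%:R / k.+1%:R) ^+ m * r)].
have onP : on P (iter m (zlift (sd k.+1)) << verts R k >>).
  by move=> l' l'in; have [? ?] := onS _ l'in; have [_ ?] := onM _ l'in.
apply: zlift_on onP; first by apply: subgrp_addset; exact: subgrp_chs.
move=> l' [sl' Dl' Ml'].
have [s' s'E simE] := simp_cont (rho_cont aS cS sl' Dl'); rewrite /rho simE.
have l0 : l'`_0 \in l' by rewrite mem_nth // sl'.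
(* A small affine simplex lies within [d] of its first vertex, so the alternative holding at that
   vertex places all of it in [U] or all of it in [V]. *)
have dist (x : simplex R k) : `|l'`_0 - aff l' (val x)| < d.
  apply: le_lt_trans mr; have [x0 x1] := simplex_setP x.
  have -> : l'`_0 - aff l' (val x) = \sum_i (val x) ord0 i *: (l'`_0 - l'`_i).
    under eq_bigr do rewrite scalerBr.
    by rewrite sumrB -scaler_suml x1 scale1r.
  apply: le_trans (ler_norm_sum _ _ _) _; set q := (_ ^+ m * r) in Ml' *.
  rewrite (_ : q = \sum_i (val x) ord0 i * q); last by rewrite -mulr_suml x1 mul1r.
  apply: ler_sum => i _; rewrite normrZ ger0_norm // ler_wpM2l //; apply: Ml' => //.
  by rewrite mem_nth // sl'.
have SA (x : simplex R k) : simplex_set (aff l' (val x)) by exact: cS.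
pose y (x : simplex R k) : simplex R k :=
  exist (fun v => v \in @simplex_set R k) _ (mem_set (SA x)).
have sx x : s' x = s (y x) by rewrite -s'E -[RHS]extE.
have [HU|HV] := Hd _ (Dl' _ l0).
- apply: addsetl; first exact: subgrp_chs.
  by apply: onU => x; rewrite sx; apply: HU; exact: dist.
- apply: addsetr; first exact: subgrp_chs.
  by apply: onU => x; rewrite sx; apply: HV; exact: dist.
Qed.
End SmallChains.
Arguments bsub {R W} n x.

Lemma quotient_rank0 (M : zmodType) (Z B : set M) : Z `<=` B -> quotient_rank Z B 0.
Proof.
move=> ZB; split; first by exists (fun=> 0) => [[]//|? ? []].
move=> z Zz iz; have Bz : B (\sum_i z i *~ (fun=> 1 : int) i).
  by rewrite big_ord1 mulr1z; exact: ZB.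
by have := iz _ Bz ord0.
Qed.

(** * Euler characteristics of subsets *)

Section EulerSets.
Variables (R : realType) (W : topologicalType).
Local Notation chn := (chn R W).
Local Notation chd := (@chd R W).
Local Notation chs := (@chs R W).
Local Notation sub := (@bsub R W).
Implicit Types U V A : set W.

Lemma sub_chd n (x : chn n.+1) m : chd n (iter m (sub n.+1) x) = iter m (sub n) (chd n x).
Proof. by elim: m => //= m IH; rewrite /bsub raddfB /= hopk_chd IH. Qed.

Lemma iter_subB n m (x y : chn n) :
  iter m (sub n) (x - y) = iter m (sub n) x - iter m (sub n) y.
Proof. by elim: m => //= m ->; rewrite raddfB. Qed.

Section Stable.
Variable A : forall n, set (chn n).
Arguments A n _ : clear implicits.
Hypothesis sA : subcomplex chd A.
Hypothesis hA : forall n x, A n x -> A n.+1 (hop 0 (@sdh R W) n x).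

Lemma sub_stable n m x : A n x -> A n (iter m (sub n) x).
Proof.
move=> Ax; elim: m => //= m IH; apply: (sub_grp sA n).2 => //.
apply: (subgrpD (sub_grp sA n)); first exact/(sub_d sA)/hA.
case: n x {Ax} IH => [|n] x IH; first by case: (sub_grp sA 0).
exact/hA/(sub_d sA).
Qed.

Lemma sub_cyc n m z : cyc chd A n z -> bnd chd A n (z - iter m (sub n) z).
Proof.
move=> Zz; elim: m => [|m IH] /=.
  by rewrite subrr; case: (subgrp_bnd n sA).
set y := iter m (sub n) z in IH *.
have Zy : cyc chd A n y.
  rewrite -[y]opprK -[- y](addKr z) opprD opprK.
  apply: (subgrp_cyc n sA).2 => //; apply: (bnd_cyc _ sA) IH; exact: chd_chd.
have -> : z - bsub n y = (z - y) + hopk 0 (@sdh R W) y.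
  by rewrite /bsub opprB addrCA addrC.
apply: (subgrpD (subgrp_bnd n sA)) => //.
rewrite (hopk_cyc 0 (@sdh R W) Zy).
by exists (hop 0 (@sdh R W) n y) => //; apply/hA/(cyc_sub Zy).
Qed.
End Stable.

Lemma chs_hop U n x : chs U n x -> chs U n.+1 (hop 0 (@sdh R W) n x).
Proof. exact: (hop_chs (@sdh_admissible R W setT) (@subsetT _ U)). Qed.

(** A chain has finitely many simplices, so some number of subdivisions makes it small; each
    subdivision is homotopic to the identity both among all chains and among small ones. *)
Lemma small_hrank U V : rel_open R (U `|` V) U -> rel_open R (U `|` V) V ->
  forall n r, hrank chd (fun n => addset (chs U n) (chs V n)) n r <->
              hrank chd (chs (U `|` V)) n r.
Proof.
move=> oU oV; pose S n := addset (chs U n) (chs V n).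
have sS : subcomplex chd S := subcomplexD (subcomplex_chs R U) (subcomplex_chs R V).
have sA := subcomplex_chs R (U `|` V).
have hS n x : S n x -> S n.+1 (hop 0 (@sdh R W) n x).
  move=> [u [v [Uu Vv ->]]]; exists (hop 0 (@sdh R W) n u), (hop 0 (@sdh R W) n v).
  by split; [exact: chs_hop|exact: chs_hop|rewrite raddfD].
have small n x : chs (U `|` V) n x -> exists m, S n (iter m (sub n) x).
  move: x; apply: (@chs_ind _ _ _ _ [set x | exists m, S n (iter m (sub n) x)]).
    split=> [|x y [m Sx] [m' Sy]]; first by exists 0%N; case: (sub_grp sS n).
    exists (m + m')%N; rewrite iter_subB; apply: (sub_grp sS n).2.
      by rewrite addnC iterD; apply: (sub_stable sS hS).
    by rewrite iterD; apply: (sub_stable sS hS).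
  case: n => [|n]; first by exists 0%N; exists 1, 0; rewrite addr0.
  by move=> s UVs; exact: sub_small (oU _ _ UVs) (oV _ _ UVs) UVs.
move=> n0 r0; apply: (hrank_equiv (A' := S)) => //.
- move=> n; apply: addset_sub; first exact: subgrp_chs.
    by apply: chsS; exact: subsetUl.
  by apply: chsS; exact: subsetUr.
- move=> n z Zz; have [m Sm] := small n z (cyc_sub Zz).
  exists (iter m (sub n) z); last by apply: sub_cyc Zz => // k x; exact: chs_hop.
  case: n z Zz Sm => [|n] z Zz Sm //; split => //; case: Zz => _ dz.
  by rewrite sub_chd dz; elim: m {Sm} => //= m ->; rewrite raddf0.
- move=> n z Zz [c Ac dc]; have [m Sm] := small n.+1 c Ac.
  rewrite -[z](subrK (iter m (sub n) z)); apply: (subgrpD (subgrp_bnd n sS)).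
    exact: (sub_cyc sS hS).
  by exists (iter m (sub n.+1) c) => //; rewrite sub_chd dc.
Qed.

Definition eul U (e : int) := euler chd (chs U) e.

Lemma eul_union U V a b c : rel_open R (U `|` V) U -> rel_open R (U `|` V) V ->
  eul U a -> eul V b -> eul (U `&` V) c -> eul (U `|` V) (a + b - c).
Proof.
move=> oU oV eU eV eI; apply: (euler_equiv (small_hrank oU oV)).
apply: mayer_vietoris => //; [exact: chd_chd|exact: subcomplex_chs|exact: subcomplex_chs|].
move: eI; rewrite /eul; congr euler; apply: functional_extensionality_dep => n.
case: n => [|n]; apply/seteqP; split=> x //.
- by move=> UV; split; apply: onS UV _ => s H y; case: (H y).
- by move=> [Ux Vx] s sx y; split; [exact: Ux|exact: Vx].
Qed.

(** The constant simplex at [p], presented through a list of equal vertices so that [bdl_nseq]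
    yields its boundary. *)
Definition ucst (p : W) n : chn n := rho (fun _ : R^o => p) n (nseq n 0).

Lemma bdl_nseq (E : choiceType) (x : E) n :
  bdl (nseq n.+1 x) = << nseq n x >> *~ odd n.+1.
Proof.
elim: n => [|n IH]; first by rewrite /= raddf0 subr0 mulr1z.
have -> : bdl (nseq n.+2 x) = << nseq n.+1 x >> - cone x (bdl (nseq n.+1 x)) by [].
rewrite IH raddfMz /= coneU.
by case: (odd n); rewrite ?mulr0z ?mulr1z ?subr0 ?subrr.
Qed.

Lemma cst_admissible (p : W) : admissible (fun _ : R^o => p) setT.
Proof. by move=> k g _ _; exact: cst_continuous. Qed.

Lemma chd_ucst p n : chd n (ucst p n.+1) = ucst p n *~ odd n.+1.
Proof.
rewrite /ucst (rho_bd (@cst_admissible p) _ _ _) ?size_nseq // bdl_nseq raddfMz.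
by rewrite /= rhocU.
Qed.

Lemma ucst_neq0 p n a : ucst p n *~ a = 0 -> a = 0.
Proof.
case: n => [|n]; first by move=> a0; rewrite -[LHS]intz.
have [s _ ->] : exists2 s : continuousType (simplex R n) W, True & ucst p n.+1 = << s >>.
  have [|s _ sE] := @simp_cont R W n (fun=> p); first exact: cst_continuous.
  by exists s.
by rewrite freegU_mulz intz => /eqP; rewrite freegU_eq0 => /eqP.
Qed.

Lemma chs_point p n z : chs [set p] n z -> exists a, z = ucst p n *~ a.
Proof.
move: z; apply: (@chs_ind _ _ _ _ [set z | exists a, z = ucst p n *~ a]).
  split=> [|_ _ [a ->] [b ->]]; first by exists 0; rewrite mulr0z.
  by exists (a - b); rewrite mulrzBr.
case: n => [|n]; first by exists 1.
move=> s sp; exists 1; rewrite mulr1z -simpE /ucst /rho; congr simp.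
by apply/funext => x; rewrite sp.
Qed.

Lemma ucst_chs p n : chs [set p] n (ucst p n).
Proof.
apply: (rho_chs (@cst_admissible p)) => //; last by rewrite size_nseq.
Qed.

(** One generator per degree, with differentials alternately an isomorphism and zero, the
    augmentation being an isomorphism: the complex is acyclic. *)
Lemma eul_point p : eul [set p] 0.
Proof.
apply: euler_acyclic; first exact: subcomplex_chs.
move=> n z Zz; have [a zE] := chs_point (cyc_sub Zz).
have [odd_n|even_n] := boolP (odd n); last first.
  exists (ucst p n.+1 *~ a);
    first by apply: (subgrp_mulz a (subgrp_chs R [set p] n.+1)); exact: ucst_chs.
  by rewrite raddfMz /= chd_ucst /= even_n mulr1z zE.
case: n z Zz zE odd_n => // n z [_ dz] zE; rewrite /= => even_n.
have : ucst p n *~ a = 0 by rewrite -dz zE raddfMz /= chd_ucst /= even_n mulr1z.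
move=> /ucst_neq0 a0; rewrite zE a0 mulr0z.
by case: (subgrp_bnd n.+1 (subcomplex_chs R [set p])) => //.
Qed.

Lemma eul_contractible U p (H : W -> R -> W) : U p -> hadmissible H U ->
  (forall x t, U x -> 0 <= t <= 1 -> U (H x t)) ->
  (forall t, 0 <= t <= 1 -> H p t = p) ->
  (forall x, U x -> H x 0 = x) -> (forall x, U x -> H x 1 = p) -> eul U 0.
Proof.
move=> Up hU HU Hp H0 H1; apply: euler_equiv (eul_point p).
apply: (homotopy_hrank (H := H)) => //; first by move=> _ ->.
by move=> _ t -> /Hp.
Qed.

(** Without simplices only the integers in degree 0, the target of the augmentation, survive. *)
Lemma eul_set0 : eul set0 1.
Proof.
have s0 := subcomplex_chs R (@set0 W).
have c0 n x : chs set0 n.+1 x -> x = 0.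
  move=> H; rewrite [x]freeg_sum big_seq; apply: big1 => s sx.
  by case: (H s sx (vert0 R n)).
exists (fun n => (n == 0%N) : nat), 1%N; split; last by rewrite big_ord1.
  case=> [|n]; last first.
    apply: quotient_rank0 => x /cyc_sub/c0 ->.
    by case: (subgrp_bnd n.+1 s0).
  apply: (basis_rank (e := fun=> 1 : int)) => //.
  - exact: subgrp_bnd.
  - move=> a [c /c0 -> ]; rewrite raddf0 big_ord1 => /esym a0 i.
    by rewrite (ord1 i) -[LHS]intz -[LHS]mulr1 mulrzl.
  - move=> z _; exists 1 => //; exists (fun=> z).
    exists 0; first by case: (sub_grp s0 1).
    rewrite raddf0 big_ord1 mulr1z [X in _ - X](_ : _ = z) ?subrr //.
    exact: (intz z).
by case.
Qed.
End EulerSets.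

(** * Cell complexes *)

Section Weights.
Variables (R : realType) (V : choiceType).
Implicit Types (s r : seq V) (w : V -> R).

(** The starting value 1 does not affect the minimum over a nonempty [s], since the weights in
    question are at most 1. *)
Definition minw s w : R := foldr (fun v a => Num.min (w v) a) 1 s.

Lemma minw_le s w v : v \in s -> minw s w <= w v.
Proof.
elim: s => //= u s IH; rewrite inE ge_min => /orP[/eqP->|/IH ->].
  by rewrite lexx.
by rewrite orbT.
Qed.

Lemma minw_le1 s w : minw s w <= 1.
Proof. by elim: s => //= u s IH; rewrite ge_min IH orbT. Qed.

Lemma minw_ge s w c : c <= 1 -> (forall v, v \in s -> c <= w v) -> c <= minw s w.
Proof.
move=> c1; elim: s => //= u s IH H; rewrite le_min H ?mem_head //=.
by apply: IH => v vs; rewrite H // inE vs orbT.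
Qed.

Lemma minw_gt0 s w : (forall v, v \in s -> 0 < w v) -> 0 < minw s w.
Proof.
elim: s => //= u s IH H; rewrite lt_min H ?mem_head //=.
by apply: IH => v vs; rewrite H // inE vs orbT.
Qed.

Lemma minw_eq0 s w v : (forall u, 0 <= w u) -> v \in s -> w v = 0 -> minw s w = 0.
Proof.
move=> w0 vs wv; apply/eqP; rewrite eq_le -{1}wv minw_le //=.
by apply: minw_ge.
Qed.

Lemma minw_ltP s w c : c <= 1 -> minw s w < c <-> exists2 v, v \in s & w v < c.
Proof.
move=> c1; split=> [mc|[v vs]]; last exact/le_lt_trans/minw_le.
apply: contrapT => H; move: mc; rewrite ltNge => /negP; apply.
by apply: minw_ge => // v vs; rewrite leNgt; apply/negP => ?; apply: H; exists v.
Qed.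

Lemma minw_attained s w v : v \in s -> (forall u, w u <= 1) ->
  exists2 u, u \in s & minw s w = w u.
Proof.
move=> + w1; suff : minw s w = 1 \/ exists2 u, u \in s & minw s w = w u.
  case=> [m1 vs|//]; exists v => //; apply/eqP; rewrite eq_le minw_le //=.
  by rewrite m1 w1.
elim: s => [|u s IH] /=; first by left.
rewrite /Order.min; case: ltP => _; first by right; exists u; rewrite ?mem_head.
by case: IH => [->|[x xs ->]]; [left|right; exists x => //; rewrite inE xs orbT].
Qed.

Lemma minw_lip s w w' d : 0 <= d -> (forall v, `|w v - w' v| <= d) ->
  `|minw s w - minw s w'| <= d.
Proof.
move=> d0 ww; elim: s => /= [|u s]; first by rewrite subrr normr0.
move: (minw s w) (minw s w') (ww u) => a b.
rewrite !ler_distl => /andP[h1 h2] /andP[h3 h4].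
rewrite /Order.min; case: ltP => h5; case: ltP => h6; apply/andP; split; lra.
Qed.

Lemma minw_cont (Z : topologicalType) s (g : Z -> V -> R) z :
  (forall v, {for z, continuous (fun x => g x v : R^o)}) ->
  {for z, continuous (fun x => minw s (g x) : R^o)}.
Proof.
move=> cg; elim: s => [|u s IH] /=; first exact: cst_continuous.
exact: (continuous_min (cg u) IH).
Qed.

Lemma conv_lt (a b d t : R) : a < d -> b < d -> 0 <= t <= 1 -> (1 - t) * a + t * b < d.
Proof.
move=> ad bd /andP[t0 t1].
rewrite -subr_gt0 (_ : _ - _ = (1 - t) * (d - a) + t * (d - b)); last by ring.
have [->|tn0] := eqVneq t 0; first by rewrite mul0r addr0 subr0 mul1r subr_gt0.
apply: ltr_wpDl; first by rewrite mulr_ge0 ?subr_ge0 // ltW.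
by rewrite mulr_gt0 ?subr_gt0 // lt_def tn0.
Qed.

Lemma conv_gt0 (a b t : R) : 0 < a -> 0 < b -> 0 <= t <= 1 -> 0 < (1 - t) * a + t * b.
Proof.
move=> a0 b0 t01; rewrite -oppr_lt0 opprD -!mulrN; apply: conv_lt => //;
  by rewrite oppr_lt0.
Qed.

Lemma cvg_mul_cst (Z : topologicalType) (f : Z -> R) (c : R) z :
  {for z, continuous f} -> (fun y => c * f y) @ z --> c * f z.
Proof. by move=> cf; exact: (cvgM (cvg_cst c) cf). Qed.

(** For homotopies at points of the older cells: there the homotopy is fixed, and nearby it moves by
    at most a multiple of a function [M] vanishing at the point. *)
Lemma cont_perturb (Z : topologicalType) (f f' M : Z -> R) (C : R) z :
  {for z, continuous f'} -> {for z, continuous M} -> M z = 0 -> f z = f' z ->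
  (\forall x \near z, `|f x - f' x| <= C * M x) -> {for z, continuous f}.
Proof.
move=> cf' cM Mz fz H.
have c0 : (fun x => C * M x) @ z --> (0 : R).
  have -> : (0 : R) = C * M z by rewrite Mz mulr0.
  exact: (cvgM (cvg_cst C) cM).
have d0 : (fun x => f x - f' x) @ z --> (0 : R).
  apply/cvgrPdist_lt => e e0; have /cvgrPdist_lt/(_ _ e0) := c0.
  apply: filterS2 H => x Hx; rewrite !sub0r !normrN; apply: le_lt_trans.
  exact: le_trans Hx (ler_norm _).
have c1 : (fun x => f x - f' x + f' x) @ z --> f z.
  by rewrite fz -[X in _ --> X]add0r; exact: (cvgD d0 cf').
apply: cvg_trans c1; apply: near_eq_cvg.
by apply: nearW => x; rewrite /= subrK.
Qed.

(** Barycentric coordinates of a point in the open simplex with vertex set [s]. *)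
Definition cellw (s : {fset V}) w := [/\ forall v, v \in s -> 0 < w v,
  forall v, v \notin s -> w v = 0 & \sum_(v <- s) w v = 1].

Lemma cellw_ge0 (s : {fset V}) w v : cellw s w -> 0 <= w v.
Proof.
by move=> [p z _]; have [/p/ltW//|/z ->] := boolP (v \in s).
Qed.

Lemma cellw_le1 (s : {fset V}) w v : cellw s w -> w v <= 1.
Proof.
move=> cw; have [p z s1] := cw; have [vs|/z ->//] := boolP (v \in s).
rewrite -s1 (big_fsetD1 v) //= lerDl; apply: sumr_ge0 => u _.
exact: cellw_ge0 cw.
Qed.

Lemma cellw_inj (s s' : {fset V}) w : cellw s w -> cellw s' w -> s = s'.
Proof.
move=> [p z _] [p' z' _]; apply/fsetP => v; apply/idP/idP => vs.
  by apply/negPn/negP => /z' w0; have := p v vs; rewrite w0 ltxx.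
by apply/negPn/negP => /z w0; have := p' v vs; rewrite w0 ltxx.
Qed.

Lemma cellw_nonempty (s : {fset V}) w : cellw s w -> exists v, v \in s.
Proof.
move=> [_ _ s1]; have [s0|[v vs]] := fset_0Vmem s; last by exists v.
by move: s1; rewrite s0 big_seq_fset0 => /eqP; rewrite eq_sym oner_eq0.
Qed.

Lemma cellw_minw_gt0 (s : {fset V}) w : cellw s w -> 0 < minw s w.
Proof. by move=> [p _ _]; exact: minw_gt0. Qed.

Lemma sum_const_fset (s : {fset V}) (c : R) : \sum_(v <- s) c = #|`s|%:R * c.
Proof. by rewrite big_const_seq count_predT iter_addr_0 mulr_natl. Qed.

End Weights.

(** * Euler characteristic of a finite cell complex described by weights *)

Section Cells.
Variables (R : realType) (V : choiceType) (W : topologicalType).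
Variables (F : seq {fset V}) (om : W -> V -> R) (pt : W).
Implicit Types (r s : {fset V}) (w : V -> R) (p : W).
Hypothesis cell_neq0 : forall s, s \in F -> exists v, v \in s.
(** Satisfied by the simplices of a complex that lie outside a subcomplex, that is, by the cells
    remaining once the subcomplex is collapsed. *)
Hypothesis cell_between : forall r s' s, r \in F -> s \in F ->
  (r `<=` s')%fset -> (s' `<=` s)%fset -> s' \in F.
Hypothesis om_cell : forall p, om p = (fun=> 0) \/ exists2 s, s \in F & cellw s (om p).
Hypothesis om_inj : injective om.
Hypothesis om_pt : om pt = fun=> 0.
Hypothesis om_surj : forall s w, s \in F -> cellw s w -> exists p, om p = w.
(* A single weight [om p v] need not be continuous at the base point, where all
   weights vanish; multiplying it by the minimum over a cell repairs this, and
   these products determine the topology of [W]. *)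
Hypothesis minw_om_cont : forall r, r \in F -> continuous (fun p => minw r (om p)).
Hypothesis minwM_om_cont : forall r v, r \in F ->
  continuous (fun p => minw r (om p) * om p v).
Hypothesis cont_crit : forall k (g : simplex R k -> W),
  (forall r, r \in F -> continuous (fun x => minw r (om (g x)))) ->
  (forall r v, r \in F -> continuous (fun x => minw r (om (g x)) * om (g x) v)) ->
  continuous g.

(* Weights that do not come from a point, such as those supported on a missing
   face, are sent to the base point. *)
Definition kap w : W := if pselect (exists p, om p = w) is left e then projT1 (cid e) else pt.

Lemma kap_out s w : cellw s w -> s \notin F -> kap w = pt.
Proof.
move=> cw sF; rewrite /kap; case: pselect => // e; exfalso.
have ew := projT2 (cid e); case: (om_cell (projT1 (cid e))); rewrite ew.
  by move=> w0; case: cw => _ _; rewrite w0 big1 // => /eqP; rewrite eq_sym oner_eq0.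
by move=> [s' s'F cw']; move: sF; rewrite (cellw_inj cw cw') s'F.
Qed.

Lemma kap_om p : kap (om p) = p.
Proof.
rewrite /kap; case: pselect => [e|[]]; last by exists p.
by apply: om_inj; exact: projT2 (cid e).
Qed.

Lemma om_kap s w : s \in F -> cellw s w -> om (kap w) = w.
Proof. by move=> sF /(om_surj sF)[p <-]; rewrite kap_om. Qed.

Lemma om_ge0 p v : 0 <= om p v.
Proof. by case: (om_cell p) => [->//|[s _]]; exact: cellw_ge0. Qed.

Lemma om_le1 p v : om p v <= 1.
Proof. by case: (om_cell p) => [->//|[s _]]; exact: cellw_le1. Qed.

Lemma minw0 r : r \in F -> minw r (fun=> 0 : R) = 0.
Proof. by move=> /cell_neq0[v vr]; exact: (minw_eq0 (v := v)). Qed.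

(** If [s'] is missing from [F], no cell [r] is contained in it by [cell_between], so some vertex of
    [r] has weight 0. Sending [w] to the base point then changes none of the continuous
    functions. *)
Lemma om_kap_face s s' w r : s \in F -> (s' `<=` s)%fset -> cellw s' w -> r \in F ->
  minw r (om (kap w)) = minw r w /\
  forall v, minw r (om (kap w)) * om (kap w) v = minw r w * w v.
Proof.
move=> sF s's cw rF; have [s'F|s'F] := boolP (s' \in F).
  by rewrite (om_kap s'F cw).
rewrite (kap_out cw s'F) om_pt.
have /fsubsetPn[v vr vs'] : ~~ (r `<=` s')%fset.
  by apply: contra s'F => rs'; exact: cell_between rs' s's.
rewrite minw0 // (minw_eq0 _ vr) //; last by case: cw => _ ->.
  by split => // u; rewrite !mul0r.
by move=> u; exact: cellw_ge0 cw.
Qed.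

(** Dividing the continuous product by the minimum recovers a single weight where the minimum is
    positive. *)
Lemma om_cont_at (Z : topologicalType) (g : Z -> W) s v z : continuous g ->
  s \in F -> 0 < minw s (om (g z)) -> {for z, continuous (fun x => om (g x) v)}.
Proof.
move=> cg sF m0.
have cm : {for z, continuous (fun x => minw s (om (g x)))}.
  exact: (continuous_comp (cg z) (@minw_om_cont _ sF (g z))).
have cn : {for z, continuous (fun x => minw s (om (g x)) * om (g x) v)}.
  exact: (continuous_comp (cg z) (@minwM_om_cont _ v sF (g z))).
have cq := cvgM cn (cvgV (lt0r_neq0 m0) cm).
have qz x : 0 < minw s (om (g x)) ->
    minw s (om (g x)) * om (g x) v * (minw s (om (g x)))^-1 = om (g x) v.
  by move=> mx; rewrite mulrAC mulfV ?mul1r // gt_eqF.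
have cq' : (fun x => minw s (om (g x)) * om (g x) v * (minw s (om (g x)))^-1) @ z
    --> om (g z) v.
  by rewrite -(qz _ m0); exact: cq.
apply: cvg_trans cq'; apply: near_eq_cvg.
have : \forall x \near z, 0 < minw s (om (g x)) by exact: (cvgr_gt _ cm _ m0).
by apply: filterS => x mx /=; rewrite qz.
Qed.

Lemma rel_open_lt (A : set W) (f : W -> R) (c : R) :
  (forall k (g : continuousType (simplex R k) W), (forall x, A (g x)) ->
     continuous (fun x => f (g x))) ->
  rel_open R A [set p | A p /\ f p < c].
Proof.
move=> cf k g gA.
rewrite (_ : g @^-1` _ = (fun x => f (g x)) @^-1` [set y | y < c]).
  by apply: open_comp => [x _|]; [exact: cf|exact: open_lt].
by apply/seteqP; split=> x //= [].
Qed.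

(** Contraction along segments towards [w0]; inside one open cell the single weights are continuous,
    so the segments depend continuously on the point. *)
Lemma eul_convex s (Q : set (V -> R)) w0 : s \in F -> Q `<=` cellw s -> Q w0 ->
  (forall w t, Q w -> 0 <= t <= 1 -> Q (fun v => (1 - t) * w v + t * w0 v)) ->
  eul R (fun p => Q (om p)) 0.
Proof.
move=> sF Qs Qw0 Qc.
pose h p t v := (1 - t) * om p v + t * w0 v.
have omh p t : Q (om p) -> 0 <= t <= 1 -> om (kap (h p t)) = h p t.
  by move=> Qp t01; apply: (om_kap sF); apply: Qs; exact: Qc.
have omw0 : om (kap w0) = w0 by apply: (om_kap sF); exact: Qs.
apply: (@eul_contractible R W _ (kap w0) (fun p t => kap (h p t))) => /=.
- by rewrite omw0.
- move=> k g t cg ct gQ t01.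
  have ch v : continuous (fun x => h (g x) (t x) v).
    move=> x; have cv : {for x, continuous (fun x => om (g x) v)}.
      by apply: (om_cont_at cg sF); apply: cellw_minw_gt0; exact/Qs/gQ.
    exact: (cvgD (cvgM (cvgB (cvg_cst (1 : R)) (ct x)) cv) (cvgM (ct x) (cvg_cst (w0 v)))).
  have cm r : continuous (fun x => minw r (h (g x) (t x))).
    by move=> x; exact: (@minw_cont _ _ _ r (fun x => h (g x) (t x)) x (fun v => ch v x)).
  apply: cont_crit => [r rF|r v rF].
    by under eq_fun do rewrite omh //; exact: cm.
  under eq_fun do rewrite omh //.
  by move=> x; exact: (cvgM (cm r x) (ch v x)).
- by move=> p t Qp t01; rewrite omh //; exact: Qc.
- move=> t t01; congr kap; apply/funext => v; rewrite /h omw0 -mulrDl subrK mul1r //.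
- move=> p Qp; rewrite -[RHS]kap_om; congr kap; apply/funext => v.
  by rewrite /h subr0 mul1r mul0r addr0.
- by move=> p Qp; congr kap; apply/funext => v; rewrite /h subrr mul0r mul1r add0r.
Qed.

Section Cover.
Variable s : {fset V}.
Hypothesis sF : s \in F.
Let n := #|`s|.

Let n_gt0 : (0 < n)%N.
Proof. by have [v vs] := cell_neq0 sF; rewrite cardfs_gt0; apply/fset0Pn; exists v. Qed.

Let nR_gt0 : 0 < n%:R :> R. Proof. by rewrite ltr0n. Qed.

Let ninv_le1 : n%:R^-1 <= 1 :> R.
Proof. by rewrite invf_le1 // ler1n. Qed.

Definition small_on (J : seq V) : set (V -> R) :=
  [set w | cellw s w /\ forall v, v \in J -> w v < n%:R^-1].

Lemma eul_small_on (J : seq V) u : u \in s -> u \notin J ->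
  eul R (fun p => small_on J (om p)) 0.
Proof.
move=> us uJ.
(* The centre of the contraction: weight [1/(2n)] everywhere except at [u], which is not constrained
   by [J] and takes the excess, making the total 1. *)
pose c v : R := if v \in s then if v == u then (n%:R + 1) / (2 * n%:R) else (2 * n%:R)^-1 else 0.
have cc : cellw s c.
  split=> [v vs|v vs|]; rewrite /c.
  - by rewrite vs; case: ifP => _; rewrite ?divr_gt0 ?invr_gt0 ?addr_gt0 ?mulr_gt0.
  - by rewrite (negbTE vs).
  rewrite (big_fsetD1 u) //= us eqxx.
  rewrite (eq_big_seq (fun=> (2 * n%:R)^-1)); last first.
    by move=> v /=; rewrite !inE => /andP[/negbTE -> ->].
  rewrite sum_const_fset.
  have -> : (#|`(s `\ u)%fset|%:R : R) = n%:R - 1.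
    by rewrite /n (cardfsD1 u s) us add1n -natr1 addrK.
  by field; rewrite gt_eqF.
apply: (eul_convex (s := s) (Q := small_on J) (w0 := c)) => //; first by move=> w [].
  split => // v vJ; have /negbTE vu : v != u by apply: contraNneq uJ => <-.
  rewrite /c vu; case: ifP => _; last by rewrite invr_gt0.
  rewrite ltf_pV2 ?posrE ?mulr_gt0 //; move: nR_gt0; lra.
move=> w t [cw wJ] /andP[t0 t1]; split; last first.
  move=> v vJ; have := wJ v vJ.
  have : c v < n%:R^-1.
    have /negbTE vu : v != u by apply: contraNneq uJ => <-.
    rewrite /c vu; case: ifP => _; last by rewrite invr_gt0.
    rewrite ltf_pV2 ?posrE ?mulr_gt0 //; move: nR_gt0; lra.
  by move=> cv wv; apply: conv_lt => //; rewrite t0.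
have [wp wz w1] := cw; have [cp cz c1] := cc; split=> [v vs|v vs|].
- by apply: conv_gt0; [exact: wp|exact: cp|rewrite t0].
- by rewrite wz // cz // !mulr0 addr0.
- by rewrite big_split /= -!mulr_sumr w1 c1 !mulr1 subrK.
Qed.

Definition small_some (J L : seq V) : set W :=
  [set p | small_on J (om p) /\ exists2 v, v \in L & om p v < n%:R^-1].

Lemma small_some1 J v : small_some J [:: v] = (fun p => small_on (v :: J) (om p)).
Proof.
apply/seteqP; split=> p.
  move=> [[cp Jp] [u]]; rewrite inE => /eqP -> uv; split => // x.
  by rewrite inE => /orP[/eqP->|/Jp].
move=> [cp Jp]; split; last by exists v; rewrite ?mem_head // Jp ?mem_head.
by split => // x xJ; apply: Jp; rewrite inE xJ orbT.
Qed.

Lemma small_some_cons J v L :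
  small_some J (v :: L) = small_some J [:: v] `|` small_some J L.
Proof.
apply/seteqP; split=> p.
  move=> [Jp [u]]; rewrite inE => /orP[/eqP->|uL] uv.
    by left; split => //; exists v; rewrite ?mem_head.
  by right; split => //; exists u.
move=> [|] [Jp [u uL uv]]; split => //; exists u => //.
  by move: uL; rewrite !inE => ->.
by rewrite inE uL orbT.
Qed.

Lemma small_some_inter J v L :
  small_some J [:: v] `&` small_some J L = small_some (v :: J) L.
Proof.
rewrite small_some1; apply/seteqP; split=> p; first by move=> [Jp [_ vL]].
move=> [[cp Jp] vL]; split; first by split.
by split => //; split => // x xJ; apply: Jp; rewrite inE xJ orbT.
Qed.

Lemma small_some_open (A : set W) J L : A `<=` (fun p => small_on J (om p)) ->
  rel_open R A (A `&` small_some J L).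
Proof.
move=> AJ; rewrite (_ : _ `&` _ = [set p | A p /\ minw L (om p) < n%:R^-1]).
  apply: rel_open_lt => k g gA x.
  apply: (@minw_cont _ _ _ L (fun x => om (g x))) => v.
  apply: om_cont_at sF _; first exact: cts_fun.
  by apply: cellw_minw_gt0; case: (AJ _ (gA x)).
apply/seteqP; split=> p [Ap].
  by move=> [_ vL]; split => //; apply/minw_ltP.
by move=> /minw_ltP vL; split => //; split; [exact: AJ|apply: vL].
Qed.

Lemma small_some_union J v L a b c : eul R (small_some J [:: v]) a ->
  eul R (small_some J L) b -> eul R (small_some (v :: J) L) c ->
  eul R (small_some J (v :: L)) (a + b - c).
Proof.
move=> ea eb; rewrite -small_some_inter => ec; rewrite (small_some_cons J v L).
have sub : small_some J [:: v] `|` small_some J L `<=` (fun p => small_on J (om p)).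
  by move=> p [|] [].
apply: eul_union => //.
- by have := @small_some_open _ J [:: v] sub; rewrite setIUl setIid (setUidl (@subIsetr _ _ _)).
- by have := @small_some_open _ J L sub; rewrite setIUl setIid (setUidr (@subIsetr _ _ _)).
Qed.

(** As long as [u] is left unconstrained, the members of the cover and their intersections are
    nonempty and convex, so all terms of Mayer-Vietoris are 0. *)
Lemma eul_small_some J L u : L != [::] -> u \in s -> u \notin L -> u \notin J ->
  eul R (small_some J L) 0.
Proof.
elim: L J => // v L IH J _ us; rewrite inE negb_or => /andP[uv uL] uJ.
have e1 : eul R (small_some J [:: v]) 0.
  by rewrite small_some1; apply: eul_small_on us _; rewrite inE negb_or uv.
case: L IH uL => [|v' L] IH uL //.
have e2 : eul R (small_some J (v' :: L)) 0 by exact: IH.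
have e3 : eul R (small_some (v :: J) (v' :: L)) 0.
  by apply: IH => //; rewrite inE negb_or uv.
by have := small_some_union e1 e2 e3; rewrite addr0 subr0.
Qed.

(* The sphere [S^(k-2)], as a union of [k] cells any proper subfamily of which
   has a contractible intersection, the total intersection being empty. *)
Lemma eul_small_some_all J L : L != [::] -> uniq L -> {subset L <= s} ->
  (forall v, v \in L -> v \notin J) -> (forall v, v \in s -> v \in J \/ v \in L) ->
  eul R (small_some J L) ((-1) ^+ (size L).-1).
Proof.
elim: L J => // v L IH J _ /= /andP[vL uL] Ls LJ JL.
have vs : v \in s by rewrite Ls ?mem_head.
have vJ : v \notin J by rewrite LJ ?mem_head.
have [L0|[u uinL]] : L = [::] \/ exists u, u \in L.
    by case: (L) => [|u L']; [left|right; exists u; rewrite mem_head].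
  rewrite L0 small_some1 expr0 (_ : (fun p => _) = set0); first exact: eul_set0.
  apply/seteqP; split=> p // [[_ _ p1] Jp].
  (* All weights are now below [1/n], so they cannot add up to 1: the total intersection is
     empty. *)
  have : \sum_(x <- s) om p x < \sum_(x <- s) n%:R^-1.
    rewrite (big_fsetD1 v) //= [ltRHS](big_fsetD1 v) //=; apply: ltr_leD.
      by apply: Jp; rewrite mem_head.
    rewrite big_seq [leRHS]big_seq; apply: ler_sum => x; rewrite !inE => /andP[xv xs].
    apply/ltW/Jp; rewrite inE; case: (JL x xs) => [->|]; first by rewrite orbT.
    by rewrite L0 inE => ->.
  by rewrite p1 sum_const_fset mulfV ?ltxx // gt_eqF.
have L0 : L != [::] by apply: contraTneq uinL => ->.
rewrite (_ : (-1) ^+ size L = 0 + 0 - (-1) ^+ (size L).-1 :> int); last first.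
  by rewrite addr0 sub0r; case: (L) L0 => // x L' _; rewrite exprS mulN1r.
apply: small_some_union.
- rewrite small_some1; apply: (eul_small_on (u := u)); first by rewrite Ls // inE uinL orbT.
  rewrite inE negb_or LJ ?inE ?uinL ?orbT // andbT.
  by apply: contraNneq vL => <-.
- exact: (eul_small_some (u := v)).
- apply: IH => //.
  + by move=> x xL; rewrite Ls // inE xL orbT.
  + move=> x xL; rewrite inE negb_or LJ ?inE ?xL ?orbT // andbT.
    by apply: contraNneq vL => <-.
  + move=> x /JL; rewrite !inE => -[->|/orP[->|->]]; [left|left|right] => //.
    by rewrite orbT.
Qed.

(** The least of [n] weights of sum 1 is at most [1/n], with equality only at the barycentre. The
    condition thus removes exactly that point. *)
Lemma eul_punctured_cell :
  eul R [set p | cellw s (om p) /\ minw s (om p) < n%:R^-1] ((-1) ^+ n.-1).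
Proof.
have -> : [set p | cellw s (om p) /\ minw s (om p) < n%:R^-1] = small_some [::] s.
  apply/seteqP; split=> p.
    by move=> [cp /(minw_ltP _ _ ninv_le1) vs]; split.
  by move=> [[cp _] vs]; split => //; apply/minw_ltP.
apply: eul_small_some_all => //.
- by rewrite -size_eq0 -lt0n.
- by move=> v vs; right.
Qed.

End Cover.

Definition cells_upto (T : seq {fset V}) : set W :=
  [set p | om p = (fun=> 0) \/ exists2 s, s \in T & cellw s (om p)].

(** * Attaching one open cell [s] to the cells of [T] *)

Section Attach.
Variables (s : {fset V}) (T : seq {fset V}).
Hypothesis sF : s \in F.
Hypothesis TF : {subset T <= F}.
Hypothesis Tmax : forall r, r \in T -> ~~ (s `<=` r)%fset.
Hypothesis Tface : forall r, r \in F -> (r `<=` s)%fset -> r != s -> r \in T.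
Let n := #|`s|.
Let m p := minw s (om p).
Let A := cells_upto (s :: T).
Let U := [set p | A p /\ m p < n%:R^-1].

Let n_gt0 : (0 < n)%N.
Proof. by have [v vs] := cell_neq0 sF; rewrite cardfs_gt0; apply/fset0Pn; exists v. Qed.

Let nR_gt0 : 0 < n%:R :> R. Proof. by rewrite ltr0n. Qed.

Let nR_ge1 : 1 <= n%:R :> R. Proof. by rewrite ler1n. Qed.

Let m_ge0 p : 0 <= m p.
Proof. by apply: minw_ge => // v _; exact: om_ge0. Qed.

Lemma minw_upto p : cells_upto T p -> m p = 0.
Proof.
rewrite /m => -[->|[r rT cr]]; first exact: minw0.
have /fsubsetPn[v vs vr] := Tmax rT.
by apply: (minw_eq0 (v := v)) => [u||]; [exact: om_ge0| |case: cr => _ ->].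
Qed.

Lemma attach_cases p : A p -> (cells_upto T p /\ m p = 0) \/ (cellw s (om p) /\ 0 < m p).
Proof.
move=> [p0|[r]]; first by left; split; [left|apply: minw_upto; left].
rewrite inE => /orP[/eqP->|rT] cr; first by right; split => //; exact: cellw_minw_gt0.
by left; split; [right; exists r|apply: minw_upto; right; exists r].
Qed.

Lemma upto_sub p : cells_upto T p -> A p.
Proof. by move=> [p0|[r rT cr]]; [left|right; exists r; rewrite // inE rT orbT]. Qed.

(* Subtracts [t] times the smallest weight on [s] and renormalizes: a homotopy
   from the identity to a retraction of the punctured cell onto its boundary. *)
Definition push p (t : R) v : R :=
  (om p v - t * m p * (v \in s)%:R) / (1 - n%:R * (t * m p)).

(** The vertices that keep a positive weight. For a point of the open cell these are all of [s]
    while [t < 1]; at [t = 1] the vertices of least weight drop out. *)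
Let face p (t : R) : {fset V} := [fset v in s | t * m p < om p v]%fset.

Lemma push_den p t : m p < n%:R^-1 -> 0 <= t <= 1 -> 0 < 1 - n%:R * (t * m p).
Proof.
move=> mp /andP[t0 t1]; rewrite subr_gt0 mulrC -ltr_pdivlMr // mul1r.
apply: le_lt_trans mp; have := m_ge0 p; move: (m p) => x x0; nra.
Qed.

Lemma push_cell p t : cellw s (om p) -> m p < n%:R^-1 -> 0 <= t <= 1 ->
  cellw (face p t) (push p t).
Proof.
move=> cp mp t01; have den := push_den mp t01; have [pp pz p1] := cp.
have z v : v \notin face p t -> push p t v = 0.
  rewrite !inE negb_and -leNgt => vf; rewrite /push.
  have [vs|vs] := boolP (v \in s); last by rewrite pz // mulr0 subr0 mul0r.
  move: vf; rewrite vs mulr1 /= => tm.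
  have := minw_le (om p) vs; rewrite -/(m p) => mv.
  have -> : om p v - t * m p = 0; last by rewrite mul0r.
  have := m_ge0 p; case/andP: t01 => t0 t1; move: tm mv; move: (om p v) (m p) => x y.
  by move=> ? ? ?; nra.
split=> // [v|].
  by rewrite !inE => /andP[vs tm]; rewrite /push vs mulr1 divr_gt0 // subr_gt0.
have sub : (face p t `<=` s)%fset by apply/fsubsetP => v; rewrite !inE => /andP[].
rewrite (big_fset_incl _ sub) => [|v _ vf]; last exact: z.
rewrite -mulr_suml sumrB p1.
rewrite (eq_big_seq (fun=> t * m p)); last by move=> v vs; rewrite vs mulr1.
by rewrite sum_const_fset mulfV // gt_eqF.
Qed.

Lemma push_face_proper p : cellw s (om p) -> face p 1 != s.
Proof.
move=> cp; have [v vs] := cellw_nonempty cp.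
have [u us mu] := minw_attained vs (om_le1 p).
apply/eqP => /fsetP/(_ u); rewrite !inE us mul1r /m mu ltxx //.
Qed.

Lemma push_id p t : m p = 0 -> push p t = om p.
Proof.
by move=> mp; apply/funext => v; rewrite /push mp !mulr0 mul0r !subr0 divr1.
Qed.

Let H p t := kap (push p t).

Lemma H_id p t : m p = 0 -> H p t = p.
Proof. by move=> mp; rewrite /H push_id // kap_om. Qed.

(** A point of the open cell stays there until it reaches a proper face. That face is either in [F],
    hence in [T], or missing, and then [kap] gives the base point. *)
Lemma H_cases p t : U p -> 0 <= t <= 1 ->
  cells_upto T (H p t) \/ [/\ t != 1, cellw s (push p t) & om (H p t) = push p t].
Proof.
move=> [Ap mp] t01; have [[Tp m0]|[cp m0]] := attach_cases Ap; first by left; rewrite H_id.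
have ch := push_cell cp mp t01.
have [fs|fs] := eqVneq (face p t) s.
  right; rewrite fs in ch; split => //; last exact: om_kap ch.
  by apply: contra_eq_neq fs => ->; exact: push_face_proper.
have sub : (face p t `<=` s)%fset by apply/fsubsetP => v; rewrite !inE => /andP[].
left; have [fF|fF] := boolP (face p t \in F).
  right; exists (face p t); first exact: Tface.
  by rewrite (om_kap fF ch).
by left; rewrite /H (kap_out ch fF).
Qed.

Lemma om_H p t r : U p -> 0 <= t <= 1 -> r \in F ->
  minw r (om (H p t)) = minw r (push p t) /\
  forall v, minw r (om (H p t)) * om (H p t) v = minw r (push p t) * push p t v.
Proof.
move=> [Ap mp] t01 rF; have [[Tp m0]|[cp m0]] := attach_cases Ap.
  by rewrite H_id // push_id.
apply: (om_kap_face sF _ (push_cell cp mp t01) rF).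
by apply/fsubsetP => v; rewrite !inE => /andP[].
Qed.

Lemma push_bounds p t v : U p -> 0 <= t <= 1 -> 0 <= push p t v <= 1.
Proof.
move=> [Ap mp] t01; have [[Tp m0]|[cp m0]] := attach_cases Ap.
  by rewrite push_id // om_ge0 om_le1.
by have ch := push_cell cp mp t01; rewrite (cellw_ge0 _ ch) (cellw_le1 _ ch).
Qed.

(** Near the older cells [push] is close to the identity uniformly in [t]. The bound [1/2] keeps its
    denominator at least [1/2], whence the factor 2. *)
Lemma push_dist p t v : 0 <= t <= 1 -> n%:R * m p <= 2^-1 ->
  `|push p t v - om p v| <= 2 * n%:R * m p.
Proof.
move=> /andP[t0 t1] nm; have mp := m_ge0 p.
have den : 2^-1 <= 1 - n%:R * (t * m p).
  move: mp nm nR_ge1; move: (m p) (n%:R) => x y ? ? ?.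
  have : t * (y * x) <= y * x by rewrite ler_piMl // mulr_ge0 // (le_trans ler01).
  by rewrite mulrCA; lra.
have den0 : 0 < 1 - n%:R * (t * m p) by apply: lt_le_trans den; rewrite invr_gt0.
have -> : push p t v - om p v =
    t * m p * (n%:R * om p v - (v \in s)%:R) / (1 - n%:R * (t * m p)).
  by rewrite /push; field; rewrite gt_eqF.
rewrite normrM normfV (gtr0_norm den0) ler_pdivrMr //.
have b1 : `|n%:R * om p v - (v \in s)%:R| <= n%:R.
  have := om_ge0 p v; have := om_le1 p v; rewrite ler_norml.
  move: nR_ge1; case: (v \in s) => /=; rewrite ?mulr1n ?mulr0n;
    move: (om p v) (n%:R) => x y ? ? ?; apply/andP; split; nra.
rewrite normrM (ger0_norm (mulr_ge0 t0 mp)).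
have : t * m p * `|n%:R * om p v - (v \in s)%:R| <= m p * n%:R.
  by apply: ler_pM => //; [exact: mulr_ge0|rewrite ler_piMl].
have : m p * n%:R <= 2 * n%:R * m p * (1 - n%:R * (t * m p)).
  have -> : 2 * n%:R * m p * (1 - n%:R * (t * m p)) =
    m p * n%:R * (2 * (1 - n%:R * (t * m p))) by ring.
  by rewrite ler_peMr ?mulr_ge0 //; lra.
by lra.
Qed.

Lemma push_cont_at (Z : topologicalType) (g : Z -> W) (t : Z -> R) z v :
  continuous g -> continuous t -> (forall x, U (g x)) -> (forall x, 0 <= t x <= 1) ->
  0 < m (g z) -> {for z, continuous (fun x => push (g x) (t x) v)}.
Proof.
move=> cg ct gU t01 m0.
have cm : {for z, continuous (fun x => m (g x))}.
  exact: (continuous_comp (cg z) (@minw_om_cont _ sF (g z))).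
have co : {for z, continuous (fun x => om (g x) v)} by exact: om_cont_at cg sF m0.
have ctm : (fun x => t x * m (g x)) @ z --> t z * m (g z) by exact: (cvgM (ct z) cm).
have den : 1 - n%:R * (t z * m (g z)) != 0.
  by rewrite gt_eqF //; apply: push_den => //; case: (gU z).
have cn : (fun x => om (g x) v - t x * m (g x) * (v \in s)%:R) @ z -->
    om (g z) v - t z * m (g z) * (v \in s)%:R.
  by apply: cvgB; [exact: co|apply: cvgM; [exact: ctm|exact: cvg_cst]].
have cd : (fun x => 1 - n%:R * (t x * m (g x))) @ z --> 1 - n%:R * (t z * m (g z)).
  by apply: cvgB; [exact: cvg_cst|apply: cvgM; [exact: cvg_cst|exact: ctm]].
exact: (cvgM cn (cvgV den cd)).
Qed.

(** Where [m] is positive, [push] is a quotient of continuous functions; where [m] vanishes, single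
    weights may jump, and [cont_perturb] with [push_dist] takes over. *)
Lemma push_hadmissible : @hadmissible R W H U.
Proof.
move=> k g t cg ct gU t01.
have cm : continuous (fun x => m (g x)).
  by move=> x; exact: (continuous_comp (cg x) (@minw_om_cont _ sF (g x))).
have small x : m (g x) = 0 -> \forall y \near x, n%:R * m (g y) <= 2^-1.
  move=> mx; have c := cvg_mul_cst (c := n%:R) (cm x).
  have : n%:R * m (g x) < 2^-1 by rewrite mx mulr0 invr_gt0.
  by move=> /(cvgr_lt _ c); apply: filterS => y /ltW.
have minw_dist r y : n%:R * m (g y) <= 2^-1 ->
    `|minw r (push (g y) (t y)) - minw r (om (g y))| <= 2 * n%:R * m (g y).
  move=> ny; apply: minw_lip => [|u]; first by rewrite !mulr_ge0.
  exact: push_dist.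
have cminw r : r \in F -> continuous (fun x => minw r (push (g x) (t x))).
  move=> rF x; have := m_ge0 (g x); rewrite le_eqVlt => /orP[/eqP/esym mx|mx]; last first.
    apply: (@minw_cont _ _ _ r (fun x => push (g x) (t x))) => v.
    exact: push_cont_at.
  apply: (@cont_perturb _ _ _ (fun x => minw r (om (g x))) (fun x => m (g x)) (2 * n%:R)) => //.
  - exact: (continuous_comp (cg x) (@minw_om_cont _ rF (g x))).
  - exact: cm.
  - by rewrite push_id.
  - by apply: filterS (small _ mx) => y; exact: minw_dist.
apply: cont_crit => [r rF|r v rF].
  under eq_fun do rewrite (om_H (gU _) (t01 _) rF).1.
  exact: cminw.
under eq_fun do rewrite (om_H (gU _) (t01 _) rF).2.
move=> x; have := m_ge0 (g x); rewrite le_eqVlt => /orP[/eqP/esym mx|mx]; last first.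
  exact: (cvgM (cminw _ rF x) (push_cont_at (v := v) cg ct gU t01 mx)).
apply: (@cont_perturb _ _ _ (fun x => minw r (om (g x)) * om (g x) v)
  (fun x => m (g x)) (2 * (2 * n%:R))) => //.
- exact: (continuous_comp (cg x) (@minwM_om_cont _ v rF (g x))).
- exact: cm.
- by rewrite push_id.
apply: filterS (small _ mx) => y ny.
have d1 := minw_dist r y ny; have d2 := push_dist v (t01 y) ny.
have b1 := push_bounds v (gU y) (t01 y).
have b2 : 0 <= minw r (om (g y)) <= 1.
  by rewrite minw_le1 andbT; apply: minw_ge => // u _; exact: om_ge0.
move: d1 d2 b1 b2; set a := minw r (push _ _); set b := minw r _; set c := push _ _ _.
set d := om _ _; set e := 2 * n%:R * m (g y) => d1 d2 /andP[c0 c1] /andP[b0 b1'].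
(* Both factors are in [[0, 1]], so each term is at most [e]; this is the origin of the extra factor
   2 in the constant. *)
rewrite (_ : a * c - b * d = (a - b) * c + b * (c - d)); last by ring.
rewrite (_ : 2 * (2 * n%:R) * m (g y) = e + e); last by rewrite /e; ring.
apply: le_trans (ler_normD _ _) _; rewrite (normrM (a - b)) (normrM b) (ger0_norm c0) (ger0_norm b0).
apply: lerD; first by apply: le_trans d1; rewrite ler_piMr.
by apply: le_trans d2; rewrite ler_piMl.
Qed.

Lemma eul_attach_open e : eul R (cells_upto T) e -> eul R U e.
Proof.
apply: euler_equiv; apply: (homotopy_hrank (H := H)) => //.
- move=> p Tp; split; first exact: upto_sub.
  by rewrite minw_upto // invr_gt0.
- exact: push_hadmissible.
- move=> p t Up t01; have [TH|[t1 ch oH]] := H_cases Up t01.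
    by split; [exact: upto_sub|rewrite minw_upto // invr_gt0].
  split; first by right; exists s; rewrite ?mem_head // oH.
  rewrite /m oH; apply/minw_ltP; first by rewrite invf_le1.
  (* On vertices of [s] the renormalized subtraction is an increasing affine map fixing the value
     [1/n], so a weight below [1/n] stays below it. *)
  have [Ap /(minw_ltP _ _ _)[|v vs pv]] := Up; first by rewrite invf_le1.
  exists v => //; have den := push_den Up.2 t01.
  rewrite /push vs mulr1 ltr_pdivrMr // mulrBr mulr1 (mulKf (lt0r_neq0 nR_gt0)).
  by rewrite ltrD2r.
- by move=> p t Tp t01; rewrite H_id // minw_upto.
- move=> p Up; rewrite -[RHS]kap_om; congr kap; apply/funext => v.
  by rewrite /push !mul0r mulr0 !subr0 divr1.
- move=> p Up; have t1 : 0 <= (1 : R) <= 1 by rewrite ler01 lexx.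
  by have [//|[]] := H_cases Up t1; rewrite eqxx.
Qed.

(** Mayer-Vietoris for [U], which deforms to the older cells, and the contractible open cell [B]:
    the punctured cell in which they meet is subtracted. *)
Lemma eul_attach e : eul R (cells_upto T) e -> eul R A (e + (-1) ^+ n).
Proof.
move=> /eul_attach_open eU.
pose B := [set p | A p /\ - m p < 0].
have BE : B = (fun p => cellw s (om p)).
  apply/seteqP; split=> p.
    by move=> [Ap]; rewrite oppr_lt0; case: (attach_cases Ap) => [[_ ->]|[//]]; rewrite ltxx.
  move=> cp; split; first by right; exists s; rewrite ?mem_head.
  by rewrite oppr_lt0; exact: cellw_minw_gt0.
have eB : eul R B 0.
  have [v vs] := cell_neq0 sF.
  have := eul_small_on sF vs (_ : v \notin [::]); rewrite BE; move=> /(_ isT).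
  congr eul; apply/seteqP; split=> p; first by case.
  by split.
have eUB : eul R (U `&` B) ((-1) ^+ n.-1).
  have := eul_punctured_cell sF; congr eul; apply/seteqP; split=> p.
    move=> [cp mp]; split; last by rewrite BE.
    by split => //; right; exists s; rewrite ?mem_head.
  by rewrite BE => -[[_ mp] cp].
have AE : A = U `|` B.
  apply/seteqP; split=> p; last by case=> [[]|[]].
  move=> Ap; case: (attach_cases Ap) => [[_ m0]|[_ m0]].
    by left; split => //; rewrite m0 invr_gt0.
  by right; split => //; rewrite oppr_lt0.
have cm k (g : continuousType (simplex R k) W) : continuous (fun x => m (g x)).
  move=> x; exact: (continuous_comp (@cts_fun _ _ g x) (@minw_om_cont _ sF (g x))).
have := eul_union (U := U) (V := B) _ _ eU eB eUB; rewrite -AE.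
rewrite (_ : e + 0 - (-1) ^+ n.-1 = e + (-1) ^+ n); last first.
  by rewrite addr0 -[in RHS](prednK n_gt0) exprS mulN1r.
apply; first by apply: (@rel_open_lt A m) => k g _; exact: cm.
apply: (@rel_open_lt A (fun p => - m p)) => k g _ x.
exact: (cvgN (cm k g x)).
Qed.

End Attach.

Hypothesis F_uniq : uniq F.

Lemma eul_upto0 : eul R (cells_upto [::]) 0.
Proof.
have := @eul_point R W pt; congr eul; apply/seteqP; split=> p /=.
  by move=> ->; left.
by case=> [p0|[s //]]; apply: om_inj; rewrite p0.
Qed.

Lemma eul_cells : eul R (@setT W) (\sum_(s <- F) (-1) ^+ #|`s|).
Proof.
(* Decreasing cardinality: induction on the list builds from its tail, so faces are attached before
   the cells they bound. *)
pose le r s := (#|`s| <= #|`r|)%N.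
have le_tr : transitive le by move=> y x z xy yz; exact: leq_trans yz xy.
pose G := sort le F.
have memG : G =i F by move=> r; rewrite mem_sort.
have srt : sorted le G by apply: sort_sorted => x y; exact: leq_total.
have -> : \sum_(s <- F) (-1) ^+ #|`s| = \sum_(s <- G) (-1) ^+ #|`s| :> int.
  by apply: perm_big; rewrite perm_sym perm_sort.
have -> : @setT W = cells_upto G.
  apply/seteqP; split=> // p _; case: (om_cell p) => [p0|[s sF cs]]; first by left.
  by right; exists s; rewrite ?memG.
have : exists pre, G = pre ++ G by exists [::].
elim: {2 3 4}G => [|s T IH] [pre GE]; first by rewrite big_nil; exact: eul_upto0.
have sF : s \in F by rewrite -memG GE mem_cat mem_head orbT.
have uG : uniq G by rewrite sort_uniq.
have {}IH : eul R (cells_upto T) (\sum_(j <- T) (-1) ^+ #|`j|).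
  by apply: IH; exists (rcons pre s); rewrite cat_rcons.
have := srt; rewrite (sorted_pairwise le_tr) GE pairwise_cat pairwise_cons.
move=> /and3P[/allrelP h1 _ /andP[/allP h2 _]].
rewrite big_cons addrC; apply: (eul_attach sF _ _ IH).
- move=> r rT; apply/negP => sr; have /eqP rE : s == r by rewrite eqEfcard sr; exact: h2.
  by move: uG; rewrite GE cat_uniq /= rE rT !andbF.
- move=> r rF rs rns.
  have : r \in G by rewrite memG.
  rewrite GE mem_cat inE (negbTE rns) /= => /orP[rpre|//].
  have := h1 r s rpre (mem_head _ _); rewrite /le leqNgt fproper_ltn_card //.
  by rewrite fproperEneq rns.
Qed.

End Cells.

(** The shift of degrees by one reverses the sign. Degree 0 contributes nothing, since the
    augmentation is onto as soon as there is a point [p]. *)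
Lemma reduced_euler_char_eul (R : realType) (W : topologicalType) (p : W) (e : int) :
  eul R (@setT W) e -> reduced_euler_char R W (- e).
Proof.
move=> [b [N [rb b0 ->]]].
have sT := subcomplex_chs R (@setT W).
have b00 : b 0%N = 0%N.
  apply: (rank_unique (subgrp_bnd 0 sT) (rb 0%N)); apply: quotient_rank0.
  move=> z _; exists (ucst R p 1 *~ z); first by case.
  by rewrite raddfMz chd_ucst mulr1z; exact: intz.
exists (fun k => b k.+1), N; split.
- move=> k; have := rb k.+1; rewrite /reduced_betti /hrank.
  congr quotient_rank; apply/seteqP; split=> x.
  + by case: k x => [|k] x [].
  + by case: k x => [|k] x.
  + by move=> [c _ <-]; exists c.
  + by move=> [c _ <-]; exists c.
- by move=> k Nk; apply: b0; exact: leqW.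
rewrite -(euler_widen (leqnSn N) b0) big_ord_recl b00 mulr0 add0r -sumrN.
apply: eq_bigr => i _; rewrite /bump /= exprS mulN1r.
by rewrite mulNr opprK.
Qed.

(** * Causal chains *)

Section Chains.
Variables (R : realType) (X : metricType R).
Implicit Types (x y : X) (c : seq X) (t l : R) (p : spacetime X) (ch : seq (spacetime X)).

Lemma causal_leE p q : (p <= q)%O = (mdist p.1 q.1 <= q.2 - p.2).
Proof. by []. Qed.

Lemma path_length_cons x y c :
  path_length [:: x, y & c] = mdist x y + path_length (y :: c).
Proof. by []. Qed.

Lemma path_length1 x : path_length [:: x] = 0.
Proof. by rewrite /= addr0. Qed.

Lemma path_length_ge0 c : 0 <= path_length c.
Proof.
elim: c => //= x c IH; rewrite addr_ge0 //.
by case: c {IH} => // y c; exact: mdist_ge0.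
Qed.

Lemma path_length_behead x c : path_length c <= path_length (x :: c).
Proof. by case: c => [|y c]; rewrite ?path_length1 // path_length_cons lerDr mdist_ge0. Qed.

Lemma path_length_dist x c : mdist x (last x c) <= path_length (x :: c).
Proof.
elim: c x => [|y c IH] x; first by rewrite /= mdistxx addr0.
rewrite path_length_cons /=; apply: le_trans (metric_triangle _ y _) _.
by rewrite lerD2l.
Qed.

Lemma path_length_drop x y c :
  path_length (x :: c) <= path_length [:: x, y & c].
Proof.
case: c => [|z c]; first by rewrite path_length1 path_length_ge0.
by rewrite !path_length_cons [leRHS]addrA lerD2r metric_triangle.
Qed.

Lemma path_length_subseq_cons x c c' : subseq c' c ->
  path_length (x :: c') <= path_length (x :: c).
Proof.
elim: c c' x => [|y c IH] c' x; first by rewrite subseq0 => /eqP ->.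
case: c' => [_|z c']; first by rewrite path_length1 path_length_ge0.
rewrite [subseq _ _]/=; case: eqP => [-> /IH H|_ /IH H].
  by rewrite !path_length_cons lerD2l.
by apply: le_trans (H x) _; exact: path_length_drop.
Qed.

Lemma path_length_subseq c c' : subseq c' c -> path_length c' <= path_length c.
Proof.
elim: c c' => [|y c IH] c'; first by rewrite subseq0 => /eqP ->.
case: c' => [_|z c']; first exact: path_length_ge0.
rewrite [subseq _ _]/=; case: eqP => [->|_ /IH H]; first exact: path_length_subseq_cons.
exact: le_trans H (path_length_behead _ _).
Qed.

Definition proper_path x c := path (fun u v : X => u != v) x c.

(* The causal chain through [x :: c] leaving [x] at time [t] at unit speed. *)
Fixpoint stamp t x c : seq (spacetime X) :=
  (x, t) :: (if c is y :: c' then stamp (t + mdist x y) y c' else [::]).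

Lemma stamp_fst t x c : [seq p.1 | p <- stamp t x c] = x :: c.
Proof. by elim: c t x => //= y c IH t x; rewrite IH. Qed.

Lemma stamp_head t x c : exists ch, stamp t x c = (x, t) :: ch.
Proof. by case: c => [|y c]; eexists. Qed.

Lemma stamp_sorted t x c : proper_path x c -> sorted <%O (stamp t x c).
Proof.
elim: c t x => // y c IH t x /= /andP[xy pc].
have := IH (t + mdist x y) y pc; have [ch ->] := stamp_head (t + mdist x y) y c.
rewrite /= => ->; rewrite andbT lt_neqAle causal_leE /=.
rewrite [_ + _ - _]addrAC subrr add0r lexx andbT.
by apply: contra xy => /eqP[->].
Qed.

Lemma stamp_mem t x c p : p \in stamp t x c ->
  [/\ t <= p.2 <= t + path_length (x :: c), mdist x p.1 <= p.2 - t &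
      mdist p.1 (last x c) <= t + path_length (x :: c) - p.2].
Proof.
elim: c t x => [|y c IH] t x.
  by rewrite inE => /eqP -> /=; rewrite !mdistxx !addr0 subrr !lexx.
rewrite [stamp _ _ _]/= inE => /orP[/eqP ->|/IH] /=.
  rewrite mdistxx subrr !lexx lerDl /= addrAC subrr add0r; split => //.
    by rewrite addr_ge0 ?mdist_ge0 // (path_length_ge0 (y :: c)).
  exact: (path_length_dist x (y :: c)).
rewrite -/(path_length (y :: c)) !addrA => -[/andP[h1 h2] h3 h4]; split => //.
  by rewrite h2 andbT; apply: le_trans h1; rewrite lerDl mdist_ge0.
apply: le_trans (metric_triangle _ y _) _.
by apply: le_trans (lerD (lexx _) h3) _; lra.
Qed.

Lemma chain_length x t ch : path <=%O ((x, t) : spacetime X) ch ->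
  path_length (x :: [seq p.1 | p <- ch]) <= (last ((x, t) : spacetime X) ch).2 - t.
Proof.
elim: ch x t => [|[y u] ch IH] x t /=; first by rewrite addr0 subrr.
rewrite causal_leE /= => /andP[xy /IH]; rewrite -/(path_length (y :: _)).
by move: (path_length _) (last _ _).2 (mdist x y) xy => a b d; rewrite -/(path_length _); lra.
Qed.

(** Equality in [chain_length] forces it at each step: the chain moves at unit speed, and strictness
    of the order excludes steps without motion. *)
Lemma chain_stamp x t ch : path <%O ((x, t) : spacetime X) ch ->
  (last ((x, t) : spacetime X) ch).2 - t <= path_length (x :: [seq p.1 | p <- ch]) ->
  (x, t) :: ch = stamp t x [seq p.1 | p <- ch] /\ proper_path x [seq p.1 | p <- ch].
Proof.
elim: ch x t => [|[y u] ch IH] x t //.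
rewrite [path _ _ _]/= => /andP[ltxy pch] le.
have lech : path <=%O ((y, u) : spacetime X) ch.
  by apply: sub_path pch => ? ?; exact: ltW.
have b1 := chain_length lech.
have xy : mdist x y <= u - t by have := ltW ltxy; rewrite causal_leE.
move: le; rewrite [last _ _]/= [map _ _]/= path_length_cons => le.
have uE : u = t + mdist x y.
  apply/eqP; rewrite eq_le; apply/andP; split; last by lra.
  by move: b1 le; set a := path_length _; set b := (last _ _).2; lra.
have [|e1 e2] := IH y u pch.
  by move: b1 le; set a := path_length _; set b := (last _ _).2; lra.
split; first by rewrite /= -uE -e1.
rewrite /proper_path /= -/(proper_path _ _) e2 andbT.
apply: contraTneq ltxy => xyE; move: uE; rewrite xyE mdistxx addr0 => ->.
by rewrite ltxx.
Qed.

End Chains.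

Section CauCells.
Variables (R : realType) (X : metricType R) (l : R) (a b : X).
Implicit Types (s : {fset spacetime X}) (ch : seq (spacetime X)).
Local Open Scope fset_scope.

Lemma fset_seq_eq ch ch' : sorted <%O ch -> sorted <%O ch' ->
  [fset p in ch] = [fset p in ch'] -> ch = ch'.
Proof.
move=> sc sc' e; apply: lt_sorted_eq => // p.
by have /fsetP/(_ p) := e; rewrite !inE.
Qed.

Lemma fset_chain_filter s ch : s `<=` [fset p in ch] ->
  s = [fset p in [seq p <- ch | p \in s]].
Proof.
move=> /fsubsetP sub; apply/fsetP => p; rewrite !inE mem_filter.
by apply/idP/andP => [ps|[]//]; split => //; have := sub p ps; rewrite !inE.
Qed.

Lemma fset_filter_neq0 s ch : s `<=` [fset p in ch] -> s != fset0 ->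
  [seq p <- ch | p \in s] != [::].
Proof.
move=> sub; apply: contra => /eqP e; rewrite (fset_chain_filter sub) e.
by apply/eqP/fsetP => p; rewrite !inE.
Qed.

Lemma sorted_filter_causal s ch : sorted <%O ch ->
  sorted <%O [seq p <- ch | p \in s].
Proof. by apply: sorted_filter => y x z; exact: lt_trans. Qed.

Lemma Cau_complex_down s s' : Cau_complex l a b s -> s' `<=` s -> s' != fset0 ->
  Cau_complex l a b s'.
Proof.
move=> [ch [c0 cs cC] <-] sub s0; exists [seq p <- ch | p \in s'].
  split; [exact: fset_filter_neq0|exact: sorted_filter_causal|].
  by move=> p; rewrite mem_filter => /andP[_ /cC].
by rewrite -fset_chain_filter.
Qed.

Lemma Cau_subcomplex_down s s' : Cau_subcomplex l a b s -> s' `<=` s ->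
  s' != fset0 -> Cau_subcomplex l a b s'.
Proof.
move=> [ch [[c0 cs cC] cl] <-] sub s0; exists [seq p <- ch | p \in s'].
  split; last first.
    apply: le_lt_trans cl; apply: path_length_subseq; apply: map_subseq.
    exact: filter_subseq.
  split; [exact: fset_filter_neq0|exact: sorted_filter_causal|].
  by move=> p; rewrite mem_filter => /andP[_ /cC].
by rewrite -fset_chain_filter.
Qed.

(** A chain outside the subcomplex has length at least [l], yet only the time interval [[0, l]] to
    cover it. So it starts at time 0, hence at [a], and ends at time [l], hence at [b]. *)
Lemma Cau_cellP s : Cau_complex l a b s /\ ~ Cau_subcomplex l a b s <->
  exists x c, [/\ x = a, last x c = b, proper_path x c, path_length (x :: c) = l &
    s = [fset p in stamp 0 x c]].
Proof.
split.
  move=> [[ch [c0 cs cC] <-] nsub].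
  have lel : l <= path_length [seq p.1 | p <- ch].
    by rewrite leNgt; apply/negP => ?; apply: nsub; exists ch.
  case: ch c0 cs cC {nsub} lel => // -[x t] ch _ cs cC lel.
  have [/= /andP[t0 tl] ax _] := cC _ (mem_head _ _).
  have [/= /andP[u0 ul] _ xb] := cC _ (mem_last _ _).
  have lech : path <=%O ((x, t) : spacetime X) ch by apply: sub_path cs => ? ?; exact: ltW.
  have b1 := chain_length lech.
  have {}lel : l <= path_length (x :: [seq p.1 | p <- ch]) := lel.
  move: b1 lel ul t0 xb => b1 lel ul t0 xb.
  have tE : t = 0.
    by move: b1 lel ul t0; set A := path_length _; set B := (last _ _).2; lra.
  have uE : (last ((x, t) : spacetime X) ch).2 = l.
    by move: b1 lel ul t0; set A := path_length _; set B := (last _ _).2; lra.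
  have lE : path_length (x :: [seq p.1 | p <- ch]) = l.
    by apply/eqP; rewrite eq_le lel andbT (le_trans b1) // uE tE subr0.
  have [|e pr] := chain_stamp (x := x) (t := t) cs; first by rewrite lE uE tE subr0.
  exists x, [seq p.1 | p <- ch]; split => //; last by rewrite e tE.
    by apply/esym/mdist_positivity/eqP; rewrite eq_le mdist_ge0 andbT -tE.
  have <- : (last ((x, t) : spacetime X) ch).1 = b.
    by apply/mdist_positivity/eqP; rewrite eq_le mdist_ge0 andbT (le_trans xb) // uE subrr.
  exact: (last_map fst ch (x, t)).
move=> [x [c [xa lb pr cl ->]]]; split.
  exists (stamp 0 x c) => //; split; [by case: (c)|exact: stamp_sorted|].
  move=> p /stamp_mem; rewrite !add0r subr0 cl lb xa => -[h1 h2 h3].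
  by split.
(* A sorted chain is determined by its set of vertices, so a shorter representative cannot exist. *)
move=> [ch [[c0 cs cC] chl]] /(fset_seq_eq cs (stamp_sorted 0 pr)) chE.
by move: chl; rewrite chE /mkset [map _ _](stamp_fst 0 x c) cl ltxx.
Qed.

End CauCells.

(** * The topology of the magnitude homotopy type *)

Lemma near_all (T : Type) (G : set_system T) {FG : Filter G} (I : eqType) (L : seq I)
    (Q : I -> T -> Prop) : (forall i, i \in L -> \forall x \near G, Q i x) ->
  \forall x \near G, forall i, i \in L -> Q i x.
Proof.
elim: L => [|i L IH] H; first by apply: filterE => x i; rewrite in_nil.
have Qi := H i (mem_head _ _).
have /IH QL j : j \in L -> \forall x \near G, Q j x by move=> jL; apply: H; rewrite inE jL orbT.
by apply: filterS2 Qi QL => x Qi QL j; rewrite inE => /orP[/eqP->|/QL].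
Qed.

Section Geometry.
Variables (R : realType) (X : finMetricType R) (l : R).
(** Vertices carry the pair of end points, which keeps the cells of different wedge summands
    disjoint. *)
Let V : choiceType := ((X * X) * spacetime X)%type.
Let W := magnitude_homotopy_type X l.
Let S : X * X -> Type := fun ab => realization R (Cau_complex l ab.1 ab.2).
Let Sub ab : set (S ab) := [set w | Cau_subcomplex l ab.1 ab.2 (carrier w)].

Definition mlift (ab : X * X) : magnitude_pair l ab.1 ab.2 -> W :=
  @wedge_lift _ _ (fun ab : X * X => None : magnitude_pair l ab.1 ab.2) ab.

Lemma mlift_None ab ab' : mlift (None : magnitude_pair l ab.1 ab.2) =
  mlift (None : magnitude_pair l ab'.1 ab'.2).
Proof.
exact: (@wedge_liftE _ (fun ab : X * X => magnitude_pair l ab.1 ab.2)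
  (fun ab : X * X => None : magnitude_pair l ab.1 ab.2) _ None _ None).
Qed.

Definition pair_weight ab (q : magnitude_pair l ab.1 ab.2) (v : V) : R :=
  if v.1 == ab then (if q is Some w then val (val w) v.2 else 0) else 0.

Let wb := fun ab : X * X => None : magnitude_pair l ab.1 ab.2.

(* All weights vanish at the base point. *)
Definition mw (p : W) : V -> R :=
  let z := repr (p : wedge wb) in pair_weight (projT2 z).

Lemma pair_weight_None ab v : pair_weight (None : magnitude_pair l ab.1 ab.2) v = 0.
Proof. by rewrite /pair_weight; case: ifP. Qed.

Lemma mw_lift ab (q : magnitude_pair l ab.1 ab.2) : mw (mlift q) = pair_weight q.
Proof.
rewrite /mw /mlift /wedge_lift /=.
have : repr (\pi_(wedge wb)%qT (existT _ ab q))
  = existT _ ab q %[mod wedge wb]%qT.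
  by rewrite reprK.
(* The chosen representative can differ from the given point only if both are base points, where all
   weights vanish. *)
move=> /eqmodP /predU1P[-> //|/andP[/eqP e /eqP /= e']].
rewrite e e'; apply/funext => v; by rewrite !pair_weight_None.
Qed.

Lemma mlift_surj p : exists ab (q : magnitude_pair l ab.1 ab.2), p = mlift q.
Proof.
exists (projT1 (repr (p : wedge wb))), (projT2 (repr (p : wedge wb))).
by rewrite /mlift /wedge_lift /= surjective_existT reprK.
Qed.

Definition mpi ab (w : S ab) : W := mlift (collapse_pi (@Sub ab) w).

Definition emb ab (u : spacetime X -> R) (v : V) : R := if v.1 == ab then u v.2 else 0.

Lemma mw_mpi_sub ab (w : S ab) : Cau_subcomplex l ab.1 ab.2 (carrier w) ->
  mpi w = mlift (None : magnitude_pair l ab.1 ab.2) /\ mw (mpi w) = fun=> 0.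
Proof.
move=> sw; have -> : mpi w = mlift (None : magnitude_pair l ab.1 ab.2).
  rewrite /mpi /collapse_pi insubF //; apply/negbTE/negP => /set_mem; exact.
split=> //; rewrite mw_lift; apply/funext => v; exact: pair_weight_None.
Qed.

Lemma mw_mpi ab (w : S ab) : ~ Cau_subcomplex l ab.1 ab.2 (carrier w) ->
  mw (mpi w) = emb ab (val w).
Proof.
move=> sw; rewrite mw_lift /collapse_pi.
have wS : w \in ~` (@Sub ab) by apply/mem_set.
by rewrite insubT.
Qed.

Lemma mpi_surj p : (exists ab, p = mlift (None : magnitude_pair l ab.1 ab.2)) \/
  exists ab (w : S ab), ~ Cau_subcomplex l ab.1 ab.2 (carrier w) /\ p = mpi w.
Proof.
have [ab [[w|] ->]] := mlift_surj p; last by left; exists ab.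
right; exists ab, (val w); have wS : (val w) \in ~` (@Sub ab) := valP w.
split; first by move: wS => /set_mem.
rewrite /mpi /collapse_pi insubT; congr mlift; congr Some.
exact: val_inj.
Qed.

Lemma real_ge0 ab (w : S ab) v : 0 <= val w v.
Proof. by have /set_mem[_ w0 _] := valP w. Qed.

Lemma real_K ab (w : S ab) : Cau_complex l ab.1 ab.2 (carrier w).
Proof. by have /set_mem[] := valP w. Qed.

Lemma real_sum ab (w : S ab) s : (carrier w `<=` s)%fset ->
  \sum_(v <- s) val w v = 1.
Proof.
move=> ws; have /set_mem[_ _ <-] := valP w.
by apply/esym/big_fset_incl => // v _; rewrite mem_finsupp negbK => /eqP.
Qed.

Lemma real_le1 ab (w : S ab) v : val w v <= 1.
Proof.
have [vw|vw] := boolP (v \in carrier w).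
  rewrite -(real_sum (fsubset_refl (carrier w))) (big_fsetD1 v) //= lerDl.
  by apply: sumr_ge0 => u _; exact: real_ge0.
by rewrite (fsfun_dflt vw).
Qed.

Lemma real_make ab s (u : spacetime X -> R) : Cau_complex l ab.1 ab.2 s ->
  (forall v, v \in s -> 0 <= u v) -> (forall v, v \notin s -> u v = 0) ->
  \sum_(v <- s) u v = 1 ->
  exists w : S ab, (forall v, val w v = u v) /\ (carrier w `<=` s)%fset.
Proof.
move=> Ks u0 uz u1; pose f : {fsfun spacetime X -> R with 0} := [fsfun v in s => u v].
have fE v : f v = u v by rewrite fsfunE; case: ifPn => // /uz.
have sub : (finsupp f `<=` s)%fset.
  by apply/fsubsetP => v; rewrite mem_finsupp fE; apply: contraNT => /uz ->.
have f1 : \sum_(v <- finsupp f) f v = 1.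
  rewrite -u1; under [RHS]eq_bigr do rewrite -fE.
  by apply/big_fset_incl => // v _; rewrite mem_finsupp negbK => /eqP.
have fb : f \in @barycentric R _ (Cau_complex l ab.1 ab.2).
  apply/mem_set; split => //.
    apply: (Cau_complex_down Ks sub); apply: contra_eq_neq f1 => ->.
    by rewrite big_seq_fset0 eq_sym oner_neq0.
  by move=> v; rewrite fE; have [/u0//|/uz ->] := boolP (v \in s).
by exists (exist _ f fb : S ab).
Qed.

Lemma emb_ab ab u v : emb ab u (ab, v) = u v.
Proof. by rewrite /emb eqxx. Qed.

Definition ecell ab (s : {fset spacetime X}) : {fset V} := [fset (ab, v) | v in s]%fset.

Lemma in_ecell ab s v : (v \in ecell ab s) = (v.1 == ab) && (v.2 \in s).
Proof.
apply/imfsetP/andP => [[x xs ->]|[/eqP <- vs]]; first by rewrite eqxx.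
by exists v.2 => //; case: v vs.
Qed.

Lemma sum_ecell ab s (u : V -> R) : \sum_(v <- ecell ab s) u v = \sum_(v <- s) u (ab, v).
Proof. by rewrite big_imfset //= => x y _ _ []. Qed.

Lemma card_ecell ab s : #|` ecell ab s| = #|` s|.
Proof. by rewrite card_imfset //= => x y []. Qed.

Lemma cellw_real ab (w : S ab) : cellw (ecell ab (carrier w)) (emb ab (val w)).
Proof.
split=> [v|v|].
- rewrite in_ecell /emb => /andP[-> vw]; rewrite lt_def real_ge0 andbT.
  by rewrite -mem_finsupp.
- rewrite in_ecell negb_and /emb; case: eqP => //= _ vw.
  by rewrite (fsfun_dflt vw).
- rewrite sum_ecell; under eq_bigr do rewrite emb_ab.
  exact: real_sum.
Qed.

Definition cell_pred (s : {fset V}) := exists ab (t : {fset spacetime X}),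
  [/\ Cau_complex l ab.1 ab.2 t, ~ Cau_subcomplex l ab.1 ab.2 t & s = ecell ab t].

Variable F : seq {fset V}.
Hypothesis FP : forall s, s \in F <-> cell_pred s.
Variable x0 : X.
Definition mpt : W := mlift (None : magnitude_pair l (x0, x0).1 (x0, x0).2).

Lemma Cau_complex_neq0 a b (t : {fset spacetime X}) : Cau_complex l a b t ->
  exists v, v \in t.
Proof.
move=> [[|v ch] [c0 _ _] <-] //; exists v; by rewrite !inE eqxx.
Qed.

Lemma mcell_neq0 s : s \in F -> exists v, v \in s.
Proof.
move=> /FP[ab [t [/Cau_complex_neq0[v vt] _ ->]]].
by exists (ab, v); rewrite in_ecell eqxx.
Qed.

Lemma mcell_between r s' s : r \in F -> s \in F ->
  (r `<=` s')%fset -> (s' `<=` s)%fset -> s' \in F.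
Proof.
move=> /FP[ab [t [Kt nt rE]]] /FP[ab' [u [Ku nu sE]]] /fsubsetP rs' /fsubsetP s's.
have [v vt] := Cau_complex_neq0 Kt.
have vr : (ab, v) \in r by rewrite rE in_ecell eqxx.
have abE : ab = ab'.
  by have := s's _ (rs' _ vr); rewrite sE in_ecell => /andP[/eqP].
subst ab'; apply/FP; pose t' := [fset v.2 | v in s']%fset.
have s'E : s' = ecell ab t'.
  apply/fsetP => -[x y]; rewrite in_ecell /=; apply/idP/andP.
    move=> xs; split; last by apply/imfsetP; exists (x, y).
    by have := s's _ xs; rewrite sE in_ecell => /andP[].
  move=> [/eqP -> /imfsetP[[x' y'] /= zs yE]].
  have := s's _ zs; rewrite sE in_ecell => /andP[/eqP /= x'E _].
  by rewrite yE -x'E.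
have tt' : (t `<=` t')%fset.
  apply/fsubsetP => y yt; have := rs' (ab, y).
  by rewrite rE s'E !in_ecell !eqxx; exact.
have t'u : (t' `<=` u)%fset.
  apply/fsubsetP => y yt; have := s's (ab, y).
  by rewrite sE s'E !in_ecell !eqxx; exact.
exists ab, t'; split => //.
- apply: (Cau_complex_down Ku t'u); apply/fset0Pn; exists v.
  exact: (fsubsetP tt').
- move=> Kt'; apply: nt; apply: (Cau_subcomplex_down Kt' tt').
  by apply/fset0Pn; exists v.
Qed.

Lemma mw_pt : mw mpt = fun=> 0.
Proof. by rewrite mw_lift; apply/funext => v; exact: pair_weight_None. Qed.

Lemma mw_cell p : mw p = (fun=> 0) \/ exists2 s, s \in F & cellw s (mw p).
Proof.
have [[ab ->]|[ab [w [nw ->]]]] := mpi_surj p.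
  by left; rewrite mw_lift; apply/funext => v; exact: pair_weight_None.
right; exists (ecell ab (carrier w)); last by rewrite mw_mpi //; exact: cellw_real.
by apply/FP; exists ab, (carrier w); split => //; exact: real_K.
Qed.

Lemma mw_inj : injective mw.
Proof.
have nz ab (w : S ab) ab' : ~ Cau_subcomplex l ab.1 ab.2 (carrier w) ->
    mw (mpi w) = mw (mlift (None : magnitude_pair l ab'.1 ab'.2)) -> False.
  move=> nw; rewrite mw_mpi // mw_lift => e.
  have [v vw] := Cau_complex_neq0 (real_K w).
  have [/(_ (ab, v)) + _ _] := cellw_real w.
  by rewrite e pair_weight_None ltxx in_ecell eqxx vw => /(_ isT).
move=> p p'; have [[ab ->]|[ab [w [nw ->]]]] := mpi_surj p;
  have [[ab' ->]|[ab' [w' [nw' ->]]]] := mpi_surj p'.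
- by move=> _; exact: mlift_None.
- by move=> /esym/nz; case.
- by move=> /nz; case.
rewrite !mw_mpi // => e.
have [v vw] := Cau_complex_neq0 (real_K w).
have abE : ab = ab'.
  have [/(_ (ab, v)) + _ _] := cellw_real w.
  rewrite e in_ecell eqxx vw => /(_ isT); rewrite /emb /=.
  by case: eqP => // _; rewrite ltxx.
subst ab'; congr mpi; apply/val_inj/fsfunP => u.
by have := congr1 (fun f => f (ab, u)) e; rewrite !emb_ab.
Qed.

Lemma mw_surj s w : s \in F -> cellw s w -> exists p, mw p = w.
Proof.
move=> /FP[ab [t [Kt nt ->]]] [wp wz w1].
have [|||w' [w'E w't]] := @real_make ab t (fun v => w (ab, v)) Kt _ _ _.
- by move=> v vt; apply/ltW/wp; rewrite in_ecell eqxx.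
- by move=> v vt; apply: wz; rewrite in_ecell eqxx.
- by rewrite -sum_ecell.
exists (mpi w'); rewrite mw_mpi.
  apply/funext => -[x y]; rewrite /emb /=; case: eqP => [->|/eqP xab]; first exact: w'E.
  by rewrite wz // in_ecell negb_and xab.
have -> // : carrier w' = t.
apply/fsetP => v; rewrite mem_finsupp w'E; apply/idP/idP => [|vt].
  by apply: contraNT => vt; rewrite wz // in_ecell eqxx.
by rewrite gt_eqF // wp // in_ecell eqxx.
Qed.

(** The reason why these functions survive the collapse: a carrier in the subcomplex contains no
    cell [r] of [F], so the minimum over [r] is 0 already before collapsing. *)
Lemma minw_mpi ab (w : S ab) r : r \in F ->
  minw r (mw (mpi w)) = minw r (emb ab (val w)) /\
  forall v, minw r (mw (mpi w)) * mw (mpi w) v = minw r (emb ab (val w)) * emb ab (val w) v.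
Proof.
move=> rF; have [sw|nw] := pselect (Cau_subcomplex l ab.1 ab.2 (carrier w)); last first.
  by rewrite mw_mpi.
have [_ ->] := mw_mpi_sub sw.
have [z zr] := mcell_neq0 rF.
rewrite (minw_eq0 _ zr) //.
have emb0 v : 0 <= emb ab (val w) v by rewrite /emb; case: ifP => // _; exact: real_ge0.
have [v vr ev] : exists2 v, v \in r & emb ab (val w) v = 0.
  apply: contrapT => H; move/FP: rF => [ab' [t [Kt nt rE]]].
  have rw v : v \in r -> v \in ecell ab (carrier w).
    move=> vr; apply/negPn/negP => vw; apply: H; exists v => //.
    by have [_ /(_ _ vw)] := cellw_real w.
  have [y yt] := Cau_complex_neq0 Kt.
  have abE : ab' = ab.
    have := rw (ab', y); rewrite rE !in_ecell eqxx yt => /(_ isT).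
    by move=> /andP[/eqP].
  subst ab'; apply: nt; apply: (Cau_subcomplex_down sw); last by apply/fset0Pn; exists y.
  apply/fsubsetP => u ut; have := rw (ab, u).
  by rewrite rE !in_ecell !eqxx ut => /(_ isT).
by rewrite (minw_eq0 emb0 vr ev); split => // u; rewrite !mul0r.
Qed.

Lemma open_mpi (O : set W) : open O <-> forall ab, realization_open ((@mpi ab) @^-1` O).
Proof. exact: (@wedge_openP _ _ wb). Qed.

Lemma continuous_mpi (f : W -> R) :
  (forall ab (w w' : S ab) d, 0 <= d -> (forall v, `|val w v - val w' v| <= d) ->
     `|f (mpi w) - f (mpi w')| <= 2 * d) -> continuous f.
Proof.
move=> fL; apply/continuousP => A oA; apply/open_mpi => ab s Ks w Aw ws.
have /nbhs_ballP[e /= e0 eA] : nbhs (f (mpi w)) A by exact: open_nbhs_nbhs.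
(* With Lipschitz constant 2, a displacement of [e / 3] changes [f] by at most [2 e / 3 < e]. *)
exists (e / 3); first by rewrite divr_gt0.
move=> w' _ ww'; apply: eA; rewrite -ball_normE /ball_ /=.
have e3 : 0 <= e / 3 by rewrite divr_ge0 // ltW.
have := fL ab w w' (e / 3) e3 (fun v => ltW (ww' v)).
by move: e0; lra.
Qed.

Definition coord (i : {fset V} * option V) (p : W) : R :=
  if i.2 is Some v then minw i.1 (mw p) * mw p v else minw i.1 (mw p).

Lemma coord_lip i ab (w w' : S ab) d : i.1 \in F -> 0 <= d ->
  (forall v, `|val w v - val w' v| <= d) ->
  `|coord i (mpi w) - coord i (mpi w')| <= 2 * d.
Proof.
case: i => r o /= rF d0 ww'.
have e0 (x : S ab) v : 0 <= emb ab (val x) v <= 1.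
  by rewrite /emb; case: ifP => _; rewrite ?real_ge0 ?real_le1 ?lexx ?ler01.
have ee v : `|emb ab (val w) v - emb ab (val w') v| <= d.
  by rewrite /emb; case: ifP => _; rewrite ?ww' // subrr normr0.
have mm := minw_lip (r : seq V) d0 ee.
have m01 (x : S ab) : 0 <= minw r (emb ab (val x)) <= 1.
  by rewrite minw_le1 andbT; apply: minw_ge => // u _; case/andP: (e0 x u).
rewrite /coord /=; case: o => [v|]; last first.
  by rewrite !(minw_mpi _ rF).1; apply: (le_trans mm); move: d0; lra.
rewrite !(minw_mpi _ rF).2; move: mm (ee v) (m01 w) (m01 w') (e0 w v) (e0 w' v).
move: (minw r (emb ab (val w))) (minw r (emb ab (val w'))) (emb ab (val w) v).
move: (emb ab (val w') v) => y a b x h1 h2.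
move=> /andP[a0 a1] /andP[b0 b1] /andP[x0' x1] /andP[y0 y1].
rewrite (_ : a * x - b * y = (a - b) * x + b * (x - y)); last by ring.
apply: le_trans (ler_normD _ _) _; rewrite 2!normrM (ger0_norm x0') (ger0_norm b0).
rewrite mulr2n mulrDl !mul1r; apply: lerD.
  by apply: le_trans h1; rewrite ler_piMr.
by apply: le_trans h2; rewrite ler_piMl.
Qed.

Lemma coord_continuous i : i.1 \in F -> continuous (coord i).
Proof. by move=> rF; apply: continuous_mpi => ab w w' d; exact: coord_lip. Qed.

(** Only vertices of cells are listed: finitely many functions, which still separate points because
    all other vertices have weight 0 everywhere. *)
Definition coords := [seq (r, o) | r <- F,
  o <- None :: [seq Some v | v <- flatten [seq enum_fset r | r <- F]]].

Lemma coordsP i : i \in coords -> i.1 \in F.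
Proof. by move=> /allpairsP[[r o] [rF _ ->]]. Qed.

(** If one of the points lies in a cell [s], the minimum over [s] is positive and common to both, so
    it cancels from the products and leaves equal weights. *)
Lemma coord_inj p p' : (forall i, i \in coords -> coord i p = coord i p') -> p = p'.
Proof.
suff main q q' s : (forall i, i \in coords -> coord i q = coord i q') -> s \in F ->
    cellw s (mw q) -> mw q = mw q'.
  move=> H; apply: mw_inj; have [p0|[s sF cs]] := mw_cell p; last exact: main cs.
  have [p0'|[s sF cs]] := mw_cell p'; first by rewrite p0.
  by apply/esym; apply: main cs => // i /H.
move=> H sF cs.
have noneP r : r \in F -> (r, None) \in coords by move=> rF; apply: allpairs_f; rewrite ?mem_head.
have someP r t v : r \in F -> t \in F -> v \in t -> (r, Some v) \in coords.
  move=> rF tF vt; apply: allpairs_f => //; rewrite inE /=; apply/map_f/flattenP.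
  by exists (enum_fset t) => //; exact: map_f.
have m0 := cellw_minw_gt0 cs.
have mE := H _ (noneP _ sF); rewrite /coord /= in mE.
have eqv t v : t \in F -> v \in t -> mw q v = mw q' v.
  move=> tF vt; have := H _ (someP s t v sF tF vt); rewrite /coord /= -mE.
  by apply: mulfI; rewrite gt_eqF.
apply/funext => v; have [vs|vs] := boolP (v \in s); first exact: (eqv s).
have [q0'|[s' s'F cs']] := mw_cell q'.
  by case: cs => _ -> //; rewrite q0'.
have [vs'|vs'] := boolP (v \in s'); first exact: (eqv s').
by case: cs => _ -> //; case: cs' => _ ->.
Qed.

Lemma coord_sep p p0 : p <> p0 -> exists2 i, i \in coords & coord i p != coord i p0.
Proof.
move=> pp0; apply: contrapT => H; apply: pp0; apply: coord_inj => i ic.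
by apply/eqP/negPn/negP => ne; apply: H; exists i.
Qed.

(* The coordinates determine the topology: each closed cell is compact, so the
   complement of [O] in it stays at a positive distance from [p0]. *)
Definition separated (O : set W) (p0 : W) (e : R) (p : W) :=
  O p \/ exists2 i, i \in coords & e <= `|coord i p - coord i p0|.

Lemma separated_cell (O : set W) p0 ab (t : {fset spacetime X}) : open O -> O p0 ->
  ecell ab t \in F -> \forall e \near 0^'+, forall w : S ab, (carrier w `<=` t)%fset ->
  separated O p0 e (mpi w).
Proof.
move=> oO Op0 tF.
have Kt : Cau_complex l ab.1 ab.2 t.
  move/FP: (tF) => [ab' [t' [Kt' _ e]]].
  have [y yt] := Cau_complex_neq0 Kt'.
  have : (ab', y) \in ecell ab t by rewrite e in_ecell eqxx.
  rewrite in_ecell /= => /andP[/eqP abE _]; subst ab'.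
  rewrite (_ : t = t') //; apply/fsetP => v.
  by have := congr1 (fun s => (ab, v) \in s) e; rewrite !in_ecell eqxx.
have [k kt] : exists k, size (enum_fset t) = k.+1.
  have [y yt] := Cau_complex_neq0 Kt; have yt' : y \in enum_fset t by [].
  by case: (enum_fset t) yt' => // a s _; exists (size s).
(* Enumerating the vertices of [t] identifies the closed cell with a standard simplex, whose
   compactness is known. *)
pose wt (x : 'rV[R]_k.+1) v : R := if v \in t then x ord0 (inord (index v (enum_fset t))) else 0.
have wt_dist x y e v : 0 < e -> `|x - y| < e -> `|wt x v - wt y v| < e.
  move=> e0 xy; rewrite /wt; case: ifP => _; last by rewrite subrr normr0.
  apply: le_lt_trans xy; rewrite [leRHS]/Num.norm /= mx_normrE.
  apply: le_trans (le_bigmax _ _ (ord0, inord (index v (enum_fset t)))).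
  by rewrite /= !mxE.
have wt_sum x : \sum_(v <- enum_fset t) wt x v = \sum_i x ord0 i.
  have [v0 _] := Cau_complex_neq0 Kt.
  rewrite (big_nth v0) big_mkord kt; apply: eq_bigr => i _.
  have it : (i < size (enum_fset t))%N by rewrite kt.
  have ut : uniq (enum_fset t) := fset_uniq t.
  rewrite /wt mem_nth // index_uniq //.
  by congr (x ord0 _); apply/val_inj; rewrite /= inordK.
have mk x : simplex_set x -> exists w : S ab,
    (forall v, val w v = wt x v) /\ (carrier w `<=` t)%fset.
  move=> [x0' x1]; apply: real_make => // [v vt|v vt|].
  - by rewrite /wt vt.
  - by rewrite /wt (negbTE vt).
  - by rewrite wt_sum.
pose P (e : R) (x : 'rV[R]_k.+1) := forall w : S ab, (forall v, val w v = wt x v) ->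
  separated O p0 e (mpi w).
have cov x : simplex_set x -> \forall x' \near x & e \near 0^'+, P e x'.
  move=> Sx; have [wx [wxE wxt]] := mk x Sx.
  have [Ox|nOx] := pselect (O (mpi wx)).
    have [e e0 eO] := (open_mpi O).1 oO ab t Kt wx Ox wxt.
    exists (ball x e, setT) => /=.
      by split; [exact: nbhsx_ballx|exact: filterT].
    move=> [y d] /= [xy _] w wE; left; apply: eO.
      apply/fsubsetP => v; rewrite mem_finsupp wE /wt; case: ifP => //.
      by rewrite eqxx.
    move=> v; rewrite wxE wE; apply: wt_dist => //.
    by rewrite -ball_normE in xy.
  have [i ic ne] : exists2 i, i \in coords & coord i (mpi wx) != coord i p0.
    by apply: coord_sep => e; apply: nOx; rewrite e.
  pose c := `|coord i (mpi wx) - coord i p0|.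
  have c0 : 0 < c by rewrite normr_gt0 subr_eq0.
  (* Moving by [c / 4] changes the coordinate by at most [c / 2], which leaves a separation of at
     least [c / 2]. *)
  exists (ball x (c / 4), [set d | d < c / 2]) => /=.
    split; first by apply: nbhsx_ballx; rewrite divr_gt0.
    by apply: nbhs_right_lt; rewrite divr_gt0.
  move=> [y d] /= [xy dc] w wE; right; exists i => //.
  have : `|coord i (mpi wx) - coord i (mpi w)| <= 2 * (c / 4).
    apply: coord_lip; [exact: coordsP|by rewrite divr_ge0 // ltW|].
    move=> v; rewrite wxE wE; apply/ltW/wt_dist; first by rewrite divr_gt0.
    by rewrite -ball_normE in xy.
  have : c <= `|coord i (mpi wx) - coord i (mpi w)| + `|coord i (mpi w) - coord i p0|.
    by rewrite /c -(subrKA (coord i (mpi w))) ler_normD.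
  by move: dc; lra.
have Hcov : \forall e \near 0^'+, @simplex_set R k `<=` P e.
  by apply: ((@compact_near_coveringP _ _).1 (@simplex_compact R k)); exact: cov.
apply: filterS Hcov => e He w wt'.
apply: (He (\row_(j < k.+1) val w (nth (ab.1, 0) (enum_fset t) j))).
  split=> [j|]; first by rewrite mxE real_ge0.
  rewrite -[RHS](real_sum wt') [RHS](big_nth (ab.1, 0)) big_mkord kt.
  by apply: eq_bigr => i _; rewrite mxE.
move=> v; rewrite /wt; case: ifPn => vt; last first.
  by rewrite (fsfun_dflt (contra (fsubsetP wt' v) vt)).
rewrite mxE inordK ?nth_index //.
by rewrite -kt index_mem.
Qed.

Lemma separated_all (O : set W) p0 : open O -> O p0 ->
  exists2 e, 0 < e & forall p, separated O p0 e p.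
Proof.
move=> oO Op0.
have cells : \forall e \near 0^'+, forall s, s \in F -> forall ab (w : S ab),
    ecell ab (carrier w) = s -> separated O p0 e (mpi w).
  apply: near_all => s sF; move/FP: (sF) => [ab [t [Kt _ sE]]]; subst s.
  apply: filterS (separated_cell oO Op0 sF) => e He ab' w wE.
  have [y yw] := Cau_complex_neq0 (real_K w).
  have : (ab', y) \in ecell ab t by rewrite -wE in_ecell eqxx.
  rewrite in_ecell /= => /andP[/eqP abE _]; subst ab'.
  apply: He; apply/fsubsetP => v vw.
  by have := congr1 (fun s => (ab, v) \in s) wE; rewrite !in_ecell eqxx vw.
have base : \forall e \near 0^'+, separated O p0 e mpt.
  have [Op|nOp] := pselect (O mpt); first by apply: nearW => e; left.
  have [i ic ne] : exists2 i, i \in coords & coord i mpt != coord i p0.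
    by apply: coord_sep => e; apply: nOp; rewrite e.
  have c0 : 0 < `|coord i mpt - coord i p0| by rewrite normr_gt0 subr_eq0.
  by apply: filterS (nbhs_right_lt c0) => e /ltW ec; right; exists i.
have pos : \forall e \near (0 : R)^'+, 0 < e by exact: nbhs_right_gt.
have [e [[e0 eb] ec]] := filter_ex (filterI (filterI pos base) cells).
exists e => // p; have [[ab ->]|[ab [w [nw ->]]]] := mpi_surj p.
  by rewrite (mlift_None ab (x0, x0)).
apply: ec erefl; apply/FP; exists ab, (carrier w); split => //; exact: real_K.
Qed.

Lemma mcont_crit k (g : simplex R k -> W) :
  (forall r, r \in F -> continuous (fun x => minw r (mw (g x)))) ->
  (forall r v, r \in F -> continuous (fun x => minw r (mw (g x)) * mw (g x) v)) ->
  continuous g.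
Proof.
move=> c1 c2 x A; rewrite nbhsE => -[O [oO Ox] OA].
have [e e0 He] := separated_all oO Ox.
have : \forall y \near x, forall i, i \in coords -> `|coord i (g y) - coord i (g x)| < e.
  apply: (@near_all _ (nbhs x) _ _ _ 
    (fun i y => `|coord i (g y) - coord i (g x)| < e)) => -[r o] /coordsP /= rF.
  have ci : {for x, continuous (fun y => coord (r, o) (g y))}.
    by case: o => [v|]; [exact: (c2 r v rF x)|exact: (c1 r rF x)].
  have /cvgrPdist_lt/(_ _ e0) := ci.
  by apply: filterS => y; rewrite distrC.
apply: filterS => y Hy; apply: OA; have [//|[i ic]] := He (g y).
by rewrite leNgt Hy.
Qed.

Lemma reduced_euler_char_cells : uniq F ->
  reduced_euler_char R W (- \sum_(s <- F) (-1) ^+ #|` s|).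
Proof.
move=> uF; apply: (@reduced_euler_char_eul R W mpt).
apply: (@eul_cells R V W F mw mpt) => //.
- exact: mcell_neq0.
- exact: mcell_between.
- exact: mw_cell.
- exact: mw_inj.
- exact: mw_pt.
- exact: mw_surj.
- by move=> r rF; exact: (@coord_continuous (r, None)).
- by move=> r v rF; exact: (@coord_continuous (r, Some v)).
- exact: mcont_crit.
Qed.

End Geometry.

(** * Proper paths *)

Section Paths.
Variables (R : realType) (X : finMetricType R).
Implicit Types (x y z : X) (c : seq X) (r : R).

(** A positive lower bound for the steps of a proper path, so that its length bounds the number of
    steps. The initial value 1 serves a space with no two distinct points. *)
Definition min_dist : R := \big[Num.min/1]_(p : X * X | p.1 != p.2) mdist p.1 p.2.

Lemma min_dist_gt0 : 0 < min_dist.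
Proof.
apply: (big_ind (fun d => 0 < d)) => // [a b a0 b0|[x y] /= xy]; first by rewrite lt_min a0.
by rewrite lt_neqAle mdist_ge0 eq_sym andbT; apply: contra xy => /eqP/mdist_positivity ->.
Qed.

Lemma min_dist_le x y : x != y -> min_dist <= mdist x y.
Proof. by move=> xy; exact: (@bigmin_le_cond _ _ _ 1 (x, y)). Qed.

Lemma proper_length x c : proper_path x c -> (size c)%:R * min_dist <= path_length (x :: c).
Proof.
elim: c x => [|y c IH] x; first by rewrite mul0r path_length1.
rewrite /proper_path /= => /andP[xy /IH]; rewrite -/(path_length (y :: c)).
have := min_dist_le xy; rewrite -natr1 mulrDl mul1r.
by move: (_ * _) (path_length _) (mdist _ _) => a b d; lra.
Qed.

Fixpoint paths k x y r : seq (seq X) :=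
  if k is j.+1 then
    [seq z :: c | z <- [seq z <- enum X | z != x], c <- paths j z y (r - mdist x z)]
  else if (x == y) && (r == 0) then [:: [::]] else [::].

Lemma pathsP k x y r c : reflect
  [/\ size c = k, proper_path x c, last x c = y & path_length (x :: c) = r] (c \in paths k x y r).
Proof.
apply: (iffP idP); elim: k x r c => [|k IH] x r c /=.
- case: ifP => // /andP[/eqP -> /eqP ->]; rewrite inE => /eqP ->.
  by split => //; rewrite /= addr0.
- move=> /allpairsPdep[z [d [+ /IH[dk pd dy dr] ->]]].
  rewrite mem_filter mem_enum andbT => zx; split => //=; first by rewrite dk.
    by rewrite /proper_path /= eq_sym zx.
  by rewrite -/(path_length (z :: d)) dr addrC subrK.
- by move=> [/size0nil -> _ /= -> <-]; rewrite addr0 !eqxx inE.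
- case: c => [[]//|z c [[ck] /andP[xz pc] cy cr]]; apply/allpairsPdep; exists z, c.
  split => //; first by rewrite mem_filter eq_sym xz mem_enum.
  by apply: IH; split => //; rewrite (_ : r = mdist x z + path_length (z :: c)) // addrC addKr.
Qed.

Lemma paths_uniq k x y r : uniq (paths k x y r).
Proof.
elim: k x r => [|k IH] x r /=; first by case: ifP.
apply: allpairs_uniq_dep => [|z _|]; first by rewrite filter_uniq ?enum_uniq.
  exact: IH.
by move=> [z c] [z' c'] _ _ /= [-> ->].
Qed.

Lemma paths_far k x y r : r < k%:R * min_dist -> paths k x y r = [::].
Proof.
move=> rk; apply/eqP; rewrite -size_eq0 -leqn0 leqNgt; apply/negP.
rewrite -has_predT => /hasP[c /pathsP[ck pc _ cr] _].
by have := proper_length pc; rewrite ck cr leNgt rk.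
Qed.

(* A proper path of length [r] has fewer than [depth r] steps. *)
Definition depth r := (Num.bound `|r / min_dist|).

Lemma depthP r : r < (depth r)%:R * min_dist.
Proof.
rewrite -ltr_pdivrMr ?min_dist_gt0 //; apply: le_lt_trans (ler_norm _) _.
exact: archi_boundP.
Qed.

Definition path_euler x y r : int :=
  \sum_(k < depth r) (-1) ^+ k * (size (paths k x y r))%:Z.

Lemma path_eulerE x y r K : r < K%:R * min_dist ->
  path_euler x y r = \sum_(k < K) (-1) ^+ k * (size (paths k x y r))%:Z.
Proof.
have H K1 K2 : (K1 <= K2)%N -> r < K1%:R * min_dist ->
    \sum_(k < K1) (-1) ^+ k * (size (paths k x y r))%:Z =
    \sum_(k < K2) (-1) ^+ k * (size (paths k x y r))%:Z :> int.
  move=> K12 rK; rewrite (big_ord_widen K2 (fun k => (-1) ^+ k * (size (paths k x y r))%:Z)) //.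
  rewrite [LHS]big_mkcond; apply: eq_bigr => k _; case: ltnP => // Kk.
  rewrite paths_far ?mulr0 //; apply: lt_le_trans rK _.
  by rewrite ler_pM2r ?min_dist_gt0 // ler_nat.
move=> rK; have [/H|/ltnW/H] := leqP (depth r) K; first by apply; exact: depthP.
by move=> /(_ rK).
Qed.

Lemma path_euler_rec x y r : path_euler x y r =
  ((x == y) && (r == 0))%:R - \sum_(z | z != x) path_euler z y (r - mdist x z).
Proof.
(* One extra, zero term: once the path without steps is split off, [depth r] terms remain for the
   tails, whose lengths do not exceed [r]. *)
rewrite (path_eulerE x y (K := (depth r).+1)); last first.
  by apply: lt_le_trans (depthP r) _; rewrite ler_pM2r ?min_dist_gt0 // ler_nat.
rewrite big_ord_recl expr0 mul1r /=; congr (_ + _); first by case: ifP.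
rewrite -sumrN; under eq_bigr do
  rewrite /bump /= size_allpairs_dep sumnE big_map big_filter big_enum_cond /=
      -natz natr_sum mulr_sumr.
rewrite exchange_big; apply: eq_bigr => z _ /=.
rewrite (path_eulerE _ _ (K := depth r)); last first.
  by apply: le_lt_trans (depthP r); rewrite gerBl mdist_ge0.
by rewrite -sumrN; apply: eq_bigr => k _; rewrite exprS mulN1r mulNr natz.
Qed.

Lemma path_euler_inverse x y r :
  \sum_z path_euler z y (r - mdist x z) = ((x == y) && (r == 0))%:R.
Proof. by rewrite (bigD1 x) //= mdistxx subr0 path_euler_rec subrK. Qed.

Lemma path_euler_lt0 x y r : r < 0 -> path_euler x y r = 0.
Proof.
move=> r0; rewrite (path_eulerE x y (K := 0)) ?big_ord0 //.
by rewrite mul0r.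
Qed.

Lemma path_euler_supp x y r K : path_euler x y r != 0 -> r < K%:R * min_dist ->
  exists2 c, (size c < K)%N & path_length (x :: c) = r.
Proof.
move=> + rK; rewrite (path_eulerE _ _ rK) => nz; apply: contrapT => H.
move: nz; rewrite big1 ?eqxx // => k _.
case pE : (paths k x y r) => [|c s]; first by rewrite mulr0.
have /pathsP[ck _ _ cr] : c \in paths k x y r by rewrite pE mem_head.
by case: H; exists c; rewrite ?ck.
Qed.

(** Exponents up to a given [r0] are lengths of paths with a bounded number of steps in a finite
    space, hence finite in number. *)
Lemma path_euler_wo x y : well_ordered [set r | path_euler x y r != 0]%classic.
Proof.
move=> S SA [r0 Sr0]; pose K := depth r0.
pose L := codom (fun c : K.-bseq X => path_length (x :: c)).
have fin : forall L : seq R, well_ordered [set` L]%classic.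
  elim=> [|a M IH]; first by move=> T TM [t /TM].
  apply: (@well_orderedS _ _ ([set a] `|` [set` M])%classic).
    by move=> t /=; rewrite inE => /orP[/eqP ->|]; [left|right].
  exact: well_orderedU (@well_ordered1 R a) IH.
have [||m [Sm _] mP] := fin L [set r | S r /\ r <= r0]%classic.
- move=> r [Sr rr0] /=.
  have [|c cK cr] := path_euler_supp (K := K) (SA r Sr).
    exact: le_lt_trans rr0 (depthP r0).
  by rewrite -cr; exact: (codom_f (fun c : K.-bseq X => path_length (x :: c)) (Bseq (ltnW cK))).
- by exists r0.
exists m => // r Sr; have [rr0|rr0] := leP r r0; first exact: mP.
by apply: le_trans (ltW rr0); apply: mP.
Qed.

Variable l : R.

Definition all_paths (xy : X * X) : seq (seq X) :=
  [seq c | k <- iota 0 (depth l), c <- paths k xy.1 xy.2 l].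

Lemma all_pathsP xy c : c \in all_paths xy <->
  [/\ proper_path xy.1 c, last xy.1 c = xy.2 & path_length (xy.1 :: c) = l].
Proof.
split=> [/allpairsPdep[k [d [_ /pathsP[_ ? ? ?] ->]]]//|[pc cy cl]].
apply/allpairsPdep; exists (size c), c; split => //; last exact/pathsP.
rewrite mem_iota add0n -(ltr_nat R) -(ltr_pM2r min_dist_gt0).
by apply: le_lt_trans (depthP l); rewrite -cl; exact: proper_length.
Qed.

Lemma all_paths_uniq xy : uniq (all_paths xy).
Proof.
apply: allpairs_uniq_dep => [|k _|]; [exact: iota_uniq|exact: paths_uniq|].
move=> [k c] [k' c'] /allpairsPdep[a [d [_ /pathsP[<- _ _ _] [-> cE]]]].
move=> /allpairsPdep[a' [d' [_ /pathsP[<- _ _ _] [-> cE']]]] /= e.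
have dE : d = c by [].
have dE' : d' = c' by [].
by rewrite dE dE' e.
Qed.

Definition path_cell (p : (X * X) * seq X) :=
  @ecell R X p.1 [fset q in stamp 0 p.1.1 p.2]%fset.

Definition path_cells :=
  [seq path_cell p | p <- [seq (xy, c) | xy <- enum {: X * X}, c <- all_paths xy]].

Lemma path_cellsP s : s \in path_cells <-> cell_pred l s.
Proof.
split=> [/mapP[p /allpairsPdep[xy [c [_ /all_pathsP[pc cy cl] ->]]] ->]|].
  have [|K nK] := (Cau_cellP l xy.1 xy.2 [fset q in stamp 0 xy.1 c]%fset).2.
    by exists xy.1, c.
  by exists xy, [fset q in stamp 0 xy.1 c]%fset.
move=> [xy [t [Kt nt ->]]].
have [x [c [xa cb pc cl ->]]] := (Cau_cellP l xy.1 xy.2 t).1 (conj Kt nt).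
apply/mapP; exists (xy, c); last by rewrite /path_cell /= xa.
apply/allpairsPdep; exists xy, c; split => //; first exact: mem_enum.
by apply/all_pathsP; rewrite -xa.
Qed.

Lemma path_cells_uniq : uniq path_cells.
Proof.
rewrite map_inj_in_uniq.
  apply: allpairs_uniq_dep => [|xy _|]; [exact: enum_uniq|exact: all_paths_uniq|].
  by move=> [xy c] [xy' c'] _ _ /= [-> ->].
move=> p p' /allpairsPdep[xy [c [_ /all_pathsP[pc _ _] ->]]].
move=> /allpairsPdep[xy' [c' [_ /all_pathsP[pc' _ _] ->]]].
rewrite /path_cell /= => e.
have xyE : xy = xy'.
  (* The starting vertex of the first cell carries the pair [xy] as label; its presence in the
     second cell identifies the pairs. *)
  have := congr1 (fun s => (xy, (xy.1, 0)) \in s) e; rewrite !in_ecell /= eqxx !inE.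
  have [ch ->] := stamp_head 0 xy.1 c; rewrite mem_head.
  by move=> /esym/andP[/eqP].
subst xy'; congr pair.
have : [fset q in stamp 0 xy.1 c]%fset = [fset q in stamp 0 xy.1 c']%fset.
  apply/fsetP => v; have := congr1 (fun s => (xy, v) \in s) e.
  by rewrite !in_ecell eqxx.
move=> /(fset_seq_eq (stamp_sorted 0 pc) (stamp_sorted 0 pc')).
by move=> /(congr1 (map fst)); rewrite !stamp_fst => -[].
Qed.

Lemma card_path_cell p : proper_path p.1.1 p.2 -> #|` path_cell p| = (size p.2).+1.
Proof.
move=> pc; rewrite card_ecell card_fseq undup_id.
  by rewrite -(size_map fst) stamp_fst.
exact: lt_sorted_uniq (stamp_sorted 0 pc).
Qed.

(** A path with [k] steps gives a cell with [k + 1] vertices, and the minus sign of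
    [reduced_euler_char_cells] restores [(-1)^k]. The point [x0] supplies a base point, as the wedge
    over an empty space has none. *)
Lemma reduced_euler_char_paths (x0 : X) :
  reduced_euler_char R (magnitude_homotopy_type X l) (\sum_x \sum_y path_euler x y l).
Proof.
have -> : \sum_x \sum_y path_euler x y l = - \sum_(s <- path_cells) (-1) ^+ #|` s|.
  rewrite big_map big_allpairs_dep /= big_enum -sumrN pair_bigA /=.
  apply: eq_bigr => xy _; rewrite /all_paths big_allpairs_dep /= -sumrN /path_euler.
  rewrite -(big_mkord xpredT (fun k => (-1) ^+ k * (size (paths k xy.1 xy.2 l))%:Z)).
  rewrite /index_iota subn0; apply: eq_bigr => k _.
  rewrite big_seq (eq_bigr (fun=> (-1) ^+ k.+1)); last first.
    by move=> c /pathsP[<- pc _ _]; rewrite card_path_cell.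
  rewrite -big_seq big_const_seq count_predT iter_addr_0 exprS mulN1r mulNrn opprK.
  by rewrite -mulr_natr natz.
apply: reduced_euler_char_cells x0 _; [exact: path_cellsP|exact: path_cells_uniq].
Qed.

End Paths.

(** * Magnitude *)

Section HahnTheory.
Variables (R : realType) (C : fieldType).
Local Notation hahn := (hahn R C).

Lemma hcoef_sum (I : Type) (s : seq I) (P : pred I) (F : I -> hahn) r :
  (\sum_(i <- s | P i) F i) r = \sum_(i <- s | P i) F i r.
Proof. exact: (big_morph (fun f : hahn => f r)). Qed.

Lemma hcoef_qpowM (s : {nonneg R}) (f : hahn) r : (qpow C s * f) r = f (r - s%:num).
Proof.
rewrite -[LHS]/(hconv (qpow C s) f r) /hconv.
rewrite -(@fsbig_widen _ _ _ _ [set s%:num]%classic) //.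
  by rewrite fsbig_set1 /= eqxx mul1r.
by move=> t [_ /= /eqP/negbTE ->]; rewrite mul0r.
Qed.

(** The monomial as a total function of a real exponent; the absolute value is inert on
    distances. *)
Definition qp (r : R) : hahn := qpow C (NngNum (normr_ge0 r)).

Lemma qpD (a b : R) : 0 <= a -> 0 <= b -> qp (a + b) = qp a * qp b.
Proof.
move=> a0 b0; apply/hahnP => r; rewrite hcoef_qpowM /=.
by rewrite !ger0_norm ?addr_ge0 // subr_eq [a + b]addrC.
Qed.

End HahnTheory.

Section MagnitudeCoef.
Variables (R : realType) (X : finMetricType R).
Implicit Types (x y : X).
Local Notation hahn := (hahn R R[i]).
Local Notation q := (qp R[i]).

Lemma is_hahn_path_euler x y : is_hahn (fun r => (path_euler x y r)%:~R : R[i]).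
Proof.
split=> [r r0|]; first by rewrite path_euler_lt0.
apply: (@well_orderedS _ _ [set r | path_euler x y r != 0]%classic).
  by move=> r; rewrite /hahn_support /= intr_eq0.
exact: path_euler_wo.
Qed.

Definition path_series x y : hahn := Hahn (is_hahn_path_euler x y).

Lemma path_series_inverse x y :
  \sum_z q (mdist x z) * path_series z y = (x == y)%:R.
Proof.
apply/hahnP => r; rewrite hcoef_sum.
under eq_bigr do rewrite hcoef_qpowM /= ger0_norm ?mdist_ge0 //.
rewrite -raddf_sum path_euler_inverse.
by case: eqP => _ //=; case: eqP.
Qed.

Lemma similarityE i j :
  similarity_matrix X i j = q (mdist (enum_val i) (enum_val j)).
Proof. by rewrite mxE; apply/hahnP => r /=; rewrite ger0_norm ?mdist_ge0. Qed.

Lemma similarity_inverse : similarity_matrix X *m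
  (\matrix_(i, j) path_series (enum_val i) (enum_val j)) = 1%:M.
Proof.
apply/matrixP => i j; rewrite !mxE -(inj_eq enum_val_inj) -path_series_inverse.
rewrite [RHS](big_enum_val (A := X)); apply: eq_bigr => k _.
by rewrite similarityE mxE.
Qed.

Lemma similarity_unit : similarity_matrix X \in unitmx.
Proof. by case/mulmx1_unit: similarity_inverse. Qed.

Lemma magnitudeE : magnitude X = \sum_(x : X) \sum_y path_series x y.
Proof.
rewrite /magnitude -[invmx _]mulmx1 -similarity_inverse mulKmx ?similarity_unit //.
rewrite [RHS](big_enum_val (A := X)).
apply: eq_bigr => i _; rewrite [RHS](big_enum_val (A := X)).
by apply: eq_bigr => j _; rewrite mxE.
Qed.

Lemma magnitude_coef l : magnitude X l = (\sum_(x : X) \sum_y path_euler x y l)%:~R.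
Proof.
rewrite magnitudeE hcoef_sum raddf_sum; apply: eq_bigr => x _.
by rewrite hcoef_sum raddf_sum.
Qed.

Definition weighting (w : X -> hahn) := forall x, \sum_y q (mdist x y) * w y = 1.

Lemma weighting_exists : exists w, weighting w.
Proof.
exists (fun x => \sum_y path_series x y) => x.
under eq_bigr do rewrite mulr_sumr.
rewrite exchange_big /= (eq_bigr (fun y => (x == y)%:R)); last first.
  by move=> y _; exact: path_series_inverse.
by rewrite (bigD1 x) //= eqxx big1 ?addr0 // => y; rewrite eq_sym => /negbTE ->.
Qed.

Lemma magnitude_weighting w : weighting w -> magnitude X = \sum_x w x.
Proof.
move=> ww; have eqw (i : 'I_#|X|) : (\sum_j similarity_matrix X i j * w (enum_val j) = 1).
  rewrite -[RHS](ww (enum_val i)) [RHS](big_enum_val (A := X)).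
  by apply: eq_bigr => j _; rewrite similarityE.
pose W : 'cV_#|X| := \col_i w (enum_val i).
have ZW : similarity_matrix X *m W = const_mx 1.
  apply/matrixP => i j; rewrite [LHS]mxE [RHS]mxE -(eqw i).
  by apply: eq_bigr => k _; rewrite [W k j]mxE.
have := mulKmx similarity_unit W; rewrite ZW => WE.
rewrite [RHS](big_enum_val (A := X)) /=; apply: eq_bigr => i _.
have : W i ord0 = w (enum_val i) by rewrite mxE.
rewrite -WE mxE => <-; apply: eq_bigr => j _.
by rewrite [X in _ = _ * X]mxE mulr1.
Qed.

End MagnitudeCoef.

Lemma path_euler_magnitude (R : realType) (X Y : finMetricType R) (l : R) :
  magnitude X = magnitude Y ->
  \sum_(x : X) \sum_y path_euler x y l = \sum_(x : Y) \sum_y path_euler x y l.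
Proof.
move=> /(congr1 (fun f : hahn R R[i] => f l)); rewrite !magnitude_coef => /eqP.
by rewrite eqr_int => /eqP.
Qed.

(** * Sycamore twists *)

Section WeightTransfer.
Variables (A : comNzRingType) (G H : finType) (P S : pred H).
Variables (ZG : G -> G -> A) (ZH : H -> H -> A) (cX cY : G -> H -> A).
Variables (pX pY : H -> G) (t : H -> A) (u : G -> A) (v : H -> A).
Hypothesis SP : forall y, S y -> P y.
Hypothesis ZG_sym : forall g g', ZG g g' = ZG g' g.
Hypothesis cX_star : forall g y, S y -> cX g y = ZG g (pX y) * t y.
Hypothesis cY_star : forall g y, S y -> cY g y = ZG g (pY y) * t y.
Hypothesis cXY : forall g y, P y -> ~~ S y -> cX g y = cY g y.
Hypothesis c_proj : forall y h, S y -> cX (pX y) h = cY (pY y) h.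
Hypothesis eqG : forall g, \sum_g' ZG g g' * u g' + \sum_(y | P y) cX g y * v y = 1.
Hypothesis eqH : forall z, P z -> \sum_g cX g z * u g + \sum_(y | P y) ZH z y * v y = 1.

(** [P] stands for the points of [H] off the common part, [S] for those of [H_*], [t y] for the
    monomial of the distance from [y] to its projection. The weighting of [X] is cut into [u] on [G]
    and [v] on [P]; only [u] is changed. *)
Definition twisted_weight g :=
  u g + (\sum_(y | S y && (pX y == g)) t y * v y - \sum_(y | S y && (pY y == g)) t y * v y).

Lemma sum_twisted_weight (f : G -> A) : \sum_g f g * twisted_weight g =
  \sum_g f g * u g + \sum_(y | S y) (f (pX y) - f (pY y)) * (t y * v y).
Proof.
under eq_bigr do rewrite mulrDr mulrBr.
rewrite big_split sumrB /=; congr (_ + _).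
under [RHS]eq_bigr do rewrite mulrBl.
rewrite sumrB; congr (_ - _).
  rewrite [RHS](partition_big pX predT) //=; apply: eq_bigr => g _.
  by rewrite mulr_sumr; apply: eq_bigr => y /andP[_ /eqP ->].
rewrite [RHS](partition_big pY predT) //=; apply: eq_bigr => g _.
by rewrite mulr_sumr; apply: eq_bigr => y /andP[_ /eqP ->].
Qed.

(** The defect of the old weighting at [g] in [Y], equal to the correction term of
    [sum_twisted_weight]. *)
Lemma sum_cXY g : \sum_(y | P y) cX g y * v y - \sum_(y | P y) cY g y * v y =
  \sum_(y | S y) (ZG g (pX y) - ZG g (pY y)) * (t y * v y).
Proof.
rewrite -sumrB (bigID S) /= [X in _ + X]big1 ?addr0; last first.
  by move=> y /andP[Py nS]; rewrite cXY // subrr.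
rewrite (eq_bigl S); last by move=> y; case Sy : (S y); rewrite ?andbF // SP.
by apply: eq_bigr => y Sy; rewrite cX_star // cY_star //; ring.
Qed.

Lemma twisted_eqG g :
  \sum_g' ZG g g' * twisted_weight g' + \sum_(y | P y) cY g y * v y = 1.
Proof.
rewrite sum_twisted_weight -sum_cXY -[RHS](eqG g).
by rewrite -addrA subrK.
Qed.

(** For [z] outside [S], the correction vanishes since [z] sees [pX y] in [X] as it sees [pY y] in
    [Y]. For [z] in [S], the sum over [G] is [t z] times the one at the projection of [z], which the
    equations already proved on [G] express through [v]; [c_proj] matches the two results. *)
Lemma twisted_eqH z : P z ->
  \sum_g cY g z * twisted_weight g + \sum_(y | P y) ZH z y * v y = 1.
Proof.
move=> Pz; rewrite -[RHS](eqH Pz); congr (_ + _).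
have [Sz|nSz] := boolP (S z); last first.
  rewrite (eq_bigr (fun g => cX g z * twisted_weight g)); last first.
    by move=> g _; rewrite cXY.
  rewrite sum_twisted_weight [X in _ + X]big1 ?addr0 // => y Sy.
  by rewrite (c_proj _ Sy) (cXY (pY y)) // subrr mul0r.
have -> : \sum_g cX g z * u g = t z * (1 - \sum_(y | P y) cX (pX z) y * v y).
  rewrite -(eqG (pX z)) addrK mulr_sumr; apply: eq_bigr => g _.
  by rewrite cX_star // ZG_sym; ring.
have -> : \sum_g cY g z * twisted_weight g =
    t z * (1 - \sum_(y | P y) cY (pY z) y * v y).
  rewrite -(twisted_eqG (pY z)) addrK mulr_sumr; apply: eq_bigr => g _.
  by rewrite cY_star // ZG_sym; ring.
by under [in RHS]eq_bigr do rewrite c_proj //.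
Qed.

Lemma twisted_total : \sum_g twisted_weight g = \sum_g u g.
Proof.
have := sum_twisted_weight (fun=> 1).
under eq_bigr do rewrite mul1r; move=> ->.
rewrite [X in _ + X]big1 ?addr0; last by move=> y _; rewrite subrr mul0r.
by under eq_bigr do rewrite mul1r.
Qed.

End WeightTransfer.

(** * Distances in a gluing and sums over it *)

Section GluingTheory.
Variables (R : realType) (G H K : finMetricType R) (k0 : K).
Variables (iG : isometric_embedding K G) (iH : isometric_embedding K H).
Local Notation X := (glued_space k0 iG iH).

Definition gl (g : G) : X := \pi_(gluing k0 iG iH)%qT (inl g).
Definition gr (h : H) : X := \pi_(gluing k0 iG iH)%qT (inr h).
Definition outside (h : H) := ~~ [exists k, iH k == h].

Lemma mdist_gl g g' : mdist (gl g) (gl g') = mdist g g'.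
Proof. exact: (gluing_mdistE k0 iG iH (inl g) (inl g')). Qed.

Lemma mdist_gr h h' : mdist (gr h) (gr h') = mdist h h'.
Proof. exact: (gluing_mdistE k0 iG iH (inr h) (inr h')). Qed.

Lemma mdist_glr g h : mdist (gl g) (gr h) = gluing_cross k0 iG iH g h.
Proof. exact: (gluing_mdistE k0 iG iH (inl g) (inr h)). Qed.

Lemma gl_inj : injective gl.
Proof. by move=> g g' /eqmodP/eqP. Qed.

Lemma gr_inj : injective gr.
Proof. by move=> h h' /eqmodP/eqP. Qed.

Lemma gl_eq_gr g h : (gl g == gr h) = [exists k, (iG k == g) && (iH k == h)].
Proof. by apply/eqP/idP => [/eqmodP//|gh]; apply/eqmodP. Qed.

Lemma gl_outside g h : outside h -> gl g == gr h = false.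
Proof.
move=> /existsPn oh; rewrite gl_eq_gr; apply/existsP => -[k /andP[_ kh]].
by move: (oh k); rewrite kh.
Qed.

Lemma glued_sum (A : nmodType) (F : X -> A) :
  \sum_p F p = \sum_g F (gl g) + \sum_(h | outside h) F (gr h).
Proof.
rewrite -[LHS]big_enum
  (perm_big ([seq gl g | g <- enum G] ++ [seq gr h | h <- enum H & outside h])).
  transitivity (\sum_(g <- enum G) F (gl g) + \sum_(h <- [seq h <- enum H | outside h]) F (gr h)).
    by rewrite big_cat !big_map.
  by congr (_ + _); rewrite ?big_filter ?big_enum_cond ?big_enum.
apply: uniq_perm; first exact: enum_uniq.
  rewrite cat_uniq; apply/and3P; split.
  - by rewrite map_inj_uniq ?enum_uniq //; exact: gl_inj.
  - apply/hasPn => _ /mapP[h + ->]; rewrite mem_filter => /andP[oh _].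
    by apply/negP => /mapP[g _ /eqP]; rewrite eq_sym gl_outside.
  - rewrite map_inj_uniq; first exact/filter_uniq/enum_uniq.
    exact: gr_inj.
move=> p; rewrite mem_enum mem_cat; apply/esym; rewrite [RHS]/=; apply/orP.
rewrite -[p]reprK; case: (repr p) => [g|h].
  by left; apply/mapP; exists g; rewrite ?mem_enum.
have [oh|] := boolP (outside h).
  by right; apply/mapP; exists h; rewrite // mem_filter oh mem_enum.
move=> /negPn/existsP[k /eqP kh]; left; apply/mapP; exists (iG k); first exact: mem_enum.
by apply/esym/eqP; rewrite -/(gr h) gl_eq_gr; apply/existsP; exists k; rewrite kh !eqxx.
Qed.

(** A route through any other [k'] passes through [k] without loss on the [H] side, so the triangle
    inequality in [G] makes [k] optimal. *)
Lemma gluing_cross_proj k g y :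
  (forall k', mdist (iH k') y = mdist (iH k') (iH k) + mdist (iH k) y) ->
  gluing_cross k0 iG iH g y = mdist g (iG k) + mdist (iH k) y.
Proof.
move=> proj; apply/eqP; rewrite eq_le gluing_cross_le /=.
have [k' ->] := gluing_crossE k0 iG iH g y.
rewrite (proj k') addrA lerD2r embeddingP -(embeddingP iG).
exact: metric_triangle.
Qed.

End GluingTheory.

Section Twist.
Variables (R : realType) (G H K : finMetricType R) (k0 : K).
Variables (iG : isometric_embedding K G) (iH : isometric_embedding K H).
Variables (alpha : isometric_embedding K K).
Hypothesis twist : sycamore_twisting iH alpha.
Local Notation X := (glued_space k0 iG iH).
Local Notation iHa := (embedding_comp iH alpha).
Local Notation Y := (glued_space k0 iG iHa).
Local Notation q := (qp R[i]).

Lemma outside_range h : outside iH h <-> ~ range iH h.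
Proof.
split=> [/existsPn ne [k _ kh]|nr]; first by move: (ne k); rewrite kh eqxx.
by apply/existsPn => k; apply/eqP => kh; apply: nr; exists k.
Qed.

Lemma outside_twist h : outside iHa h = outside iH h.
Proof.
have [[beta _ alphaK] _] := twist; congr (~~ _).
apply/existsP/existsP => -[k /eqP <-]; first by exists (alpha k).
by exists (beta k); rewrite /= alphaK.
Qed.

Definition star (h : H) : bool := `[< sycamore_star iH h >].

Lemma star_outside h : star h -> outside iH h.
Proof. by move=> /asboolP[nr _]; apply/outside_range. Qed.

(** The implication stands under the existential so that choice gives a total projection, with [k0]
    as value off [H_*]. *)
Lemma star_proj h : exists k, star h ->
  forall k', mdist (iH k') h = mdist (iH k') (iH k) + mdist (iH k) h.
Proof.
have [/asboolP[_ [p [k _ kp] pr]]|nS] := boolP (star h); last by exists k0.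
by exists k => _ k'; rewrite kp; apply: pr; exists k'.
Qed.

Lemma magnitude_twist : magnitude X = magnitude Y.
Proof.
have [[beta betaK alphaK] twist0] := twist.
have [pr prP] := boolp.choice star_proj.
have [w wP] := weighting_exists X.
pose u g := w (gl k0 iG iH g); pose v h := w (gr k0 iG iH h).
pose cX g h := q (gluing_cross k0 iG iH g h).
pose cY g h := q (gluing_cross k0 iG iHa g h).
(* In [Y] the point [iG k] is glued to [iH (alpha k)], so the projection [iH (pr h)] is found in [G]
   at the inverse image [beta (pr h)]. *)
pose pX h := iG (pr h); pose pY h := iG (beta (pr h)).
pose t h := q (mdist (iH (pr h)) h).
pose ZG (g g' : G) := q (mdist g g'); pose ZH (h h' : H) := q (mdist h h').
have ZG_sym g g' : ZG g g' = ZG g' g by rewrite /ZG metric_sym.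
have cX_star g y : star y -> cX g y = ZG g (pX y) * t y.
  by move=> Sy; rewrite /cX (gluing_cross_proj k0 iG g (prP _ Sy)) qpD ?mdist_ge0.
have cY_star g y : star y -> cY g y = ZG g (pY y) * t y.
  move=> Sy.
  rewrite /cY (gluing_cross_proj k0 iG g (iH := iHa) (k := beta (pr y))) /= ?alphaK;
    last first.
    by move=> k'; exact: prP.
  by rewrite qpD ?mdist_ge0.
(* Such a [y] is in [H_0], where the hypothesis on [alpha] makes the two minima agree term by
   term. *)
have cXY g y : outside iH y -> ~~ star y -> cX g y = cY g y.
  move=> Py nS; congr q; rewrite /gluing_cross.
  have zero : sycamore_zero iH y.
    by move=> [/(outside_range y).1|Sy]; [|by move: nS => /negP; apply; apply/asboolP].
  have FE k : mdist g (iG k) + mdist (iH k) y = mdist g (iG k) + mdist (iHa k) y.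
    by rewrite /= metric_sym (metric_sym (iH k)) twist0 // metric_sym (metric_sym y).
  by rewrite FE; apply: eq_bigr => k _; exact: FE.
(* Both sides are the monomial of the distance in [H] from [iH (pr y)] to [h]. *)
have c_proj y h : star y -> cX (pX y) h = cY (pY y) h.
  by move=> _; rewrite /cX /cY !gluing_crossl /= alphaK.
have eqG g : \sum_g' ZG g g' * u g' + \sum_(y | outside iH y) cX g y * v y = 1.
  rewrite -[RHS](wP (gl k0 iG iH g)) glued_sum; congr (_ + _); apply: eq_bigr => y _.
    by rewrite mdist_gl.
  by rewrite mdist_glr.
have eqH z : outside iH z ->
    \sum_g cX g z * u g + \sum_(y | outside iH y) ZH z y * v y = 1.
  move=> _; rewrite -[RHS](wP (gr k0 iG iH z)) glued_sum; congr (_ + _); apply: eq_bigr => y _.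
    by rewrite metric_sym mdist_glr.
  by rewrite mdist_gr.
pose u' := twisted_weight star pX pY t u v.
(* Points of the common part have preimages on both sides; trying [G] first gives them the twisted
   weight. *)
pose w' (p : Y) := if [pick g | gl k0 iG iHa g == p] is Some g then u' g else
  if [pick h | gr k0 iG iHa h == p] is Some h then v h else 0.
have w'gl g : w' (gl k0 iG iHa g) = u' g.
  rewrite /w'; case: pickP => [g' /eqP/gl_inj -> //|/(_ g)].
  by rewrite eqxx.
have w'gr h : outside iH h -> w' (gr k0 iG iHa h) = v h.
  move=> oh; rewrite /w'; case: pickP => [g|_]; first by rewrite gl_outside ?outside_twist.
  by case: pickP => [h' /eqP/gr_inj -> //|/(_ h)]; rewrite eqxx.
have oE := outside_twist.
have w'P : weighting w'.
  move=> p; have [[g ->]|[z Pz ->]] : (exists g, p = gl k0 iG iHa g) \/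
      exists2 z, outside iH z & p = gr k0 iG iHa z.
    rewrite -[p]reprK; case: (repr p) => [g|z]; first by left; exists g.
    have [oz|] := boolP (outside iHa z); first by right; exists z; rewrite -?oE.
    move=> /negPn/existsP[k /eqP kz]; left; exists (iG k); apply/esym/eqP.
    by rewrite -/(gr k0 iG iHa z) gl_eq_gr; apply/existsP; exists k; rewrite kz !eqxx.
  - rewrite -[RHS](twisted_eqG star_outside cX_star cY_star cXY eqG g) glued_sum.
    congr (_ + _); first by apply: eq_bigr => g' _; rewrite mdist_gl w'gl.
    apply: eq_big => [y|y]; first by rewrite oE.
    by rewrite oE => Py; rewrite mdist_glr w'gr.
  rewrite -[RHS](twisted_eqH star_outside ZG_sym cX_star cY_star cXY c_proj eqG eqH Pz).
  rewrite glued_sum; congr (_ + _).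
    by apply: eq_bigr => g _; rewrite metric_sym mdist_glr w'gl.
  apply: eq_big => [y|y]; first by rewrite oE.
  by rewrite oE => Py; rewrite mdist_gr w'gr.
rewrite (magnitude_weighting wP) (magnitude_weighting w'P) !glued_sum.
congr (_ + _); last by apply: eq_big => [y|y oy]; rewrite ?oE ?w'gr.
rewrite -(twisted_total star pX pY t u v).
by apply: eq_bigr => g _; rewrite w'gl.
Qed.

End Twist.

Theorem corollary5p21 (R : realType) (G H K : finMetricType R) (k0 : K)
    (iG : isometric_embedding K G) (iH : isometric_embedding K H)
    (alpha : isometric_embedding K K) (twist : sycamore_twisting iH alpha) :
  let X := glued_space k0 iG iH in
  let Y := glued_space k0 iG (embedding_comp iH alpha) in
  (forall l : R, 0 <= l -> exists chi : int,
     reduced_euler_char R (magnitude_homotopy_type X l) chi /\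
     reduced_euler_char R (magnitude_homotopy_type Y l) chi) /\
  magnitude X = magnitude Y.
Proof.
have magXY := magnitude_twist k0 iG twist.
move=> X Y; split=> // l _; exists (\sum_(x : X) \sum_y path_euler x y l); split.
  exact: reduced_euler_char_paths l (gl k0 iG iH (iG k0)).
rewrite (path_euler_magnitude l magXY).
exact: reduced_euler_char_paths l (gl k0 iG (embedding_comp iH alpha) (iG k0)).
Qed.
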